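(* Let $k\ge1$, $D=(d_1,\dots,d_{k+1})\in\mathbb Z_{\ge0}^{k+1}$ with $d_{k+1}\le1$, and put $2\alpha_i=d_{k+1}+\cdots+d_{i+1}$, $i=1,\dots,k$. Then $$\mathrm{ch}\,L^D=\frac{q^{-p(D)/4}}{(\infty)_q}\sum_{\substack{i_1,\dots,i_k\\ i_l+\alpha_l\in\mathbb Z,\ l=1,\dots,k\\ i_l\ge i_{l-1}-\frac{d_l}2,\ l=2,\dots,k}}\frac{z^{\sum_{l=1}^ki_l}\,q^{\sum_{l=1}^ki_l^2}}{\prod_{l=1}^{k-1}\bigl(i_{l+1}-i_l+\tfrac{d_{l+1}}2\bigr)_q!}.$$
   Context: Notation: $(m)_q!=\prod_{i=1}^m(1-q^i)$ for integers $m\ge0$, $(\infty)_q=\prod_{i=1}^\infty(1-q^i)$. $p(D)$ is the number of $i\in\{1,\dots,k\}$ with $\alpha_i\in\mathbb Z+\frac12$. The fermionic space $F$: let $\psi(i),\phi(i)$, $i\in\mathbb Z$, be mutually anticommuting variables with zero squares. $F$ is the complex vector space with basis the semi-infinite monomials $\dots\psi(N-1)\phi(N-1)\psi(N)\phi(N)\,\psi(i_1)\cdots\psi(i_s)\,\phi(j_1)\cdots\phi(j_t)$, $N<i_1<\dots<i_s$, $N<j_1<\dots<j_t$. $\psi(i),\phi(i)$ act by right multiplication. Put $e_m=\sum_{i+j=m}\psi(i)\phi(j)$; these commute and act on $F^{\otimes k}$ by the coproduct. Put $v(2N)=\dots\psi(N-1)\phi(N-1)\psi(N)$, $v(2N+1)=\dots\psi(N-1)\phi(N-1)\psi(N)\phi(N)$.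 The grading operators $h_0$ and $d$ act diagonally on monomials of $F$: $h_0v(0)=dv(0)=0$, $[h_0,\psi(i)]=\psi(i)$, $[h_0,\phi(i)]=\phi(i)$, $[d,\psi(i)]=i\psi(i)$, $[d,\phi(i)]=i\phi(i)$; they act on $F^{\otimes k}$ additively (so $[d,e_m]=me_m$, $[h_0,e_m]=2e_m$, and $v(0),v(1)$ have $d$-degree $0$). Definition of $L^D$: let $n=d_1+\cdots+d_{k+1}$ and $\beta_i=d_{i+1}+\cdots+d_{k+1}=2\alpha_i$. For $s\ge1$ put $$w_s=v(-\beta_1-2s)\otimes\cdots\otimes v(-\beta_k-2s),\qquad M_s=\mathbb C[e_{-(n+2s)+1},\dots,e_{-1},e_0]\,w_s\subset F^{\otimes k}.$$ These form an increasing chain and $L^D=\bigcup_{s\ge1}M_s$ (an $\widehat{\mathfrak{sl}}_2$-submodule of $F^{\otimes k}$, bigraded by $h_0$ and $d$). Its character is $\mathrm{ch}\,L^D=\mathrm{Tr}_{L^D}\,q^dz^{h_0/2}$. *)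

(* Defs.v *)
From HB Require Import structures.
From mathcomp Require Import all_boot all_order all_algebra finmap.
From mathcomp Require Import all_classical reals.
From mathcomp Require Import complex.
From mathcomp Require Import freeg.

Set Implicit Arguments.
Unset Strict Implicit.
Unset Printing Implicit Defensive.

Import Order.TTheory GRing.Theory Num.Theory.

Local Open Scope classical_set_scope.
Local Open Scope fset_scope.
Local Open Scope ring_scope.

(* The variables psi(i), phi(i) are numbered by the integers, psi(i) having
   number 2i and phi(i) number 2i + 1.  A semi-infinite monomial is determined,
   up to a sign, by the set of numbers of the variables that occur in it; this
   set contains all sufficiently negative integers and is bounded above.  It is
   encoded by its (finite) symmetric difference with {u | u <= 0}, the set of
   v(0).  As basis vector we take the monomial whose variables are written in
   increasing order of their numbers,
     ... psi(-1) phi(-1) psi(0) phi(0) psi(1) phi(1) ...,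
   which is +1 or -1 times the monomial with the psi's sorted before the
   phi's. *)
Definition monomial : choiceType := {fset int}.

Definition occurs (b : monomial) (u : int) : bool := (u <= 0) (+) (u \in b).

Definition adjoin (b : monomial) (u : int) : monomial :=
  if u <= 0 then b `\ u else u |` b.

(* the variables over which a variable u multiplied on the right of b has to
   move in order to reach its place *)
Definition above (b : monomial) (u : int) : {fset int} :=
  fset_set [set t : int | u < t /\ occurs b t].

(* v m contains the variables number u <= m: its last variable is psi(N) if
   m = 2N and phi(N) if m = 2N + 1. *)
Definition v (m : int) : monomial :=
  fset_set [set u : int | (u <= m) != (u <= 0)].

Definition fock (K : fieldType) : lmodType K := {freeg monomial / K}.

Section FockOperators.
Variable K : fieldType.
Local Notation F := (fock K).

Definition rmul_var (u : int) : F -> F :=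
  fglift (fun b : monomial =>
    if occurs b u then 0 : F
    else << (-1) ^+ #|` above b u| *g adjoin b u >>).

Definition psi (i : int) : F -> F := rmul_var (2 * i).
Definition phi (i : int) : F -> F := rmul_var (2 * i + 1).

(* operators act on the right: x psi(i) phi(j) = phi j (psi i x); for each x
   only finitely many terms are nonzero *)
Definition e (m : int) (x : F) : F :=
  \sum_(i \in [set: int]) phi (m - i) (psi i x).

Definition charge (b : monomial) : int :=
  \sum_(u <- b) (if 0 < u then 1 else -1).

(* (u %/ 2)%Z, rounded down, is the i such that u is the number of psi(i) or
   phi(i) *)
Definition energy (b : monomial) : int :=
  \sum_(u <- b) (if 0 < u then (u %/ 2)%Z else - (u %/ 2)%Z).

Definition h0 : F -> F :=
  fglift (fun b : monomial => << (charge b)%:~R *g b >> : F).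
Definition d : F -> F :=
  fglift (fun b : monomial => << (energy b)%:~R *g b >> : F).

End FockOperators.

(* The k-th tensor power of the Fock space: the basis vector indexed by b is
   b 0 (x) ... (x) b (k-1). *)
Definition tfock (K : fieldType) (k : nat) : lmodType K :=
  {freeg {ffun 'I_k -> monomial} / K}.

Section TensorPower.
Variables (K : fieldType) (k : nat).

(* 1 (x) ... (x) T (x) ... (x) 1 with T at place l; no Koszul signs, since it
   is only used for the even operators e m, h0 and d *)
Definition at_factor (l : 'I_k) (T : fock K -> fock K) :
    tfock K k -> tfock K k :=
  fglift (fun b : {ffun 'I_k -> monomial} =>
    fglift (fun c : monomial =>
        << [ffun j => if j == l then c else b j] >> : tfock K k)
      (T << b l >>)).

Definition coprod (T : fock K -> fock K) (x : tfock K k) : tfock K k :=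
  \sum_(l < k) at_factor l T x.

End TensorPower.

Definition lspan (K : fieldType) (V : lmodType K) (G : set V) : set V :=
  [set x | exists (n : nat) (c : 'I_n -> K) (g : 'I_n -> V),
     (forall i, G (g i)) /\ x = \sum_(i < n) c i *: g i].

Definition has_dim (K : fieldType) (V : lmodType K) (W : set V) (N : nat) :
    Prop :=
  exists g : 'I_N -> V,
    (forall c : 'I_N -> K, \sum_(i < N) c i *: g i = 0 -> forall i, c i = 0) /\
    (forall x, W x <-> exists c : 'I_N -> K, x = \sum_(i < N) c i *: g i).

(* The entries of D = (d_1, ..., d_(k+1)) and the tensor factors are numbered
   from 0: d_j is nth 0 D j.-1, and beta_(l+1), alpha_(l+1) are beta D l and
   alpha D l. *)
Section LD.
Variables (K : fieldType) (k : nat) (D : k.+1.-tuple nat).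

Definition beta (l : nat) : nat := \sum_(l.+1 <= j < k.+1) nth 0%N D j.

Definition w (s : nat) : tfock K k :=
  << [ffun l : 'I_k => v (- (beta l)%:Z - (2 * s)%:Z)] >>.

Definition M (s : nat) : set (tfock K k) :=
  lspan [set x | exists ms : seq int,
    all (fun m : int => - (sumn D + 2 * s)%:Z + 1 <= m <= 0) ms /\
    x = foldr (fun m => coprod (e m)) (w s) ms].

Definition LD : set (tfock K k) :=
  \bigcup_(s in [set s : nat | (1 <= s)%N]) M s.

End LD.

Section Character.
Variables (K : fieldType) (k : nat).

Definition has_weight (a b : rat) (x : tfock K k) : Prop :=
  coprod (@d K) x = ratr a *: x /\ 2^-1 *: coprod (@h0 K) x = ratr b *: x.

(* Tr_L q^d z^(h_0/2) = \sum_(a, b) c a b * q^a * z^b: the space L is the sum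
   of its weight spaces, and these have the finite dimensions c a b. *)
Definition is_character (L : set (tfock K k)) (c : rat -> rat -> rat) : Prop :=
  (forall x, L x ->
     lspan [set y | L y /\ exists a b : rat, has_weight a b y] x) /\
  (forall a b : rat, exists N : nat,
     has_dim [set x | L x /\ has_weight a b x] N /\ c a b = N%:R).

End Character.

(* Formal power series in q are represented by their coefficient functions. *)
Definition fps : Type := nat -> rat.

Definition fps_of_poly (p : {poly rat}) : fps := fun n => p`_n.

Definition fps_mul (f g : fps) : fps :=
  fun n => \sum_(i < n.+1) f i * g (n - i)%N.

Fixpoint fps_inv_seq (f : fps) (n : nat) : seq rat :=
  if n is n'.+1 then
    let s := fps_inv_seq f n' in
    rcons s (- (f 0%N)^-1 * \sum_(i < n) f (n - i)%N * s`_i)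
  else [:: (f 0%N)^-1].

Definition fps_inv (f : fps) : fps := fun n => (fps_inv_seq f n)`_n.

Lemma size_fps_inv_seq (f : fps) n : size (fps_inv_seq f n) = n.+1.
Proof. by elim: n => //= n IHn; rewrite size_rcons IHn. Qed.

Lemma nth_fps_inv_seq (f : fps) n i : (i <= n)%N -> (fps_inv_seq f n)`_i = fps_inv f i.
Proof.
elim: n => [|n IHn]; first by rewrite leqn0 => /eqP ->.
rewrite leq_eqVlt => /orP[/eqP -> //|lt_in].
by rewrite -IHn //= nth_rcons size_fps_inv_seq lt_in.
Qed.

Lemma fps_mulV (f : fps) : f 0%N != 0 -> fps_mul f (fps_inv f) =1 fps_of_poly 1.
Proof.
move=> f0 [|n]; rewrite /fps_mul /fps_of_poly coef1.
  by rewrite big_ord1 /fps_inv /= mulfV.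
rewrite big_ord_recl /= {1}/fps_inv /= nth_rcons size_fps_inv_seq ltnn eqxx.
rewrite mulNr mulrN mulrA mulfV // mul1r (reindex_inj rev_ord_inj) /=.
apply/eqP; rewrite addrC subr_eq0; apply/eqP/eq_bigr => i _.
by rewrite nth_fps_inv_seq ?subSS ?leq_subr // -subSS subKn // /bump add1n subSS.
Qed.

(* (m)_q! *)
Definition qfact (m : nat) : {poly rat} := \prod_(1 <= i < m.+1) (1 - 'X^i).

(* (oo)_q: the factors 1 - q^i with i > n do not change the coefficient of
   q^n *)
Definition qinfty : fps := fun n => (qfact n)`_n.

(* the coefficient of q^a * z^b in q^a0 * z^b0 * f(q) *)
Definition qz_term (a0 b0 : rat) (f : fps) (a b : rat) : rat :=
  if (b == b0) && (a - a0 \is a Num.nat) then f (Num.truncn (a - a0)) else 0.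

Section Formula.
Variables (k : nat) (D : k.+1.-tuple nat).

Definition alpha (l : nat) : rat := (beta D l)%:R / 2.

Definition pD : nat := #|[pred l : 'I_k | alpha l - 2^-1 \is a Num.int]|.

Definition indices : set (k.-tuple rat) :=
  [set i | (forall l : 'I_k, tnth i l + alpha l \is a Num.int) /\
           (forall l : nat, (l.+1 < k)%N ->
              i`_l - (nth 0%N D l.+1)%:R / 2 <= i`_l.+1)].

Definition denominator (i : k.-tuple rat) : fps :=
  fps_mul qinfty (fps_of_poly
    (\prod_(0 <= l < k.-1)
        qfact (Num.truncn (i`_l.+1 - i`_l + (nth 0%N D l.+1)%:R / 2)))).

(* for given a and b only finitely many terms are nonzero, since
   \sum_l i_l^2 <= a + p(D)/4 in such a term *)
Definition ch_formula (a b : rat) : rat :=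
  \sum_(i \in indices)
    qz_term (\sum_(l < k) tnth i l ^+ 2 - pD%:R / 4) (\sum_(l < k) tnth i l)
            (fps_inv (denominator i)) a b.

End Formula.

(* Main.v *)
(* For charges c let w(c) be the tensor product of the v(c_l), and let
   N(c) = C[e_m, m in Z] w(c).  Multiplication by the first variable missing
   from the last factor commutes with all e_m, maps w(c) to w(c + eps_k), and
   kills the submodule N(c + 2) of N(c) generated by the lowest coefficient of
   e(z)^k w(c); hence
      dim N(c) >= dim N(c + eps_k) + dim N(c + 2)
   in each degree.  Conversely e(z)^2 = 0 on F gives e(z)^(k+1) = 0 on the
   tensor power, modulo which e(x)^j e(z)^k is divisible by (x - z)^(2j); these
   relations, together with the lowest powers of z in the e(z)^j w(c), give
   the opposite inequality.  The recursion obtained is that of the fermionic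
   sum over N_k <= ... <= N_1 of q^(sum N_l (N_l - 1) + b_l N_l) divided by
   (N_k)_q! (N_(k-1) - N_k)_q! ....  As s grows, these sums for w_s tend to the
   right hand side with z replaced by 1/z.  Finally sl_2-symmetry, in the form
   of the injectivity of e_0^n from h_0-weight -n to h_0-weight n, exchanges z
   and 1/z. *)

Require Import Defs.
From HB Require Import structures.
From mathcomp Require Import all_boot all_order all_algebra finmap.
From mathcomp Require Import all_classical reals.
From mathcomp Require Import complex.
From mathcomp Require Import freeg.
From mathcomp Require Import zify ring.

Set Implicit Arguments.
Unset Strict Implicit.
Unset Printing Implicit Defensive.

Import Order.TTheory GRing.Theory Num.Theory.

(** * Fermionic counting function *)

(** The upper bound is an argument about ideals: with u the lowest coefficient of e(z)^k, a quotient
    by P splits into those by P + (u) and by the colon ideal (P : u). The former satisfies the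
    relations with its first threshold raised by one, the latter those with all thresholds raised by
    two. The lower bound follows the same two branches, so one recursion of [chi] serves both. All
    modes occur there, while M_s has only modes m <= 0; for large s the coefficients of e(z)^(k+1) =
    0 trade a positive mode on w_s for nonpositive ones on w_(s'), s' > s. No limit of dimensions is
    taken: in a fixed weight the sums equal the stated formula exactly once s is large. Injectivity
    of powers of e_0 gives only one inequality between opposite weights. The lowering operator f_0
    is built on the whole tensor power, and of L^D only stability under e_0 enters. The reverse
    inequality comes from the charges +beta: the same formula computes their space with opposite
    h_0-weights, so the inequality for them reads backwards on L^D. *)

Fixpoint npart (m n : nat) : nat :=
  if m is m'.+1 then \sum_(i < n.+1 | m'.+1 %| i) npart m' (n - i)
  else (n == 0).

(** As [npart m] lists the coefficients of 1/(m)_q!, this is 1/(m+1)_q! = 1/(m)_q! +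
    q^(m+1)/(m+1)_q!. *)
Lemma npartS m n :
  npart m.+1 n = npart m n + (if m < n then npart m.+1 (n - m.+1) else 0).
Proof.
rewrite /= (bigD1 ord0) ?dvdn0 //= subn0; congr (_ + _).
have [lt_mn|le_nm] := ltnP m n; last first.
  rewrite big1 // => i /andP[dv i0].
  have i_gt0 : 0 < i by rewrite lt0n; apply: contra i0 => /eqP i0; apply/eqP/val_inj.
  by have := dvdn_leq i_gt0 dv; have := ltn_ord i; lia.
transitivity (\sum_(0 <= i < n.+1 | (m.+1 %| i) && (0 < i)) npart m (n - i)).
  rewrite big_mkord; apply: eq_bigl => i; congr andb.
  by rewrite lt0n; congr negb; apply/eqP/eqP => [->|i0] //; apply/val_inj.
rewrite (@big_cat_nat _ _ _ m.+1) //=; last lia.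
rewrite big_nat_cond big1 => [|i /andP[/andP[_ im] /andP[dv i0]]]; last first.
  by have := dvdn_leq i0 dv; rewrite leqNgt im.
rewrite add0n -{1}(add0n m.+1) big_addn -(big_mkord (fun i => m.+1 %| i) (fun i => npart m (n - m.+1 - i))).
rewrite subSn //; apply: congr_big_nat => //.
  by move=> i _; rewrite dvdn_addl // addnS andbT.
by move=> i /andP[_ _]; congr npart; lia.
Qed.

(* The coefficient of q^E in the sum, over t <= N_0 <= N_1 <= ... with
   N_0 + N_1 + ... = r, of q^(sum N_l (N_l - 1) + b_l N_l) divided by
   (N_0 - t)_q! (N_1 - N_0)_q! ...; the entry b_0 belongs to the last tensor
   factor. *)
Fixpoint chi (b : seq nat) (t r E : nat) : nat :=
  if b is b0 :: b' then
    \sum_(N < r.+1 | t <= N)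
      \sum_(y < E.+1 | N * N.-1 + b0 * N + y <= E)
        npart (N - t) y * chi b' N (r - N) (E - (N * N.-1 + b0 * N + y))
  else (r == 0) && (E == 0).

(* the sums in [chi] may run over any long enough range *)
Lemma chi_consE B B' b0 b t r E : r < B -> E < B' ->
  chi (b0 :: b) t r E =
  \sum_(N < B | t <= N <= r)
    \sum_(y < B' | N * N.-1 + b0 * N + y <= E)
      npart (N - t) y * chi b N (r - N) (E - (N * N.-1 + b0 * N + y)).
Proof.
move=> rB EB /=.
rewrite -(big_mkord (fun N => t <= N) (fun N => \sum_(y < E.+1 | N * N.-1 + b0 * N + y <= E)
        npart (N - t) y * chi b N (r - N) (E - (N * N.-1 + b0 * N + y)))).
rewrite (big_nat_widen _ _ _ _ _ rB) big_mkord.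
apply: eq_big => [N|N _]; first by rewrite ltnS.
rewrite -(big_mkord (fun y => N * N.-1 + b0 * N + y <= E) (fun y => 
        npart (N - t) y * chi b N (r - N) (E - (N * N.-1 + b0 * N + y)))).
rewrite (big_nat_widen _ _ _ _ _ EB) big_mkord.
by apply: eq_bigl => y; apply/andP/idP => [[]//|h]; split; lia.
Qed.

(** Every N_l is at least t, so the linear terms b_l N_l alone already exceed E. *)
Lemma chi_eq0 b t r E : E < t * sumn b -> chi b t r E = 0.
Proof.
elim: b t r E => [|b0 b IH] t r E /=; first by rewrite muln0.
move=> h; rewrite big1 // => N tN; rewrite big1 // => y hy.
by rewrite IH ?muln0 //; nia.
Qed.

Lemma chi_eq0_size b t r E : r < t * size b -> chi b t r E = 0.
Proof.
elim: b t r E => [|b0 b IH] t r E /=; first by rewrite muln0.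
move=> h; rewrite big1 // => N tN; rewrite big1 // => y hy.
by rewrite IH ?muln0 //; have := ltn_ord N; nia.
Qed.

(** N_0 >= 1 forces all N_l >= 1 and hence an exponent of at least the sum of b; what survives is
    N_0 = 0, whose denominator is (0)_q! = 1. *)
Lemma chi_trunc b0 b r E : E < sumn (b0 :: b) -> chi (b0 :: b) 0 r E = chi b 0 r E.
Proof.
move=> h /=; rewrite (bigD1 ord0) //= [X in _ + X]big1 ?addn0 => [|N N0]; last first.
  rewrite big1 // => y hy; rewrite chi_eq0 ?muln0 //.
  have : 0 < N by rewrite lt0n; apply: contra N0 => /eqP N0; apply/eqP/val_inj.
  by move: h => /=; nia.
rewrite (bigD1 ord0) //= ?muln0 //= [X in _ + X]big1 => [|y /andP[_ y0]].
  by rewrite !subn0 mul1n addn0.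
by rewrite -val_eqE /= in y0; rewrite (negPf y0) mul0n.
Qed.

(** Substitute N_l + 1 for N_l: the exponent (N + 1) N + b (N + 1) equals N (N - 1) + (b + 2) N +
    b. *)
Lemma chi_shift b t r E :
  chi b t.+1 (r + size b) (E + sumn b) = chi [seq x.+2 | x <- b] t r E.
Proof.
elim: b t r E => [|b0 b IH] t r E; first by rewrite /= !addn0.
have sumn2 : sumn [seq x.+2 | x <- b] = sumn b + (size b).*2.
  by elim: (b) => //= x s ->; lia.
rewrite (@chi_consE (r + (size b).+1).+2 (E + (b0 + sumn b)).+1) //= ?ltnS //.
rewrite -/(chi (b0.+2 :: [seq x.+2 | x <- b]) t r E).
rewrite (@chi_consE (r + (size b).+1).+1 (E + (b0 + sumn b)).+1) //=; try lia.
rewrite big_mkcond big_ord_recl /= add0n -big_mkcondr /= [RHS]big_mkcond [LHS]big_mkcond.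
apply: eq_bigr => N _; rewrite /bump /= !add1n /= ltnS subSS.
case tN: (t <= N) => //=.
have [le_Nr|lt_rN] := leqP N r; last first.
  case: ifP => // hN; rewrite big1 // => y hy.
  by rewrite chi_eq0_size ?muln0 //; lia.
rewrite ifT; last lia.
rewrite big_mkcond [RHS]big_mkcond; apply: eq_bigr => y _.
have eX : N.+1 * N + b0 * N.+1 + y = N * N.-1 + b0.+2 * N + y + b0.
  by case: (nat_of_ord N) => [|M] /=; nia.
rewrite add0n eX; set X := N * _ + _ + y.
have [le_XE|lt_EX] := leqP X E.
  rewrite ifT; last lia.
  have -> : r + (size b).+1 - N.+1 = (r - N) + size b by lia.
  have -> : E + (b0 + sumn b) - (X + b0) = E - X + sumn b by lia.
  by rewrite IH.
case: ifP => // h; rewrite chi_eq0 ?muln0 //; nia.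
Qed.

(** For N_0 >= 1 write 1/(N_0)_q! = q^(N_0)/(N_0)_q! + 1/(N_0 - 1)_q!. The factor q^(N_0) raises b_0
    by one; the remaining sum is the one with t = 1, to which [chi_shift] applies. *)
Lemma chi_rec b0 b r E :
  chi (b0 :: b) 0 r E = chi (b0.+1 :: b) 0 r E +
    (if (size (b0 :: b) <= r) && (sumn (b0 :: b) <= E)
     then chi [seq x.+2 | x <- b0 :: b] 0 (r - size (b0 :: b)) (E - sumn (b0 :: b))
     else 0).
Proof.
set rest := if _ then _ else _.
have -> : rest = chi (b0 :: b) 1 r E.
  rewrite /rest; case: ifP => [/andP[hs hE]|/negbT].
    by rewrite -chi_shift !subnK.
  rewrite negb_and -!ltnNge => /orP[hs|hE]; first by rewrite chi_eq0_size ?mul1n.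
  by rewrite chi_eq0 ?mul1n.
rewrite [LHS](@chi_consE r.+1 E.+1) // (@chi_consE r.+1 E.+1 b0.+1) //.
rewrite (@chi_consE r.+1 E.+1 b0 b 1) // [X in _ = _ + X]big_mkcond /=.
rewrite [X in _ = _ + X](eq_bigr (fun N : 'I_r.+1 => if 0 < N then
   \sum_(y < E.+1 | N * N.-1 + b0 * N + y <= E)
      npart (N - 1) y * chi b N (r - N) (E - (N * N.-1 + b0 * N + y)) else 0)); last first.
  by move=> N _; have := ltn_ord N; rewrite ltnS => ->; rewrite andbT.
rewrite [LHS]big_mkcond [X in _ = X + _]big_mkcond -big_split /=.
apply: eq_bigr => N _; have := ltn_ord N; rewrite ltnS => -> /=; rewrite subn0.
case: (posnP N) => [-> /=|N_gt0].
  by rewrite !muln0 !addn0.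
case: N N_gt0 => [[//|N] hN] _ /=; rewrite subn1 [N.+1.-1]/=.
set x := r - N.+1.
pose f y := chi b N.+1 x (E - (N.+1 * N + b0 * N.+1 + y)).
have eq1 y : npart N.+1 y * f y = npart N y * f y + (if N < y then npart N.+1 (y - N.+1) * f y else 0).
  by rewrite npartS mulnDl; case: ifP.
under eq_bigr => y _ do rewrite -/(f y) eq1.
rewrite big_split /= addnC; congr (_ + _).
have := @big_mkord nat 0 addn E.+1 (fun y => N.+1 * N + b0 * N.+1 + y <= E)
  (fun y => if N < y then npart N.+1 (y - N.+1) * f y else 0) => <-.
have [lt_NE|le_EN] := ltnP N E; last first.
  rewrite big_nat_cond !big1 // => [y hy|y /andP[/andP[_ hy] _]]; first by nia.
  by rewrite ifF //; lia.
rewrite (@big_cat_nat _ _ _ N.+1) //=; last lia.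
rewrite big_nat_cond big1 => [|y /andP[/andP[_ hy] _]]; last first.
  by rewrite ifF //; lia.
rewrite add0n -{1}(add0n N.+1) big_addn.
rewrite -(big_mkord (fun y => N.+1 * N + b0.+1 * N.+1 + y <= E) (fun y => npart N.+1 y * chi b N.+1 x (E - (N.+1 * N + b0.+1 * N.+1 + y)))).
rewrite [RHS](@big_cat_nat _ _ _ (E.+1 - N.+1)) //=; last lia.
rewrite [X in _ = _ + X]big_nat_cond [X in _ = _ + X]big1 => [|y /andP[/andP[hy _] h]]; last by nia.
rewrite addn0; apply: congr_big_nat => //.
  by move=> y _; congr (_ <= _); lia.
move=> y _; rewrite ifT; last lia.
by rewrite addnK /f; congr (_ * chi _ _ _ (_ - _)); lia.
Qed.

Local Open Scope ring_scope.

(** * Upper bound from the relations *)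

(** Both sides run over all triples of natural numbers with sum S. *)
Lemma triangle_sum (V : nmodType) (S : nat) (G : nat -> nat -> nat -> V) :
  \sum_(p < S.+1) \sum_(m < p.+1) G m (p - m)%N (S - p)%N =
  \sum_(m < S.+1) \sum_(p < (S - m).+1) G m p (S - m - p)%N.
Proof.
transitivity (\sum_(p < S.+1) \sum_(m < S.+1 | (m <= p)%N) G m (p - m)%N (S - p)%N).
  apply: eq_bigr => p _.
  rewrite -(big_mkord xpredT (fun m => G m (p - m)%N (S - p)%N)).
  rewrite (big_nat_widen _ _ S.+1) ?ltn_ord // big_mkord.
  by apply: eq_bigl => m; rewrite ltnS.
rewrite (exchange_big_dep xpredT) //=; apply: eq_bigr => m _.
rewrite -(big_mkord (fun p => m <= p)%N (fun p => G m (p - m)%N (S - p)%N)).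
rewrite (@big_cat_nat _ _ _ m) //=; last by have := ltn_ord m; lia.
rewrite big_nat_cond big1 => [|p /andP[/andP[_ h] h']]; last by lia.
rewrite add0r -{1}(add0n (m : nat)) big_addn subSn ?leq_ord // big_mkord.
by apply: eq_big => [p|p _]; [lia | rewrite addnK -subnDA addnC].
Qed.

Section PowerCoefficients.
Variables (A : comNzRingType) (e : nat -> A).

(** The coefficient of z^n in e(z)^j, where e(z) is the power series with coefficients e i. Only
    finitely many modes enter it, so [ecE] may compute it with a polynomial. *)
Fixpoint ec (j n : nat) : A :=
  if j is j'.+1 then \sum_(i < n.+1) e i * ec j' (n - i) else (n == 0%N)%:R.

Lemma ecE N j n : (n < N)%N -> ec j n = ((\poly_(i < N) e i) ^+ j)`_n.
Proof.
elim: j n => [|j IH] n nN /=; first by rewrite expr0 coef1.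
rewrite exprS coefM; apply: eq_bigr => i _; have := ltn_ord i; rewrite ltnS => le_in.
by rewrite coef_poly (leq_ltn_trans le_in nN) IH // (leq_ltn_trans (leq_subr _ _)).
Qed.

(** Coefficient of z^S in (k + 1) z e'(z) e(z)^k = z (e(z)^(k+1))'. *)
Lemma ec_euler k S :
  (\sum_(i < S.+1) i%:R * (e i * ec k (S - i))) *+ k.+1 = ec k.+1 S *+ S.
Proof.
set f := \poly_(i < S.+1) e i.
have -> : \sum_(i < S.+1) i%:R * (e i * ec k (S - i)) = ('X * f^`() * f ^+ k)`_S.
  rewrite coefM; apply: eq_bigr => i _; have := ltn_ord i; rewrite ltnS => le_iS.
  rewrite mulrA (ecE _ (N := S.+1)) ?ltnS ?leq_subr //; congr (_ * _).
  rewrite coefXM; case: (nat_of_ord i) le_iS => [|m] mS /=; first by rewrite mul0r.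
  by rewrite coef_deriv coef_poly ltnS mS mulr_natl.
rewrite (ecE _ (N := S.+1)) // -/f -coefMn.
have -> : 'X * f^`() * f ^+ k *+ k.+1 = 'X * (f ^+ k.+1)^`().
  by rewrite deriv_exp /= -mulrA -mulrnAr.
rewrite coefXM; case: S f => [|S] f /=; first by rewrite mulr0n.
by rewrite coef_deriv.
Qed.

End PowerCoefficients.

Section Upper.
Variables (K : numFieldType) (A : comNzRingType) (sc : {rmorphism K -> A}).
Variable e : nat -> A.
Local Notation ec := (ec e).

(* the span of the monomials e m_1 * ... * e m_r with m_1 + ... + m_r = E *)
Inductive Hom : nat -> nat -> A -> Prop :=
| Hom0 r E : Hom r E 0
| Hom1 : Hom 0 0 1
| HomD r E p q : Hom r E p -> Hom r E q -> Hom r E (p + q)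
| HomZ r E c p : Hom r E p -> Hom r E (sc c * p)
| HomM r E m p : Hom r E p -> Hom r.+1 (m + E) (e m * p).

Lemma Hom_sum I (s : seq I) (F : I -> A) r E :
  (forall i, Hom r E (F i)) -> Hom r E (\sum_(i <- s) F i).
Proof. by move=> h; elim/big_ind: _ => //; [exact: Hom0|exact: HomD]. Qed.

Lemma Hom_ec j n : Hom j n (ec j n).
Proof.
elim: j n => [|j IH] n /=.
  by case: n => [|n]; [exact: Hom1|exact: Hom0].
apply: Hom_sum => i; have := HomM i (IH (n - i)%N).
by rewrite subnKC // -ltnS.
Qed.

Lemma Hom_mul r E r' E' p q : Hom r E p -> Hom r' E' q -> Hom (r + r') (E + E') (p * q).
Proof.
move=> hp hq; elim: hp => {r E p} [r E||r E p q' _ h1 _ h2|r E c p _ h|r E m p _ h].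
- by rewrite mul0r; exact: Hom0.
- by rewrite mul1r.
- by rewrite mulrDl; exact: HomD.
- by rewrite -mulrA; exact: HomZ.
- by rewrite -mulrA -addnA addSn; exact: HomM.
Qed.

(** P r E plays the part of bidegree (r, E) of an ideal. It stays abstract because the induction for
    the upper bound enlarges it, takes colon ideals and cuts it off in E; the bidegree is an index
    of P so that a cut-off can be expressed. *)
Record graded (P : nat -> nat -> A -> Prop) : Prop := Graded {
  graded0 : forall r E, P r E 0;
  gradedD : forall r E p q, P r E p -> P r E q -> P r E (p + q);
  gradedZ : forall r E c p, P r E p -> P r E (sc c * p);
  gradedM : forall r E m p, P r E p -> P r.+1 (m + E)%N (e m * p) }.

Lemma graded_Hom P r E r' E' p q :
  graded P -> Hom r E p -> P r' E' q -> P (r + r')%N (E + E')%N (p * q).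
Proof.
move=> gP hp hq; elim: hp => {r E p} [r E||r E p q' _ h1 _ h2|r E c p _ h|r E m p _ h].
- by rewrite mul0r; exact: graded0.
- by rewrite mul1r.
- by rewrite mulrDl; exact: gradedD.
- by rewrite -mulrA; exact: gradedZ.
- by rewrite -mulrA -addnA addSn; exact: gradedM.
Qed.

Lemma graded_sum P I (s : seq I) (Q : pred I) (F : I -> A) r E : graded P ->
  (forall i, Q i -> P r E (F i)) -> P r E (\sum_(i <- s | Q i) F i).
Proof.
by move=> gP h; elim/big_ind: _ => //; [exact: graded0|move=> x y; exact: gradedD].
Qed.

Lemma gradedN P r E p : graded P -> P r E p -> P r E (- p).
Proof. by move=> gP /(gradedZ gP (-1)); rewrite rmorphN1 mulN1r. Qed.

Lemma gradedB P r E p q : graded P -> P r E p -> P r E q -> P r E (p - q).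
Proof. by move=> gP hp hq; apply: (gradedD gP) => //; exact: gradedN. Qed.

Lemma gradedMn P r E p n : graded P -> P r E p -> P r E (p *+ n).
Proof.
move=> gP hp; elim: n => [|n IH]; first by rewrite mulr0n; exact: graded0.
by rewrite mulrS; exact: gradedD.
Qed.

Lemma gradedMnI P r E p n : graded P -> P r E (p *+ n.+1) -> P r E p.
Proof.
move=> gP /(gradedZ gP (n.+1%:R^-1)); rewrite -[p *+ _]mulr_natl mulrA.
by rewrite -(rmorph_nat sc) -rmorphM mulVf ?pnatr_eq0 // rmorph1 mul1r.
Qed.

(* the least power of z in e(z)^j, on the tensor product of the vectors with
   thresholds b *)
Definition tb (j : nat) (b : seq nat) : nat := sumn (drop (size b - j) b).

Definition rel (P : nat -> nat -> A -> Prop) (b : seq nat) : Prop :=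
  (forall j n, (0 < j <= size b)%N -> (n < tb j b)%N -> P j n (ec j n)) /\
  (forall n, P (size b).+1 n (ec (size b).+1 n)).

(* e(x)^j e(z)^k is divisible by (x - z)^(2j) modulo e(z)^(k+1) = 0 *)
Lemma moment_vanish P k : graded P -> (forall n, P k.+1 n (ec k.+1 n)) ->
  forall j c S, (c < j.*2)%N ->
  P (j + k)%N S (\sum_(p < S.+1) sc (p%:R ^+ c) * (ec j p * ec k (S - p))).
Proof.
move=> gP h1; elim=> [//|j IH] c S hc.
(* One factor e m is split off from [ec j.+1 p], and p^c is expanded as (m + (p - m))^c. *)
rewrite (eq_bigr (fun p : 'I_S.+1 => \sum_(m < p.+1) \sum_(i < c.+1)
   sc (m%:R ^+ (c - i)) * sc ((p - m)%:R ^+ i) * (e m * ec j (p - m) * ec k (S - p)) *+ 'C(c, i))); last first.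
  move=> p _ /=; rewrite mulr_suml mulr_sumr; apply: eq_bigr => m _.
  rewrite -{1}(subnKC (leq_ord m)) natrD exprDn rmorph_sum mulr_suml.
  by apply: eq_bigr => i _; rewrite rmorphMn rmorphM mulrnAl.
under eq_bigr => p _ do rewrite exchange_big /=.
rewrite exchange_big /=; apply: graded_sum => // i _.
pose G m p q := sc (m%:R ^+ (c - i)) * sc (p%:R ^+ i) * (e m * ec j p * ec k q) *+ 'C(c, i).
(* If i < 2j, the induction hypothesis applies to the sum over p - m with m fixed. Otherwise c - i
   <= 1, and the sum over m with p - m fixed is a coefficient of e(z)^(k+1) or of its derivative. *)
have [lt_i|le_i] := ltnP i j.*2.
  rewrite -[X in P _ _ X]/(\sum_(p < S.+1) \sum_(m < p.+1) G m (p - m)%N (S - p)%N).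
  rewrite triangle_sum; apply: graded_sum => // m _.
  have := ltn_ord m; rewrite ltnS => le_mS.
  have := gradedM gP m (IH i (S - m)%N lt_i); rewrite subnKC // => h.
  have := gradedMn 'C(c, i) gP (gradedZ gP (m%:R ^+ (c - i)) h).
  rewrite !mulr_sumr -sumrMnl; congr P; apply: eq_bigr => p _.
  by congr (_ *+ _); rewrite !mulrA; congr (_ * _ * _); rewrite mulrAC.
pose G' p m q := G m p q.
have -> : \sum_(p < S.+1) \sum_(m < p.+1) G m (p - m)%N (S - p)%N =
          \sum_(p < S.+1) \sum_(m < p.+1) G' m (p - m)%N (S - p)%N.
  apply: eq_bigr => p _; rewrite (reindex_inj rev_ord_inj) /=.
  by apply: eq_bigr => m _; rewrite /G' !subSS subKn // -ltnS.
rewrite triangle_sum; apply: graded_sum => // p _.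
have := ltn_ord p; rewrite ltnS => le_pS.
(* With weight m^1 the sum is, by [ec_euler], a multiple of a coefficient of e(z)^(k+1) after
   division by k + 1. *)
have base : P k.+1 (S - p)%N (\sum_(m < (S - p).+1)
    sc (m%:R ^+ (c - i)) * (e m * ec k (S - p - m))).
  case ci: (c - i)%N => [|ci'].
    have := h1 (S - p)%N; congr P; apply: eq_bigr => m _.
    by rewrite expr0 rmorph1 mul1r.
  have -> : ci' = 0%N by lia.
  apply: (@gradedMnI _ _ _ _ k) => //.
  have := gradedMn (S - p)%N gP (h1 (S - p)%N); rewrite -ec_euler; congr P.
  congr (_ *+ _); apply: eq_bigr => m _.
  by rewrite expr1 rmorph_nat.
have := gradedMn 'C(c, i) gP (gradedZ gP (p%:R ^+ i) (graded_Hom gP (Hom_ec j p) base)).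
rewrite subnKC // addnS !mulr_sumr -sumrMnl; congr P; apply: eq_bigr => m _.
by congr (_ *+ _); rewrite !mulrA; ring.
Qed.

(** A linear combination of the moments of [moment_vanish] isolates one product: every other product
    in total degree n + T is either in P by its own threshold or gets coefficient zero. The result
    is that the colon ideal of P by the lowest coefficient of e(z)^k satisfies the relations for the
    thresholds b + 2. *)
Lemma top_relation P b : graded P -> rel P b -> (0 < size b)%N ->
  forall j n, (0 < j <= size b)%N -> (n < tb j b + j.*2)%N ->
  P (j + size b)%N (n + sumn b)%N (ec j n * ec (size b) (sumn b)).
Proof.
move=> gP [h1 h2] b0 j n jb hn; set k := size b; set T := sumn b.
have T_tb : tb k b = T by rewrite /tb subnn drop0.
have [lt_n|le_n] := ltnP n (tb j b).
  by rewrite mulrC addnC (addnC n); apply: graded_Hom => //; [exact: Hom_ec|exact: h1].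
pose S := (n + T)%N; pose t := tb j b.
(* L kills the p with t <= p < n and is nonzero at n. Its degree n - t is below 2j, so only moments
   known to vanish are combined. *)
pose L : {poly K} := \prod_(t <= m < n) ('X - m%:R%:P).
have sL : (size L <= j.*2)%N.
  by rewrite /L size_prod_XsubC size_iota -/t; lia.
have hL : P (j + k)%N S (\sum_(p < S.+1) sc L.[p%:R] * (ec j p * ec k (S - p))).
  rewrite (eq_bigr (fun p : 'I_S.+1 => \sum_(i < size L)
    sc L`_i * (sc (p%:R ^+ i) * (ec j p * ec k (S - p))))); last first.
    move=> p _; rewrite horner_coef rmorph_sum mulr_suml.
    by apply: eq_bigr => i _; rewrite rmorphM -mulrA.
  rewrite exchange_big /=; apply: graded_sum => // i _; rewrite -mulr_sumr.
  apply: gradedZ => //; apply: moment_vanish => //.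
  exact: leq_trans (ltn_ord i) sL.
have n_lt : (n < S.+1)%N by rewrite ltnS leq_addr.
rewrite (bigD1 (Ordinal n_lt)) //= in hL.
have hrest : P (j + k)%N S (\sum_(p < S.+1 | p != Ordinal n_lt)
    sc L.[p%:R] * (ec j p * ec k (S - p))).
  apply: graded_sum => // p pn.
  have := ltn_ord p; rewrite ltnS => le_pS.
  have [/andP[le_tp lt_pn]|] := boolP (t <= p < n)%N.
    suff -> : L.[p%:R] = 0 by rewrite rmorph0 mul0r; exact: graded0.
    apply/eqP; rewrite /L horner_prod prodf_seq_eq0; apply/hasP; exists (nat_of_ord p).
      by rewrite mem_index_iota le_tp.
    by rewrite hornerXsubC subrr eqxx.
  (* For p < t the first factor lies in P; for p > n the second has index S - p < T and lies in
     P. *)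
  rewrite negb_and -!ltnNge => hp; apply: gradedZ => //.
  have [lt_pt|le_tp] := ltnP p t.
    by have := graded_Hom gP (Hom_ec k (S - p)%N) (h1 j p jb lt_pt);
      rewrite subnK // addnC mulrC.
  have {hp} le_np : (n <= p)%N by lia.
  have lt_T : (S - p < tb k b)%N.
    by rewrite T_tb; move: pn le_pS; rewrite -val_eqE /= /S => /eqP; move: (nat_of_ord p) le_np => q; lia.
  have kb : (0 < k <= size b)%N by rewrite b0 leqnn.
  by have := graded_Hom gP (Hom_ec j p) (h1 k (S - p)%N kb lt_T); rewrite subnKC.
have := gradedB gP hL hrest; rewrite addrK {2}/S addKn => /(gradedZ gP (L.[n%:R])^-1).
rewrite mulrA -rmorphM mulVf ?rmorph1 ?mul1r // /L horner_prod.
rewrite prodf_seq_neq0; apply/allP => m; rewrite mem_index_iota => /andP[_ lt_mn].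
by rewrite /= hornerXsubC subr_eq0 eqr_nat neq_ltn lt_mn orbT.
Qed.

Definition comb (cs : seq K) (l : seq A) : A := \sum_(x <- zip cs l) sc x.1 * x.2.

Lemma comb_cat cs cs' l l' : size cs = size l ->
  comb (cs ++ cs') (l ++ l') = comb cs l + comb cs' l'.
Proof. by move=> h; rewrite /comb zip_cat // big_cat. Qed.

Lemma comb_mul cs l u : comb cs [seq x * u | x <- l] = comb cs l * u.
Proof.
rewrite /comb; elim: cs l => [|c cs IH] [|x l] /=; rewrite ?big_nil ?mul0r //.
by rewrite !big_cons IH /= mulrDl mulrA.
Qed.

Lemma tb_cons b0 b j : (j <= size b)%N -> tb j (b0 :: b) = tb j b.
Proof. by move=> h; rewrite /tb /= subSn. Qed.

Lemma tb_full b : tb (size b) b = sumn b.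
Proof. by rewrite /tb subnn drop0. Qed.

Lemma tb_add2 b j : (j <= size b)%N -> tb j [seq x.+2 | x <- b] = (tb j b + j.*2)%N.
Proof.
move=> jb; rewrite /tb size_map -map_drop.
have : size (drop (size b - j) b) = j by rewrite size_drop subKn.
move: (drop _ b) => s {jb b}; elim: s j => [|x s IH] [|j] //= [sj].
by rewrite (IH j) //; lia.
Qed.

(** Nested induction on [size b], r and E + 1 - [sumn b]: dropping a threshold lowers the first,
    passing to the colon ideal lowers r, and adjoining u to the ideal raises [sumn b]. The list l
    spans the bidegree modulo P. *)
Theorem upper_bound b P r E : graded P -> rel P b ->
  exists2 l : seq A, size l = chi b 0 r E &
    forall p, Hom r E p -> exists2 cs : seq K, size cs = size l & P r E (p - comb cs l).
Proof.
have [k] := ubnP (size b); elim: k b P r E => // k IHk b P r E; rewrite ltnS.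
case: b => [|b0 b] sb gP hrel.
  (* Without thresholds the second relation is about e(z)^1, so every e m lies in P and only
     constants remain. *)
  have hP p : Hom r E p -> exists c, P r E (p - sc c) /\ (c != 0 -> (r == 0%N) && (E == 0%N)).
    elim=> {r E p} [r E||r E p q _ [c [h1 h2]] _ [c' [h1' h2']]
                   |r E c p _ [c' [h1 h2]]|r E m p hp _].
    - by exists 0; rewrite rmorph0 subrr eqxx; split=> //; exact: graded0.
    - by exists 1; rewrite rmorph1 subrr; split=> //; exact: graded0.
    - exists (c + c'); split; first by rewrite rmorphD opprD addrACA; exact: gradedD.
      have [->|/h2 -> //] := eqVneq c 0; by rewrite add0r.
    - exists (c * c'); split; first by rewrite rmorphM -mulrBr; exact: gradedZ.
      by rewrite mulf_eq0 negb_or => /andP[_ /h2].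
    - exists 0; rewrite rmorph0 subr0 eqxx; split=> //.
      have := graded_Hom gP hp (hrel.2 m); rewrite addn1 addnC mulrC /=.
      congr P; congr (_ * _); rewrite big_ord_recr /= subnn eqxx mulr1 big1 ?add0r // => i _.
      by rewrite subn_eq0 leqNgt ltn_ord mulr0.
  case rE: ((r == 0%N) && (E == 0%N)).
    exists [:: 1]; first by rewrite /= rE.
    move=> p /hP[c [h1 _]]; exists [:: c] => //.
    by rewrite /comb /= big_seq1 /= mulr1.
  exists [::]; first by rewrite /= rE.
  move=> p /hP[c [h1 h2]]; exists [::] => //; rewrite /comb big_nil subr0.
  have [c0|/h2] := eqVneq c 0; last by rewrite rE.
  by move: h1; rewrite c0 rmorph0 subr0.
have [m] := ubnP r; elim: m b0 b P r E sb gP hrel => // m IHm b0 b P r E sb gP hrel.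
rewrite ltnS => le_rm.
have [d] := ubnP (E.+1 - sumn (b0 :: b)); elim: d b0 b P sb gP hrel => // d IHd b0 b P sb gP hrel.
rewrite ltnS => hd.
have [lt_E|le_E] := ltnP E (sumn (b0 :: b)).
  (* Below degree [sumn (b0 :: b)] all coefficients of e(z)^k lie in P. Ignoring degrees above E
     therefore gives the relation e(z)^k = 0 that the shorter list b demands. *)
  pose P' r' E' p := (E' <= E)%N -> P r' E' p.
  have gP' : graded P'.
    split=> [r' E' _|r' E' p q hp hq h|r' E' c p hp h|r' E' i p hp h].
    - exact: graded0.
    - by apply: gradedD; [|exact: hp|exact: hq].
    - by apply: gradedZ; [|exact: hp].
    - by apply: gradedM => //; apply: hp; apply: leq_trans h; rewrite leq_addl.
  have rel' : rel P' b.
    split=> [j n /andP[j0 jb] hn _|n hn].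
      by apply: hrel.1; rewrite ?j0 /= ?leqW // tb_cons.
    by apply: hrel.1; rewrite /= ?leqnn // -/(size (b0 :: b)) tb_full; lia.
  have [|l sl hl] := IHk b P' r E _ gP' rel'; first by rewrite (leq_trans _ sb).
  exists l; first by rewrite chi_trunc.
  by move=> p /hl[cs scs h]; exists cs => //; exact: h.
set B := b0 :: b in hrel le_E sb *; set k' := size B; set T := sumn B.
pose u := ec k' T.
(* The ideal P + (u). The cofactor p' is recorded as homogeneous, since the induction hypothesis for
   the colon ideal speaks of [Hom] only; p' = 0 covers bidegrees too small for a multiple of u. *)
pose P' r' E' p := exists q p', P r' E' q /\ p = q + p' * u /\
  (p' = 0 \/ exists r'' E'', r' = (r'' + k')%N /\ E' = (E'' + T)%N /\ Hom r'' E'' p').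
have gP' : graded P'.
  split=> [r' E'|r' E' p p2 [q [p' [h1 [-> h2]]]] [q2 [p2' [h1' [-> h2']]]]
          |r' E' c p [q [p' [h1 [-> h2]]]]|r' E' i p [q [p' [h1 [-> h2]]]]].
  - by exists 0, 0; rewrite mul0r addr0; split; [exact: graded0|split; [|left]].
  - exists (q + q2), (p' + p2'); split; first exact: gradedD.
    split; first by rewrite mulrDl addrACA.
    case: h2 => [->|[r1 [E1 [e1 [e2 H1]]]]]; first by rewrite add0r.
    case: h2' => [->|[r2 [E2 [e3 [e4 H2]]]]].
      by rewrite addr0; right; exists r1, E1.
    right; exists r1, E1; split=> //; split=> //; apply: HomD => //.
    have <- : r2 = r1 by lia.
    by have <- : E2 = E1 by lia.
  - exists (sc c * q), (sc c * p'); split; first exact: gradedZ.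
    split; first by rewrite mulrDr mulrA.
    case: h2 => [->|[r1 [E1 [e1 [e2 H1]]]]]; first by left; rewrite mulr0.
    by right; exists r1, E1; do 2!split=> //; exact: HomZ.
  - exists (e i * q), (e i * p'); split; first exact: gradedM.
    split; first by rewrite mulrDr mulrA.
    case: h2 => [->|[r1 [E1 [e1 [e2 H1]]]]]; first by left; rewrite mulr0.
    right; exists r1.+1, (i + E1)%N; rewrite e1 e2 addSn addnA; do 2!split=> //.
    exact: HomM.
have subP' r' E' p : P r' E' p -> P' r' E' p.
  by move=> h; exists p, 0; rewrite mul0r addr0; split=> //; split=> //; left.
(* Only the threshold for j = k involves b0, and the one new coefficient it demands is n = T, which
   is u itself. *)
have rel' : rel P' (b0.+1 :: b).
  split=> [j n /andP[j0 jb] hn|n]; last by apply: subP'; apply: hrel.2.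
  have [jb'|/eqP jk] : (j <= size b)%N \/ j == k' by move: jb; rewrite /k' /=; lia.
    by apply: subP'; apply: hrel.1; rewrite ?j0 // /B tb_cons // -(tb_cons b0.+1).
  move: hn; rewrite jk (_ : k' = size (b0.+1 :: b)) // tb_full /= ltnS leq_eqVlt.
  case/orP=> [/eqP ->|hn]; last first.
    by apply: subP'; apply: (hrel.1 k' n); rewrite /k' ?tb_full ?leqnn.
  exists 0, 1; rewrite mul1r add0r; split; first exact: graded0.
  by split=> //; right; exists 0%N, 0%N; do 2!split=> //; exact: Hom1.
have [||l1 sl1 hl1] := IHd b0.+1 b P' _ gP' rel'; first exact: sb.
  by rewrite /=; move: le_E hd; rewrite /B /=; lia.
case: (boolP ((k' <= r) && (T <= E))%N) => [/andP[le_kr le_TE]|hno]; last first.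
  exists l1; first by rewrite sl1 [RHS]chi_rec ifF ?addn0 //; exact: negbTE.
  move=> p /hl1[cs scs [q [p' [h1 [h2 h3]]]]]; exists cs => //.
  case: h3 => [p0|[r1 [E1 [e1 [e2 _]]]]].
    by rewrite h2 p0 mul0r addr0.
  by move: hno; rewrite e1 e2 !leq_addl.
(* The colon ideal (P : u), with bidegrees shifted by that of u. *)
pose P2 r' E' p := P (r' + k')%N (E' + T)%N (p * u).
have gP2 : graded P2.
  split=> [r' E'|r' E' p q hp hq|r' E' c p hp|r' E' i p hp]; rewrite /P2.
  - by rewrite mul0r; exact: graded0.
  - by rewrite mulrDl; exact: gradedD.
  - by rewrite -mulrA; exact: gradedZ.
  - by rewrite addSn -addnA -mulrA; exact: gradedM.
have rel2 : rel P2 [seq x.+2 | x <- B].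
  rewrite /rel size_map; split=> [j n jb hn|n].
    by apply: top_relation => //; rewrite -tb_add2 //; case/andP: jb.
  rewrite /P2 mulrC addnC (addnC n); apply: graded_Hom => //; first exact: Hom_ec.
  exact: hrel.2.
have [||l2 sl2 hl2] := IHm b0.+2 [seq x.+2 | x <- b] P2 (r - k')%N (E - T)%N _ gP2 rel2.
- by rewrite /= size_map.
- by move: le_kr; rewrite /k' /=; lia.
exists (l1 ++ [seq x * u | x <- l2]).
  by rewrite size_cat size_map sl1 sl2 [RHS]chi_rec ifT //; apply/andP.
move=> p /hl1[cs scs [q [p' [h1 [h2 h3]]]]].
have Hp' : Hom (r - k')%N (E - T)%N p'.
  case: h3 => [->|[r1 [E1 [e1 [e2 H]]]]]; first exact: Hom0.
  by rewrite e1 e2 !addnK.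
have [cs2 scs2] := hl2 p' Hp'; rewrite /P2 !subnK // => h4.
exists (cs ++ cs2); first by rewrite !size_cat size_map scs scs2.
rewrite comb_cat // comb_mul opprD addrA h2 -addrA -mulrBl.
exact: gradedD.
Qed.

End Upper.

Local Open Scope classical_set_scope.
Local Open Scope fset_scope.
Local Open Scope ring_scope.

(** * Free modules and the fermion operators *)

Section FreeModule.
Variables (K : fieldType) (T : choiceType) (M : lmodType K).
Implicit Types (f : T -> M) (x : {freeg T / K}).

Lemma fglift_is_linear f : linear (fglift f : {freeg T / K} -> M).
Proof.
have liftE x : fglift f x = \sum_(b <- dom x) coeff b x *: f b.
  rewrite -{1}[x]Freeg_dom fglift_Freeg /prelift big_map.
  by apply: eq_bigr.
have addf := lift_is_additive f.
pose F := GRing.isZmodMorphism.Build _ _ (fglift f : {freeg T / K} -> M) addf.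
pose Fa : {additive {freeg T / K} -> M} := HB.pack (fglift f : {freeg T / K} -> M) F.
have FaE : fglift f = Fa by [].
move=> c x y; rewrite FaE raddfD -FaE; congr (_ + _).
have [->|c0] := eqVneq c 0.
  by rewrite !scale0r FaE raddf0.
rewrite !liftE scaler_sumr.
rewrite (perm_big (dom x)) /=; last first.
  by apply: uniq_perm; rewrite ?uniq_dom //; exact: domZ.
by apply: eq_bigr => b _; rewrite coeffZ scalerA.
Qed.

HB.instance Definition _ f := GRing.isLinear.Build K {freeg T / K} M _ (fglift f)
  (fglift_is_linear f).

Lemma fgliftU f b : fglift f << b >> = f b.
Proof. by rewrite liftU scale1r. Qed.

Lemma freegUZ (c : K) (b : T) : << c *g b >> = c *: << b >> :> {freeg T / K}.
Proof.
by apply/eqP/freeg_eqP => b'; rewrite coeffZ !coeffU mul1r.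
Qed.

Lemma fgliftE f x : fglift f x = \sum_(b <- dom x) coeff b x *: f b.
Proof.
rewrite -{1}[x]freeg_sumE linear_sum; apply: eq_bigr => b _.
by rewrite freegUZ linearZ /= fgliftU.
Qed.

Lemma freeg_ext (F G : {linear {freeg T / K} -> M}) :
  (forall b, F << b >> = G << b >>) -> F =1 G.
Proof.
move=> h x; rewrite -[x]freeg_sumE !linear_sum; apply: eq_bigr => b _.
by rewrite freegUZ !linearZ /= h.
Qed.

End FreeModule.

(** A bilinear extension does not depend on the order of its arguments; this makes operators on
    different tensor factors commute. *)
Lemma fglift_comm (K : fieldType) (T T' : choiceType) (M : lmodType K)
    (G : T -> T' -> M) (x : {freeg T / K}) (y : {freeg T' / K}) :
  fglift (fun b => fglift (G b) y) x = fglift (fun b' => fglift (G^~ b') x) y.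
Proof.
rewrite fgliftE [RHS]fgliftE.
under eq_bigr do rewrite fgliftE scaler_sumr.
rewrite exchange_big /=; apply: eq_bigr => b' _.
rewrite fgliftE scaler_sumr; apply: eq_bigr => b _.
by rewrite !scalerA mulrC.
Qed.

Section Supported.
Variables (K : fieldType) (T : choiceType).
Implicit Types (x y : {freeg T / K}) (Q : T -> Prop).

Definition supported Q x := forall b, coeff b x != 0 -> Q b.

Lemma supported0 Q : supported Q 0.
Proof. by move=> b; rewrite coeff0 eqxx. Qed.

Lemma supportedD Q x y : supported Q x -> supported Q y -> supported Q (x + y).
Proof.
move=> hx hy b; rewrite coeffD => h.
have [x0|/hx//] := eqVneq (coeff b x) 0.
by apply: hy; move: h; rewrite x0 add0r.
Qed.

Lemma supportedZ Q c x : supported Q x -> supported Q (c *: x).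
Proof. by move=> hx b; rewrite coeffZ mulf_eq0 negb_or => /andP[_ /hx]. Qed.

Lemma supportedU Q b : Q b -> supported Q << b >>.
Proof. by move=> hb b'; rewrite coeffU mul1r; have [<- //|_] := eqVneq b b'; rewrite eqxx. Qed.

Lemma supported_sum Q I (s : seq I) (P : pred I) (F : I -> {freeg T / K}) :
  (forall i, P i -> supported Q (F i)) -> supported Q (\sum_(i <- s | P i) F i).
Proof.
by move=> h; elim/big_ind: _ => //; [exact: supported0|exact: supportedD].
Qed.

End Supported.

Lemma supported_fglift (K : fieldType) (T T' : choiceType) (Q : T -> Prop) (Q' : T' -> Prop)
    (f : T -> {freeg T' / K}) (x : {freeg T / K}) :
  (forall b, Q b -> supported Q' (f b)) -> supported Q x -> supported Q' (fglift f x).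
Proof.
move=> h hx; rewrite fgliftE big_seq; apply: supported_sum => b.
rewrite mem_dom => /hx qb; apply: supportedZ; exact: h.
Qed.

Lemma finite_int_range (a c : int) : finite_set [set t : int | a < t <= c].
Proof.
pose s : seq int := [seq a + i%:Z | i <- iota 0 (`|c - a|%N).+1].
apply: (@sub_finite_set _ _ [set` s]); last exact: finite_seq.
move=> t /= /andP[h1 h2]; have te : t = a + `|t - a|%N%:Z by lia.
suff : t \in s by [].
by rewrite {1}te; apply: (map_f (fun i : nat => a + i%:Z)); rewrite mem_iota; lia.
Qed.

Section Occurrences.
Implicit Types (b : monomial) (u t : int).

Lemma occurs_inj b b' : occurs b =1 occurs b' -> b = b'.
Proof. by move=> h; apply/fsetP => u; have := h u; rewrite /occurs => /addbI. Qed.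

Lemma mem_above b u t : (t \in above b u) = (u < t) && occurs b t.
Proof.
rewrite /above in_fset_set; last first.
  apply: (@sub_finite_set _ _ ([set t : int | u < t <= 0] `|` [set` b])).
    move=> s /= [us]; rewrite /occurs; case: (leP s 0) => //= [h _|_]; [left|by right].
    by rewrite us.
  by rewrite finite_setU; split; [exact: finite_int_range|exact: finite_fset].
by apply/idP/andP => [|h]; rewrite inE //.
Qed.

Lemma occurs_adjoin b u t : ~~ occurs b u -> occurs (adjoin b u) t = (t == u) || occurs b t.
Proof.
rewrite /occurs /adjoin; case: (leP u 0) => hu.
  move=> /negPn ub; rewrite !inE; have [->|tu] //= := eqVneq t u; by rewrite hu.
rewrite /= => ub; rewrite !inE; have [->|tu] //= := eqVneq t u.
by rewrite leNgt hu.
Qed.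

Lemma above_adjoin b u t : ~~ occurs b u ->
  above (adjoin b u) t = if t < u then u |` above b t else above b t.
Proof.
move=> ub; apply/fsetP => s; case: ifP => tu; rewrite ?inE !mem_above occurs_adjoin //.
  by have [->|] := eqVneq s u; rewrite //= tu.
by have [->|] := eqVneq s u; rewrite //= tu.
Qed.

Lemma adjoinC b u t : u != t -> ~~ occurs b u -> ~~ occurs b t ->
  adjoin (adjoin b u) t = adjoin (adjoin b t) u.
Proof.
move=> ut ub tb; apply: occurs_inj => s.
rewrite !occurs_adjoin //; first by rewrite orbCA.
  by rewrite negb_or ut.
by rewrite negb_or eq_sym ut.
Qed.

End Occurrences.

Section Fock.
Variable K : fieldType.
Local Notation F := (fock K).
Local Notation R := (@rmul_var K).

HB.instance Definition _ (u : int) := GRing.Linear.on (@rmul_var K u).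

Lemma rmul_varU u b : R u << b >> =
  if occurs b u then 0 else (-1) ^+ #|` above b u| *: << adjoin b u >>.
Proof. by rewrite /rmul_var fgliftU; case: ifP => // _; exact: freegUZ. Qed.

Lemma rmul_var_anti u t x : R u (R t x) = - R t (R u x).
Proof.
apply/eqP; rewrite -addr_eq0; apply/eqP.
pose L := fun x => R u (R t x) + R t (R u x).
have linL : linear L.
  by move=> c y z; rewrite /L !linearP /= scalerDr addrACA.
pose LL : {linear F -> F} := HB.pack L (GRing.isLinear.Build _ _ _ _ L linL).
suff /(_ x) : LL =1 (\0 : F -> F) by [].
apply: freeg_ext => b /=; rewrite /L !rmul_varU.
have [<-|ut] := eqVneq u t.
  case: ifPn => ub; first by rewrite !linear0 addr0.
  by rewrite !linearZ /= rmul_varU occurs_adjoin // eqxx /= !scaler0 addr0.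
case: ifPn => tb; case: ifPn => ub; rewrite ?linear0 ?addr0 ?add0r //.
- by rewrite linearZ /= rmul_varU occurs_adjoin // tb orbT scaler0.
- by rewrite linearZ /= rmul_varU occurs_adjoin // ub orbT scaler0.
rewrite !linearZ /= !rmul_varU !occurs_adjoin // (negPf ub) (negPf tb) (negPf ut) eq_sym (negPf ut) /=.
rewrite (adjoinC ut) // !scalerA -scalerDl -!exprD !above_adjoin //.
suff -> : (-1) ^+ (#|` above b t| + #|` if u < t then t |` above b u else above b u|) +
    (-1) ^+ (#|` above b u| + #|` if t < u then u |` above b t else above b t|) = 0 :> K.
  by rewrite scale0r.
(* The larger number, once adjoined, lies above the smaller but not conversely, so exactly one of
   the two orders picks up an extra sign. *)
have [lt_ut|lt_tu|e] := ltgtP u t; last by rewrite e eqxx in ut.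
  by rewrite cardfsU1 mem_above (negPf tb) andbF /= add1n addnS exprS mulN1r addnC addNr.
by rewrite cardfsU1 mem_above (negPf ub) andbF /= add1n addnS exprS mulN1r addnC addrN.
Qed.

End Fock.

(** * The modes e_m on the Fock space *)

Lemma int_above (c n : int) : c < n -> exists m : nat, n = c + 1 + m%:Z.
Proof. by move=> h; exists (absz (n - c - 1)%R); lia. Qed.

Section FockOps.
Variable K : fieldType.
Local Notation F := (fock K).
Local Notation R := (@rmul_var K).
Implicit Types (x y : F) (c n : int).

(** Every monomial of x contains all variables of number at most c. Each x has such a c, all
    operators in play preserve it, and it makes the sum in [e n x] finite. *)
Definition full c x := forall u, u <= c -> R u x = 0.

Lemma full_le c c' x : c' <= c -> full c x -> full c' x.
Proof. by move=> h hx u hu; apply: hx; apply: le_trans h. Qed.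

Lemma fullD c x y : full c x -> full c y -> full c (x + y).
Proof. by move=> hx hy u hu; rewrite linearD /= hx // hy // addr0. Qed.

Lemma fullZ c (a : K) x : full c x -> full c (a *: x).
Proof. by move=> hx u hu; rewrite linearZ /= hx // scaler0. Qed.

Lemma full0 c : full c 0.
Proof. by move=> u _; rewrite linear0. Qed.

Lemma full_rmul c t x : full c x -> full c (R t x).
Proof. by move=> hx u hu; rewrite rmul_var_anti hx // linear0 oppr0. Qed.

Lemma full_basis (b : monomial) : exists c, full c << b >>.
Proof.
exists (- (\sum_(u <- b) `|u|%N)%:Z - 1) => u hu; rewrite rmul_varU ifT //.
rewrite /occurs; have -> : u <= 0 by lia.
suff -> : u \in b = false by [].
apply/negP => ub; have : (`|u| <= \sum_(u <- b) `|u|)%N.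
  by rewrite (big_fsetD1 u) //= leq_addr.
by lia.
Qed.

Lemma full_ex x : exists c, full c x.
Proof.
rewrite -[x]freeg_sumE; elim/big_ind: _ => [|y z [c hy] [c' hz]|b _].
- by exists 0; exact: full0.
- exists (Num.min c c'); apply: fullD; [apply: full_le hy|apply: full_le hz].
    by rewrite ge_min lexx.
  by rewrite ge_min lexx orbT.
- by have [c hc] := full_basis b; exists c; rewrite freegUZ; exact: fullZ.
Qed.

Lemma full_ex3 n x y z : exists c, [/\ c < n, full c x, full c y & full c z].
Proof.
have [c hx] := full_ex x; have [c' hy] := full_ex y; have [c2 hz] := full_ex z.
exists (Num.min (n - 1) (Num.min c (Num.min c' c2))); split.
- by rewrite gt_min; apply/orP; left; lia.
- by apply: full_le hx; rewrite !ge_min lexx ?orbT.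
- by apply: full_le hy; rewrite !ge_min lexx ?orbT.
- by apply: full_le hz; rewrite !ge_min lexx ?orbT.
Qed.

(* the first psi and the first phi that do not occur in v c *)
Definition psi_from c (p : nat) : F -> F := psi (((c + 2) %/ 2)%Z + p%:Z).
Definition phi_from c (q : nat) : F -> F := phi (((c + 1) %/ 2)%Z + q%:Z).

(** The first psi and phi that need not kill y have indices with sum c + 1, whatever the parity of
    c. Hence c + 1 is the lowest mode that can act nontrivially, and above it only finitely many
    pairs contribute. *)
Lemma e_full c m y : full c y ->
  e (c + 1 + m%:Z) y = \sum_(p < m.+1) phi_from c (m - p) (psi_from c p y).
Proof.
move=> hy; pose i0 := ((c + 2) %/ 2)%Z; pose j0 := ((c + 1) %/ 2)%Z.
have ij : i0 + j0 = c + 1 by rewrite /i0 /j0; lia.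
pose s : seq int := [seq i0 + p%:Z | p <- iota 0 m.+1].
have us : uniq s by rewrite map_inj_uniq ?iota_uniq // => p q; lia.
transitivity (\sum_(i \in [set` s]) phi (c + 1 + m%:Z - i) (psi i y)).
  rewrite /e; apply/esym/fsbig_widen => // i /= [_ his].
  have [lt_i|le_i] := ltP i i0.
    by rewrite /psi hy ?/phi ?linear0 // /i0; move: lt_i; rewrite /i0; lia.
  have le_i' : i0 + m%:Z < i.
    rewrite ltNge; apply/negP => h; apply: his.
    suff : i \in s by [].
    have -> : i = i0 + `|i - i0|%N%:Z by lia.
    by apply: (map_f (fun p : nat => i0 + p%:Z)); rewrite mem_iota; lia.
  rewrite /phi; apply: (full_rmul _ hy).
  by move: ij le_i'; rewrite /i0 /j0; lia.
rewrite -fsbig_seq // big_map -/(index_iota 0 m.+1) big_mkord.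
apply: eq_bigr => p _; rewrite /phi_from /psi_from -/i0 -/j0; congr (phi _ _).
by have := ltn_ord p; lia.
Qed.

Lemma e_low c n y : full c y -> n <= c -> e n y = 0.
Proof.
move=> hy hn; apply: fsbig1 => i _.
have [hi|hi] := leP (2 * i) c; first by rewrite /psi hy // /phi linear0.
by rewrite /phi; apply: (full_rmul _ hy); lia.
Qed.

Lemma e_is_linear n : linear (e n : F -> F).
Proof.
move=> a x y; have [c [hc hx hy _]] := full_ex3 n x y 0.
have [m ->] := int_above hc.
rewrite !e_full //; last by apply: fullD => //; exact: fullZ.
rewrite scaler_sumr -big_split /=; apply: eq_bigr => p _.
by rewrite /phi_from /psi_from /phi /psi !linearP.
Qed.

HB.instance Definition _ n := GRing.isLinear.Build K F F _ (e n : F -> F) (e_is_linear n).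

Lemma e_rmul n u y : e n (R u y) = R u (e n y).
Proof.
have [c [hc hy _ _]] := full_ex3 n y 0 0.
have [m ->] := int_above hc.
rewrite !e_full //; last exact: full_rmul.
rewrite linear_sum; apply: eq_bigr => p _; rewrite /phi_from /psi_from /phi /psi.
by rewrite (rmul_var_anti _ u y) linearN /= (rmul_var_anti _ u) opprK.
Qed.

Lemma full_e c n y : full c y -> full c (e n y).
Proof. by move=> hy u hu; rewrite -e_rmul hy // linear0. Qed.

Lemma eC n n' y : e n (e n' y) = e n' (e n y).
Proof.
have [c [hc hy _ _]] := full_ex3 n' y 0 0.
have [m ->] := int_above hc.
rewrite !e_full //; last exact: full_e.
rewrite linear_sum; apply: eq_bigr => p _; rewrite /phi_from /psi_from /phi /psi.
by rewrite /= !e_rmul.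
Qed.

(** A coefficient of e(z)^2 = 0. Exchanging the two psi's in psi phi psi phi keeps the total index
    and changes the sign, so the sum equals its own negative. *)
Lemma e_square c (n : nat) y : 2%:R != 0 :> K -> full c y ->
  \sum_(m < n.+1) e (c + 1 + m%:Z) (e (c + 1 + (n - m)%N%:Z) y) = 0.
Proof.
move=> K2 hy; pose B := n.+1.
have eB m z : (m < B)%N -> full c z ->
    e (c + 1 + m%:Z) z = \sum_(p < B) \sum_(q < B | (p + q == m)%N) phi_from c q (psi_from c p z).
  move=> mB hz; rewrite e_full //.
  rewrite (bigID (fun p : 'I_B => (p <= m)%N)) /= [X in _ + X]big1 ?addr0 => [|p hp]; last first.
    by rewrite big1 // => q; lia.
  rewrite -(big_mkord (fun p => p <= m)%N (fun p => \sum_(q < B | (p + q == m)%N) phi_from c q (psi_from c p z))).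
  rewrite -(big_mkord xpredT (fun p => phi_from c (m - p) (psi_from c p z))).
  rewrite (big_nat_widen _ _ _ _ _ mB); apply: congr_big_nat => // p /andP[pm _].
  have hq : (m - p < B)%N by lia.
  rewrite (big_pred1 (Ordinal hq)) // => q.
  by rewrite /= -val_eqE /=; lia.
pose t p q p' q' := phi_from c q (psi_from c p (phi_from c q' (psi_from c p' y))).
have t_anti p q p' q' : t p q p' q' = - t p' q p q'.
  rewrite /t /phi_from /psi_from /phi /psi.
  set a := 2 * _ + 1; set b := 2 * _; set a' := 2 * _ + 1; set b' := 2 * _.
  have rN u z : R u (- z) = - R u z by rewrite linearN.
  rewrite (rmul_var_anti b a' (R b' y)) (rmul_var_anti b b' y) (rmul_var_anti b' a' (R b y)).
  by rewrite !rN !opprK.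
pose G (p q p' q' : nat) := if (p + q + p' + q' == n)%N then t p q p' q' else 0.
pose S := \sum_(p < B) \sum_(q < B) \sum_(p' < B) \sum_(q' < B) G p q p' q'.
have S_anti : S = - S.
  rewrite {1}/S; under eq_bigr => p _ do rewrite exchange_big /=.
  rewrite exchange_big /= /S -sumrN; apply: eq_bigr => p _.
  rewrite exchange_big /= -sumrN; apply: eq_bigr => q _.
  rewrite -sumrN; apply: eq_bigr => p' _; rewrite -sumrN; apply: eq_bigr => q' _.
  rewrite /G t_anti.
  have -> : (p' + q + p + q' = p + q + p' + q')%N by lia.
  by case: ifP => // _; rewrite ?opprK ?oppr0.
have S0 : S = 0.
  apply/eqP; have : 2%:R *: S == 0 by rewrite scaler_nat mulr2n {1}S_anti addNr.
  by rewrite scaler_eq0 (negPf K2).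
rewrite -[RHS]S0 /S.
transitivity (\sum_(m < B) \sum_(p < B) \sum_(q < B) \sum_(p' < B) \sum_(q' < B)
    if (p + q == m)%N && (p' + q' == n - m)%N then t p q p' q' else 0).
  apply: eq_bigr => m _; rewrite eB //; last exact: full_e.
  apply: eq_bigr => p _; rewrite big_mkcond; apply: eq_bigr => q _.
  case: ifP => pq /=; last by rewrite big1 // => p' _; rewrite big1.
  rewrite eB //; last by rewrite ltnS leq_subr.
  rewrite /phi_from /psi_from /phi /psi !linear_sum; apply: eq_bigr => p' _.
  by rewrite !linear_sum -big_mkcond.
rewrite exchange_big; apply: eq_bigr => p _.
rewrite exchange_big; apply: eq_bigr => q _.
rewrite exchange_big; apply: eq_bigr => p' _.
rewrite exchange_big; apply: eq_bigr => q' _.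
rewrite -big_mkcond /= /G.
case: ifP => h; last by rewrite big1 // => m; have := ltn_ord m; lia.
have hpq : (p + q < n.+1)%N by lia.
rewrite (big_pred1 (Ordinal hpq)) // => m; apply/andP/eqP => [[/eqP e1 _]|->].
  exact: val_inj.
by split; rewrite /= ?eqxx //; lia.
Qed.

End FockOps.

Section Weights.
Implicit Types (b : monomial) (u c : int).

Lemma charge_adjoin b u : ~~ occurs b u -> charge (adjoin b u) = charge b + 1.
Proof.
rewrite /occurs /adjoin /charge; case: (leP u 0) => hu /= ub.
  rewrite [in RHS](big_fsetD1 u) //=; last by rewrite negbK in ub.
  by rewrite ltNge hu /= addrAC addNr add0r.
by rewrite big_fsetU1 //= hu addrC.
Qed.

Lemma energy_adjoin b u : ~~ occurs b u -> energy (adjoin b u) = energy b + (u %/ 2)%Z.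
Proof.
rewrite /occurs /adjoin /energy; case: (leP u 0) => hu /= ub.
  rewrite [in RHS](big_fsetD1 u) //=; last by rewrite negbK in ub.
  by rewrite ltNge hu /= addrAC addNr add0r.
by rewrite big_fsetU1 //= hu addrC.
Qed.

Lemma occurs_v c u : occurs (v c) u = (u <= c).
Proof.
rewrite /occurs /v in_fset_set.
  have -> : (u \in [set u | (u <= c) != (u <= 0)]) = ((u <= c) != (u <= 0)).
    by apply/idP/idP; rewrite inE.
  by case: (u <= c); case: (u <= 0).
apply: (@sub_finite_set _ _ ([set t : int | c < t <= 0] `|` [set t : int | 0 < t <= c])).
  by move=> t /=; case: (leP t c) => h1; case: (leP t 0) => h2 //= _; [right|left].
by rewrite finite_setU; split; exact: finite_int_range.
Qed.

Lemma adjoin_v c : adjoin (v c) (c + 1) = v (c + 1).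
Proof.
apply: occurs_inj => u; rewrite occurs_adjoin ?occurs_v //; last by lia.
by lia.
Qed.

Lemma v0 : v 0 = fset0.
Proof.
by apply: occurs_inj => u; rewrite occurs_v /occurs inE addbF.
Qed.

Lemma int_ind_both (P : int -> Prop) :
  P 0 -> (forall c, P c <-> P (c + 1)) -> forall c, P c.
Proof.
move=> h0 h; elim=> [//|n hn|n hn].
  by have [+ _] := h n%:Z; rewrite (_ : n%:Z + 1 = n.+1%:Z); [exact|lia].
by have [_] := h (- n.+1%:Z); rewrite (_ : - n.+1%:Z + 1 = - n%:Z); [exact|lia].
Qed.

Lemma charge_v c : charge (v c) = c.
Proof.
elim/int_ind_both: c => [|c]; first by rewrite v0 /charge big_seq_fset0.
by rewrite -adjoin_v charge_adjoin ?occurs_v; lia.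
Qed.

(** The defect 1/4 for odd c is the origin of q^(-p(D)/4). *)
Lemma energy_v c : 4 * energy (v c) = c ^+ 2 - (c %% 2)%Z.
Proof.
elim/int_ind_both: c => [|c]; first by rewrite v0 /energy big_seq_fset0.
rewrite -adjoin_v energy_adjoin ?occurs_v; last by lia.
rewrite !expr2; lia.
Qed.

End Weights.

Section FockWeights.
Variable K : fieldType.
Local Notation F := (fock K).
Local Notation R := (@rmul_var K).
Implicit Types (x y : F) (c n : int).

Lemma supported_rmul (Q Q' : monomial -> Prop) u x :
  (forall b, ~~ occurs b u -> Q b -> Q' (adjoin b u)) -> supported Q x -> supported Q' (R u x).
Proof.
move=> h; apply: supported_fglift => b qb; case: ifPn => ub; first exact: supported0.
by rewrite freegUZ; apply: supportedZ; apply: supportedU; exact: h.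
Qed.

Lemma supported_e n (C En : int) x :
  supported (fun b => charge b = C /\ energy b = En) x ->
  supported (fun b => charge b = C + 2 /\ energy b = En + n) (e n x).
Proof.
move=> hx; have [c [hc fx _ _]] := full_ex3 n x 0 0.
have [m nE] := int_above hc; rewrite nE e_full //; apply: supported_sum => p _.
rewrite /phi_from /psi_from /phi /psi.
set j := 2 * _ + 1; set i := 2 * _.
apply: (@supported_rmul (fun b => charge b = C + 1 /\ energy b = En + (i %/ 2)%Z)).
  move=> b bj [h1 h2]; rewrite charge_adjoin // energy_adjoin // h1 h2; split; first lia.
  rewrite /i /j; have := ltn_ord p; lia.
apply: supported_rmul hx => b bi [h1 h2].
by rewrite charge_adjoin // energy_adjoin // h1 h2.
Qed.

Lemma rmul_v c : R (c + 1) << v c >> = << v (c + 1) >>.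
Proof.
rewrite rmul_varU occurs_v ifF; last by lia.
rewrite adjoin_v (_ : above _ _ = fset0) ?cardfs0 ?scale1r //.
by apply/fsetP => u; rewrite mem_above occurs_v inE; lia.
Qed.

Lemma full_v c : full c (<< v c >> : F).
Proof. by move=> u hu; rewrite rmul_varU occurs_v hu. Qed.

Lemma e_v c : exists2 s : K, s != 0 & e (c + 1) << v c >> = s *: << v (c + 2) >>.
Proof.
have vE : R (c + 2) (R (c + 1) << v c >>) = << v (c + 2) >>.
  by rewrite rmul_v (_ : c + 2 = c + 1 + 1) ?rmul_v //; lia.
have := e_full 0 (@full_v c); rewrite addr0 big_ord1 /= /phi_from /psi_from /phi /psi !addr0.
set j := 2 * _ + 1; set i := 2 * _.
(* The parity of c decides whether psi or phi is the first missing variable; in the second case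
   reordering costs a sign. *)
have [ev|od] : (i = c + 1 /\ j = c + 2) \/ (i = c + 2 /\ j = c + 1) by rewrite /i /j; lia.
  by case: ev => -> -> ->; exists 1; rewrite ?oner_neq0 // scale1r.
case: od => -> -> ->; exists (-1); first by rewrite oppr_eq0 oner_neq0.
by rewrite rmul_var_anti vE scaleN1r.
Qed.

End FockWeights.

(** * Operators on the tensor power *)

Section Tensor.
Variables (K : fieldType) (k : nat).
Local Notation F := (fock K).
Local Notation V := (tfock K k).
Implicit Types (b : {ffun 'I_k -> monomial}) (l : 'I_k) (m : int).

HB.instance Definition _ l (T : F -> F) := GRing.Linear.on (@at_factor K k l T).

Definition upd b l (c : monomial) : {ffun 'I_k -> monomial} :=
  [ffun j => if j == l then c else b j].

Definition ins b l : F -> V := fglift (fun c => << upd b l c >> : V).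

HB.instance Definition _ b l := GRing.Linear.on (ins b l).

Lemma at_factorU l (T : F -> F) b : at_factor l T << b >> = ins b l (T << b l >>).
Proof. by rewrite /at_factor fgliftU. Qed.

Lemma insU b l c : ins b l << c >> = << upd b l c >>.
Proof. exact: fgliftU. Qed.

Lemma upd_upd b l c c' : upd (upd b l c) l c' = upd b l c'.
Proof. by apply/ffunP => j; rewrite !ffunE; case: eqP. Qed.

Lemma upd_id b l : upd b l (b l) = b.
Proof. by apply/ffunP => j; rewrite ffunE; case: eqP => [->|]. Qed.

Lemma updC b l l' c c' : l != l' -> upd (upd b l c) l' c' = upd (upd b l' c') l c.
Proof.
move=> ll'; apply/ffunP => j; rewrite !ffunE.
by have [->|//] := eqVneq j l'; rewrite eq_sym (negPf ll').
Qed.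

Lemma ins_id b l : ins b l << b l >> = << b >>.
Proof. by rewrite insU upd_id. Qed.

Lemma at_factor_ins l (T : {linear F -> F}) b x : at_factor l T (ins b l x) = ins b l (T x).
Proof.
apply: (@freeg_ext _ _ _ (at_factor l T \o ins b l) (ins b l \o T)) => c /=.
rewrite insU at_factorU ffunE eqxx /ins; congr (fglift _ _).
by apply/funext => c'; rewrite upd_upd.
Qed.

Lemma at_factor_comm l (T T' : {linear F -> F}) :
  (forall y, T (T' y) = T' (T y)) ->
  forall x, at_factor l T (at_factor l T' x) = at_factor l T' (at_factor l T x).
Proof.
move=> h; apply: (@freeg_ext _ _ _ (at_factor l T \o at_factor l T')
   (at_factor l T' \o at_factor l T)) => b /=.
by rewrite !at_factorU !at_factor_ins h.
Qed.

Lemma at_factor_comm_neq l l' (T T' : F -> F) : l != l' ->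
  forall x, at_factor l T (at_factor l' T' x) = at_factor l' T' (at_factor l T x).
Proof.
move=> ll'; apply: (@freeg_ext _ _ _ (at_factor l T \o at_factor l' T')
   (at_factor l' T' \o at_factor l T)) => b /=.
rewrite !at_factorU.
pose G c c' := << upd (upd b l c) l' c' >> : V.
have -> : at_factor l T (ins b l' (T' << b l' >>)) =
    fglift (fun c' => fglift (fun c => G c c') (T << b l >>)) (T' << b l' >>).
  apply: (@freeg_ext _ _ _ (at_factor l T \o ins b l')
    (fglift (fun c' => fglift (fun c => G c c') (T << b l >>)))) => c' /=.
  rewrite insU at_factorU fgliftU ffunE (negPf ll') /ins; congr (fglift _ _).
  by apply/funext => c; rewrite /G (updC _ _ _ ll').
have -> : at_factor l' T' (ins b l (T << b l >>)) =
    fglift (fun c => fglift (G c) (T' << b l' >>)) (T << b l >>).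
  apply: (@freeg_ext _ _ _ (at_factor l' T' \o ins b l)
    (fglift (fun c => fglift (G c) (T' << b l' >>)))) => c /=.
  by rewrite insU at_factorU fgliftU ffunE eq_sym (negPf ll').
by rewrite fglift_comm.
Qed.

Definition Xf l m : V -> V := at_factor l (e m : F -> F).

HB.instance Definition _ l m := GRing.Linear.on (Xf l m).

Lemma XfC l l' m m' x : Xf l m (Xf l' m' x) = Xf l' m' (Xf l m x).
Proof.
rewrite /Xf; have [->|ll'] := eqVneq l l'; last exact: at_factor_comm_neq.
by apply: at_factor_comm => y; exact: eC.
Qed.

(* operators commuting with everything that commutes with all the [Xf l m]:
   they commute with each other *)
Definition is_op (f : V -> V) : Prop := linear f /\
  forall g : {linear V -> V}, (forall l m x, g (Xf l m x) = Xf l m (g x)) ->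
  forall x, f (g x) = g (f x).

(** Bundled in order to be a commutative ring, so that polynomials over it and [ring] are available
    and the upper bound applies with this ring as A. *)
Record op : Type := Op { opf :> V -> V ; opfP : is_op opf }.

HB.instance Definition _ := gen_eqMixin op.
HB.instance Definition _ := gen_choiceMixin op.

HB.instance Definition _ (p : op) := GRing.isLinear.Build K V V _ (opf p) (opfP p).1.

Lemma op_ext (p q : op) : p =1 q -> p = q.
Proof.
case: p q => [f hf] [g hg] /= /funext fg; subst g.
by congr Op; exact: Prop_irrelevance.
Qed.

Lemma op_lin (f : {linear V -> V}) :
  (forall g : {linear V -> V}, (forall l m x, g (Xf l m x) = Xf l m (g x)) ->
    forall x, f (g x) = g (f x)) -> is_op f.
Proof. by move=> h; split=> //; exact: linearP. Qed.

Lemma is_opX l m : is_op (Xf l m).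
Proof. by apply: op_lin => g h x; rewrite h. Qed.

Definition Xop l m : op := Op (is_opX l m).

Lemma op_comm_lin (p : op) (g : {linear V -> V}) :
  (forall l m x, g (Xf l m x) = Xf l m (g x)) -> forall x, p (g x) = g (p x).
Proof. by case: p => f [lf hf] h x /=; exact: hf. Qed.

Lemma op_comm (p q : op) x : p (q x) = q (p x).
Proof.
apply: op_comm_lin => l m y; apply: (op_comm_lin q) => l' m' z; exact: XfC.
Qed.

Fact op_zero_subproof : is_op (\0 : V -> V).
Proof. by apply: op_lin => g h x /=; rewrite linear0. Qed.
Definition op_zero := Op op_zero_subproof.

Fact op_one_subproof : is_op (idfun : V -> V).
Proof. by apply: op_lin. Qed.
Definition op_one := Op op_one_subproof.

Fact op_add_subproof (p q : op) : is_op ((p : {linear V -> V}) \+ (q : {linear V -> V})).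
Proof.
by apply: op_lin => g h x /=; rewrite linearD /= (op_comm_lin p h) (op_comm_lin q h).
Qed.
Definition op_add p q := Op (op_add_subproof p q).

Fact op_opp_subproof (p : op) : is_op (\- (p : {linear V -> V})).
Proof. by apply: op_lin => g h x /=; rewrite linearN /= (op_comm_lin p h). Qed.
Definition op_opp p := Op (op_opp_subproof p).

Fact op_mul_subproof (p q : op) : is_op ((p : {linear V -> V}) \o (q : {linear V -> V})).
Proof. by apply: op_lin => g h x /=; rewrite (op_comm_lin q h) (op_comm_lin p h). Qed.
Definition op_mul p q := Op (op_mul_subproof p q).

Fact op_addA : associative op_add.
Proof. by move=> p q r; apply: op_ext => x /=; rewrite addrA. Qed.
Fact op_addC : commutative op_add.
Proof. by move=> p q; apply: op_ext => x /=; rewrite addrC. Qed.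
Fact op_add0 : left_id op_zero op_add.
Proof. by move=> p; apply: op_ext => x /=; rewrite add0r. Qed.
Fact op_addN : left_inverse op_zero op_opp op_add.
Proof. by move=> p; apply: op_ext => x /=; rewrite addNr. Qed.

HB.instance Definition _ := GRing.isZmodule.Build op op_addA op_addC op_add0 op_addN.

Fact op_mulA : associative op_mul. Proof. by move=> p q r; exact: op_ext. Qed.
Fact op_mulC : commutative op_mul.
Proof. by move=> p q; apply: op_ext => x; exact: op_comm. Qed.
Fact op_mul1 : left_id op_one op_mul. Proof. by move=> p; exact: op_ext. Qed.
Fact op_mulD : left_distributive op_mul +%R.
Proof. by move=> p q r; exact: op_ext. Qed.

Lemma basis_neq0 b : << b >> != 0 :> V.
Proof. by rewrite freegU_eq0 oner_neq0. Qed.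

Fact op_1_neq0 : op_one != 0.
Proof.
apply/eqP => /(congr1 (fun p : op => p << [ffun=> fset0] >>)) /= /eqP.
by rewrite (negPf (basis_neq0 _)).
Qed.

HB.instance Definition _ := GRing.Zmodule_isComNzRing.Build op
  op_mulA op_mulC op_mul1 op_mulD op_1_neq0.

Fact sc_subproof (c : K) : is_op ( *:%R c : V -> V).
Proof.
split; first by move=> a x y; rewrite scalerDr !scalerA mulrC.
by move=> g _ x; rewrite linearZ.
Qed.
Definition sc c : op := Op (sc_subproof c).

Fact sc_zmod : zmod_morphism sc.
Proof. by move=> a c; apply: op_ext => x /=; rewrite scalerBl. Qed.
Fact sc_monoid : monoid_morphism sc.
Proof.
split; first by apply: op_ext => x /=; rewrite scale1r.
by move=> a c; apply: op_ext => x /=; rewrite scalerA.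
Qed.
HB.instance Definition _ := GRing.isZmodMorphism.Build K op sc sc_zmod.
HB.instance Definition _ := GRing.isMonoidMorphism.Build K op sc sc_monoid.

Lemma opfD (p q : op) x : (p + q) x = p x + q x. Proof. by []. Qed.
Lemma opfB (p q : op) x : (p - q) x = p x - q x. Proof. by []. Qed.
Lemma opfM (p q : op) x : (p * q) x = p (q x). Proof. by []. Qed.
Lemma opf0 x : (0 : op) x = 0. Proof. by []. Qed.
Lemma opf1 x : (1 : op) x = x. Proof. by []. Qed.
Lemma opf_sc c x : sc c x = c *: x. Proof. by []. Qed.
Lemma opf_sum I (s : seq I) (P : pred I) (f : I -> op) x :
  (\sum_(i <- s | P i) f i) x = \sum_(i <- s | P i) f i x.
Proof. exact: (big_morph (fun p : op => p x) (fun p q => opfD p q x) (opf0 x)). Qed.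
Lemma opfMn (p : op) n x : (p *+ n) x = p x *+ n.
Proof. by elim: n => [|n IH]; rewrite ?mulr0n // !mulrS opfD IH. Qed.

(** Restricted to a list of factors, because the relations and the lower bound are proved by
    induction on the factors. *)
Definition Eop (ls : seq 'I_k) m : op := \sum_(l <- ls) Xop l m.

Lemma coprod_Eop m x : coprod (e m : F -> F) x = Eop (enum 'I_k) m x.
Proof. by rewrite /coprod /Eop opf_sum big_enum. Qed.

End Tensor.

(** * Relations in the tensor power *)

(** The binomial theorem modulo y^2, meant for y the current of a single factor, whose square acts
    as zero. *)
Lemma sq_expand (A : comNzRingType) (f y : A) j :
  exists q, (y + f) ^+ j.+1 = f ^+ j.+1 + f ^+ j * y *+ j.+1 + y ^+ 2 * q.
Proof.
elim: j => [|j [q IH]].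
  by exists 0; rewrite !expr1 expr0 mul1r mulr0 addr0 addrC.
exists (y * q + f * q + f ^+ j *+ j.+1).
rewrite exprS IH (exprS f j.+1) (exprS f j) expr2 -[f ^+ j * y *+ _]mulr_natr.
rewrite -[f ^+ j *+ _]mulr_natr -[f * _ * y *+ _]mulr_natr -(natr1 j.+1).
ring.
Qed.

Lemma tb0 b : tb 0 b = 0%N.
Proof. by rewrite /tb subn0 drop_size. Qed.

Lemma tb_le j b b0 : (j < size b)%N -> all (fun x => x <= b0)%N b ->
  (tb j.+1 b <= tb j b + b0)%N.
Proof.
move=> jb /allP hb; rewrite /tb (drop_nth 0%N); last by lia.
have -> : (size b - j.+1).+1 = (size b - j)%N by rewrite subnSK.
by rewrite /= addnC leq_add2l; apply: hb; rewrite mem_nth // ltn_subrL (leq_ltn_trans _ jb).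
Qed.

Section Relations.
Variables (K : numFieldType) (k : nat).
Local Notation F := (fock K).
Local Notation V := (tfock K k).
Local Notation A := (op K k).
Implicit Types (l : 'I_k) (m : int) (c : 'I_k -> int) (ls : seq 'I_k).

Definition wv c : V := << [ffun l => v (c l)] >>.

Definition incr ls (a : int) c l : int := if l \in ls then c l + a else c l.

Lemma wv_upd c l a : << upd [ffun j => v (c j)] l (v (c l + a)) >> = wv (incr [:: l] a c).
Proof.
rewrite /wv; congr << _ >>; apply/ffunP => j; rewrite !ffunE /incr inE.
by case: eqP => // ->.
Qed.

Lemma incr0 ls a c l : l \notin ls -> incr ls a c l = c l.
Proof. by rewrite /incr => /negPf ->. Qed.

Lemma incr_cons l ls a c : l \notin ls -> incr [:: l] a (incr ls a c) =1 incr (l :: ls) a c.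
Proof.
move=> lls j; rewrite /incr !inE.
by have [->|] := eqVneq j l; rewrite ?(negPf lls).
Qed.

Lemma eq_wv c c' : c =1 c' -> wv c = wv c'.
Proof. by move=> h; congr << _ >>; apply/ffunP => j; rewrite !ffunE h. Qed.

Lemma Xf_wv_low c l m : m <= c l -> Xf l m (wv c) = 0.
Proof.
move=> h; rewrite /Xf at_factorU ffunE (e_low (@full_v _ (c l))) //.
by rewrite linear0.
Qed.

Lemma Xf_wv c l : exists2 s : K, s != 0 & Xf l (c l + 1) (wv c) = s *: wv (incr [:: l] 2 c).
Proof.
have [s s0 h] := e_v K (c l); exists s => //.
by rewrite /Xf at_factorU ffunE h linearZ /= insU wv_upd.
Qed.

Lemma prod_X_wv c ls : uniq ls ->
  exists2 s : K, s != 0 & (\prod_(l <- ls) Xop K l (c l + 1)) (wv c) = s *: wv (incr ls 2 c).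
Proof.
elim: ls => [_|l ls IH /= /andP[lls uls]].
  by exists 1; rewrite ?oner_neq0 // big_nil opf1 scale1r.
have [s s0 h] := IH uls; have [s' s'0 h'] := Xf_wv (incr ls 2 c) l.
exists (s * s'); first by rewrite mulf_neq0.
rewrite big_cons opfM h linearZ -scalerA; congr (_ *: _).
move: h'; rewrite (incr0 _ _ lls) /= => ->; congr (_ *: _).
exact/eq_wv/incr_cons.
Qed.

(** Modes are renumbered by natural numbers from a base m0 not exceeding any c l + 1. Then
    [gap m0 c l] is the first index at which factor l of w(c) is not killed: these are the
    thresholds b. *)
Definition en ls m0 (m : nat) : A := Eop K ls (m0 + m%:Z).
Definition gap m0 c l : nat := absz (c l + 1 - m0)%R.

Section Null.
Variables (c : 'I_k -> int) (m0 : int) (N : nat).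

(** p(z) w(c) = O(z^N). These p form an ideal, so identities between series acting on w(c) become
    computations modulo it. *)
Definition null (p : {poly A}) : Prop := forall i, (i < N)%N -> p`_i (wv c) = 0.

Lemma null0 : null 0.
Proof. by move=> i _; rewrite coef0. Qed.

Lemma nullD p q : null p -> null q -> null (p + q).
Proof. by move=> hp hq i hi; rewrite coefD opfD hp // hq // addr0. Qed.

Lemma nullM p q : null q -> null (p * q).
Proof.
move=> hq i hi; rewrite coefM opf_sum big1 // => j _; rewrite opfM hq ?linear0 //.
exact: leq_ltn_trans (leq_subr _ _) hi.
Qed.

(** Divisibility of p(z) by z^t on w(c). The quotient is a polynomial in operators, so that the
    orders of two factors add in a product ([DvM]). *)
Definition Dv t (p : {poly A}) := exists q, null (p - 'X^t * q).

Lemma Dv_null t p : null p -> Dv t p.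
Proof. by move=> hp; exists 0; rewrite mulr0 subr0. Qed.

Lemma DvD t p q : Dv t p -> Dv t q -> Dv t (p + q).
Proof.
move=> [p' hp] [q' hq]; exists (p' + q').
by rewrite mulrDr opprD addrACA; exact: nullD.
Qed.

Lemma DvMl t p q : Dv t q -> Dv t (p * q).
Proof.
move=> [q' hq]; exists (p * q').
by rewrite mulrCA -mulrBr; exact: nullM.
Qed.

Lemma DvM t t' p q : Dv t p -> Dv t' q -> Dv (t + t') (p * q).
Proof.
move=> [p' hp] [q' hq]; exists (p' * q').
have -> : p * q - 'X^(t + t') * (p' * q') = q * (p - 'X^t * p') + 'X^t * p' * (q - 'X^t' * q').
  by rewrite exprD; ring.
by apply: nullD; exact: nullM.
Qed.

Lemma Dv_le t t' p : (t' <= t)%N -> Dv t p -> Dv t' p.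
Proof.
move=> h [q hq]; exists ('X^(t - t') * q).
by rewrite mulrA -exprD subnKC.
Qed.

(** [Y l] is the truncated current of factor l, counted from m0; [g l] is the same current counted
    from its lowest mode acting on w(c), so the two differ by a power of z. *)
Definition Y l : {poly A} := \poly_(m < N) Xop K l (m0 + m%:Z).
Definition g l : {poly A} := \poly_(m < N) Xop K l (c l + 1 + m%:Z).
Definition f ls : {poly A} := \poly_(m < N) en ls m0 m.

Lemma f_nil : f [::] = 0.
Proof. by apply/polyP => i; rewrite coef_poly coef0 /en /Eop big_nil; case: ifP. Qed.

Lemma f_cons l ls : f (l :: ls) = Y l + f ls.
Proof.
apply/polyP => i; rewrite coefD !coef_poly; case: ifP => _; last by rewrite addr0.
by rewrite /en /Eop big_cons.
Qed.

Lemma null_g2 l : null (g l ^+ 2).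
Proof.
move=> n nN; rewrite expr2 coefM opf_sum.
transitivity (@ins K k [ffun j => v (c j)] l (\sum_(m < n.+1)
   e (c l + 1 + m%:Z) (e (c l + 1 + (n - m)%N%:Z) << v (c l) >>))); last first.
  rewrite e_square ?linear0 ?pnatr_eq0 //; exact: full_v.
rewrite linear_sum; apply: eq_bigr => m _.
rewrite !coef_poly; have := ltn_ord m; rewrite ltnS => mn.
rewrite (leq_ltn_trans mn nN) (leq_ltn_trans (leq_subr _ _) nN) opfM /= /Xf.
by rewrite [at_factor l _ (wv c)]at_factorU ffunE at_factor_ins.
Qed.

Lemma null_Y l : m0 <= c l + 1 -> null (Y l - 'X^(gap m0 c l) * g l).
Proof.
move=> h i iN; rewrite coefB coefXnM !coef_poly iN opfB.
case: ltnP => hi.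
  by rewrite opf0 subr0 /= Xf_wv_low //; move: hi; rewrite /gap; lia.
rewrite (leq_ltn_trans (leq_subr _ _) iN); apply/eqP; rewrite subr_eq0; apply/eqP.
by congr (Xop _ _ _ _); move: hi; rewrite /gap; lia.
Qed.

Lemma null_Y2 l : m0 <= c l + 1 -> null (Y l ^+ 2).
Proof.
move=> h; set b := gap m0 c l.
have -> : Y l ^+ 2 = (Y l + 'X^b * g l) * (Y l - 'X^b * g l) + 'X^b ^+ 2 * g l ^+ 2 by ring.
by apply: nullD; apply: nullM; [exact: null_Y|exact: null_g2].
Qed.

Lemma null_f_big ls j : {in ls, forall l, m0 <= c l + 1} -> (size ls < j)%N -> null (f ls ^+ j).
Proof.
elim: ls j => [|l ls IH] [|j] // hls.
  by move=> _; rewrite f_nil exprS mul0r; exact: null0.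
rewrite /= ltnS => hj; rewrite f_cons; have [q ->] := sq_expand (f ls) (Y l) j.
have hls' : {in ls, forall l, m0 <= c l + 1} by move=> i il; apply: hls; rewrite inE il orbT.
apply: nullD; last by rewrite mulrC; apply/nullM/null_Y2/hls/mem_head.
apply: nullD; first by apply: IH => //; exact: leqW.
by rewrite mulrC -mulrnAl; apply/nullM/IH.
Qed.

(** As each current squares to zero, the j-th power is a sum over j-element sets of factors. The
    lowest power of z is then the sum of the j smallest gaps, which the ordering puts at the end of
    the list. *)
Lemma Dv_f ls j : {in ls, forall l, m0 <= c l + 1} -> sorted geq [seq gap m0 c l | l <- ls] ->
  (j <= size ls)%N -> Dv (tb j [seq gap m0 c l | l <- ls]) (f ls ^+ j).
Proof.
elim: ls j => [|l ls IH] [|j] // hls hs.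
- by exists 1; rewrite ?tb0 !expr0 mulr1 subrr; exact: null0.
- by exists 1; rewrite ?tb0 !expr0 mulr1 subrr; exact: null0.
rewrite /= ltnS => hj; rewrite f_cons; have [q ->] := sq_expand (f ls) (Y l) j.
have hls' : {in ls, forall l, m0 <= c l + 1} by move=> i il; apply: hls; rewrite inE il orbT.
have hs' : sorted geq [seq gap m0 c l | l <- ls] by apply: path_sorted hs.
have hall : all (fun x => x <= gap m0 c l)%N [seq gap m0 c l | l <- ls].
  by apply: (order_path_min (leT := geq)) hs => x y z /= h1 h2; exact: leq_trans h2 h1.
set bs := [seq _ | _ <- ls] in IH hs' hall *.
have sbs : size bs = size ls by rewrite size_map.
apply: DvD; last by rewrite mulrC; apply/Dv_null/nullM/null_Y2/hls/mem_head.
apply: DvD.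
  move: hj; rewrite leq_eqVlt => /orP[/eqP ->|hj].
    by apply: Dv_null; exact: null_f_big.
  by rewrite tb_cons ?sbs //; exact: IH.
rewrite -mulr_natl; apply: DvMl.
apply: (@Dv_le (tb j bs + gap m0 c l)).
  move: hj; rewrite leq_eqVlt => /orP[/eqP ->|hj].
    by rewrite -sbs -[X in (tb X.+1)]/(size bs) -/(size (gap m0 c l :: bs)) !tb_full /= addnC.
  by rewrite tb_cons ?sbs //; apply: tb_le; rewrite ?sbs.
apply: DvM; first exact: IH.
by exists (g l); apply/null_Y/hls/mem_head.
Qed.

(** In the top power each factor occurs exactly once, in any of (size ls)! orders. At the lowest
    degree this yields w(c + 2) in [ec_top]. *)
Lemma null_f_top ls : {in ls, forall l, m0 <= c l + 1} ->
  null (f ls ^+ size ls -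
    ('X^(sumn [seq gap m0 c l | l <- ls]) * \prod_(l <- ls) g l) *+ (size ls)`!).
Proof.
elim: ls => [|l ls IH] hls; first by rewrite big_nil mulr1 fact0 subrr; exact: null0.
have hls' : {in ls, forall l, m0 <= c l + 1} by move=> i il; apply: hls; rewrite inE il orbT.
rewrite f_cons [size _]/= big_cons [sumn _]/=; have [q ->] := sq_expand (f ls) (Y l) (size ls).
have hY := null_Y (hls l (mem_head _ _)); have hY2 := null_Y2 (hls l (mem_head _ _)).
have hf := null_f_big hls' (ltnSn _); have := IH hls'.
set T := sumn _; set s := size ls in hf *; set b := gap _ _ _ in hY *; set G := \prod_(_ <- _) _.
move=> hT.
have -> : f ls ^+ s.+1 + f ls ^+ s * Y l *+ s.+1 + Y l ^+ 2 * q -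
    'X^(b + T) * (g l * G) *+ s.+1`! =
  f ls ^+ s.+1 + q * Y l ^+ 2 + (Y l * s.+1%:R) * (f ls ^+ s - 'X^T * G *+ s`!) +
  (s.+1`!%:R * 'X^T * G) * (Y l - 'X^b * g l).
  rewrite -[_ *+ s.+1`!]mulr_natr -[_ *+ s`!]mulr_natr -[_ *+ s.+1]mulr_natr factS natrM exprD.
  ring.
by apply: nullD; [apply: nullD; [apply: nullD => //|]|]; exact: nullM.
Qed.

End Null.

Lemma ec_top ls c m0 : uniq ls -> {in ls, forall l, m0 <= c l + 1} ->
  exists2 s : K, s != 0 &
    ec (en ls m0) (size ls) (sumn [seq gap m0 c l | l <- ls]) (wv c) = s *: wv (incr ls 2 c).
Proof.
move=> uls hls; set T := sumn _.
have [s s0 hs] := prod_X_wv c uls; exists ((size ls)`!%:R * s).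
  by rewrite mulf_neq0 // pnatr_eq0 -lt0n fact_gt0.
rewrite (ecE _ _ (ltnSn T)) -scalerA -hs.
have := null_f_top (N := T.+1) hls (ltnSn T).
rewrite coefB opfB => /eqP; rewrite subr_eq0 => /eqP ->.
rewrite coefMn coefXnM ltnn subnn opfMn -scaler_nat coef0_prod; congr (_ *: _).
congr (opf _ (wv c)); apply: eq_bigr => l _.
by rewrite coef_poly /= addr0.
Qed.

Lemma rel_wv ls c m0 : {in ls, forall l, m0 <= c l + 1} ->
  sorted geq [seq gap m0 c l | l <- ls] ->
  rel (en ls m0) (fun _ _ p => p (wv c) = 0) [seq gap m0 c l | l <- ls].
Proof.
move=> hls hs; rewrite /rel size_map; split=> [j n /andP[j0 jb] hn|n].
  rewrite (ecE _ _ (ltnSn n)); have [q hq] := Dv_f n.+1 hls hs jb.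
  have := hq n (ltnSn n); rewrite coefB coefXnM hn opfB opf0 subr0; exact.
rewrite (ecE _ _ (ltnSn n)).
exact: (null_f_big (N := n.+1) hls (ltnSn _) (ltnSn n)).
Qed.

Lemma graded_ann (x : V) ls m0 : graded (@sc K k) (en ls m0) (fun _ _ p => p x = 0).
Proof.
split=> [r E|r E p q hp hq|r E a p hp|r E m p hp] //.
- by rewrite opfD hp hq addr0.
- by rewrite opfM hp linear0.
- by rewrite opfM hp linear0.
Qed.

End Relations.

(** * Lower bound *)

Definition indep (K : fieldType) (V : lmodType K) (n : nat) (g : 'I_n -> V) : Prop :=
  forall a : 'I_n -> K, \sum_(i < n) a i *: g i = 0 -> forall i, a i = 0.

Section Lower.
Variables (K : numFieldType) (k : nat).
Local Notation F := (fock K).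
Local Notation V := (tfock K k).
Local Notation A := (op K k).
Implicit Types (l : 'I_k) (m : int) (c : 'I_k -> int) (ls : seq 'I_k).
Local Notation Hom ls m0 := (Hom (@sc K k) (en K ls m0)).

Lemma supported_Xf (Q Q' : {ffun 'I_k -> monomial} -> Prop) l m (x : V) :
  (forall b, Q b -> forall b' : monomial, charge b' = charge (b l) + 2 ->
     energy b' = energy (b l) + m -> Q' (upd b l b')) ->
  supported Q x -> supported Q' (Xf l m x).
Proof.
move=> h; apply: supported_fglift => b qb.
apply: (@supported_fglift _ _ _ (fun b' => charge b' = charge (b l) + 2 /\
  energy b' = energy (b l) + m)).
  by move=> b' [h1 h2]; apply: supportedU; exact: h.
by apply: supported_e; apply: supportedU.
Qed.

Lemma wv_neq0 c : wv K c != 0.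
Proof. exact: basis_neq0. Qed.

Definition pr (C : int) : F -> F :=
  fglift (fun b : monomial => if charge b == C then << b >> else 0 : F).
HB.instance Definition _ C := GRing.Linear.on (pr C).

Lemma pr_supported C l (x : V) : supported (fun b : {ffun 'I_k -> monomial} => C < charge (b l)) x ->
  at_factor l (pr C) x = 0.
Proof.
move=> hx; rewrite /at_factor fgliftE big_seq big1 // => b.
rewrite mem_dom => /hx hb; rewrite /pr fgliftU ifF ?linear0 ?scaler0 //.
by apply/negbTE; rewrite neq_lt hb orbT.
Qed.

(* the part of [q w] in which the factor [l] is untouched involves the other
   factors only *)
Lemma Hom_lift c m0 l ls r E p : l \notin ls -> Hom ls m0 r E p ->
  exists q, [/\ Hom (l :: ls) m0 r E q,
    at_factor l (pr (c l)) (q (wv K c)) = p (wv K c) &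
    supported (fun b : {ffun 'I_k -> monomial} => c l <= charge (b l)) (q (wv K c))].
Proof.
move=> lls; elim=> {r E p} [r E||r E p p' _ [q [h1 h2 h3]] _ [q' [h1' h2' h3']]
    |r E a p _ [q [h1 h2 h3]]|r E m p _ [q [h1 h2 h3]]].
- exists 0; split; [exact: Hom0|by rewrite linear0|exact: supported0].
- exists 1; split; first exact: Hom1.
    rewrite !opf1 /wv at_factorU ffunE /pr fgliftU charge_v eqxx insU; congr << _ >>.
    by apply/ffunP => j; rewrite !ffunE; case: eqP => [->|].
  by apply: supportedU; rewrite ffunE charge_v.
- exists (q + q'); split; [exact: HomD|by rewrite !opfD linearD /= h2 h2'|exact: supportedD].
- exists (sc k a * q); split; first exact: HomZ.
    by rewrite !opfM !opf_sc linearZ /= h2.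
  by rewrite opfM; exact: supportedZ.
exists (en K (l :: ls) m0 m * q); split; first exact: HomM.
  rewrite !opfM /en /Eop !opf_sum big_cons /= linearD linear_sum /=.
  rewrite pr_supported ?add0r; last first.
    apply: supported_Xf h3 => b hb b' hb' _.
    by rewrite ffunE eqxx hb'; lia.
  rewrite big_seq [RHS]big_seq; apply: eq_bigr => l' l'ls /=.
  by rewrite /Xf at_factor_comm_neq ?h2 //; apply: contraNneq lls => ->.
rewrite opfM /en /Eop opf_sum; apply: supported_sum => l' _ /=.
apply: supported_Xf h3 => b hb b' hb' _; rewrite ffunE.
by have [e|//] := eqVneq l l'; rewrite hb' -e; lia.
Qed.

Lemma gap_incr ls c a m0 l : l \in ls -> m0 <= c l + 1 -> gap m0 (incr ls a%:Z c) l = (gap m0 c l + a)%N.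
Proof. by rewrite /gap /incr => ->; lia. Qed.

(** The induction has the same three parameters and the same branches as the one for the upper
    bound. *)
Lemma lower_bound ls c m0 r E : uniq ls -> {in ls, forall l, m0 <= c l + 1} ->
  exists n (q : 'I_n -> A), [/\ n = chi [seq gap m0 c l | l <- ls] 0 r E,
    forall i, Hom ls m0 r E (q i) & indep (fun i => q i (wv K c))].
Proof.
have [s] := ubnP (size ls); elim: s ls c r E => // s IHs [|l ls] c r E; rewrite ltnS => sls uls hls.
  case rE: ((r == 0%N) && (E == 0%N)); rewrite /= rE.
    case/andP: rE => /eqP -> /eqP ->.
    exists 1%N, (fun=> 1); split=> // [_|a]; first exact: Hom1.
    rewrite big_ord1 opf1 => /eqP; rewrite scaler_eq0 (negPf (wv_neq0 c)) orbF => /eqP a0 i.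
    by rewrite ord1.
  by exists 0%N, (fun=> 1); split=> // [[]|a _ []].
have hls' : {in ls, forall l, m0 <= c l + 1} by move=> i il; apply: hls; rewrite inE il orbT.
have /andP[lls uls'] := uls.
have [m] := ubnP r; elim: m c r E hls hls' => // m IHm c r E hls hls'; rewrite ltnS => le_rm.
have [d] := ubnP (E.+1 - sumn [seq gap m0 c l | l <- l :: ls]).
elim: d c hls hls' => // d IHd c hls hls'; rewrite ltnS => hd.
set b := [seq gap m0 c l | l <- l :: ls] in hd *.
have [lt_E|le_E] := ltnP E (sumn b).
  have [n [q [nE hq iq]]] := IHs ls c r E sls uls' hls'.
  have /choice[q' hq'] i := Hom_lift c lls (hq i).
  exists n, q'; split; first by rewrite nE [RHS]chi_trunc.
    by move=> i; case: (hq' i).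
  (* Projecting factor l to its initial charge removes every term in which a mode acted there,
     leaving the relation for the other factors. *)
  move=> a ha; apply: iq; have := congr1 (at_factor l (pr (c l))) ha.
  rewrite linear_sum linear0 => h; rewrite -[RHS]h; apply: eq_bigr => i _.
  by rewrite linearZ /=; case: (hq' i) => _ -> _.
pose c1 := incr [:: l] 1 c; pose c2 := incr (l :: ls) 2 c.
have b1 : [seq gap m0 c1 l | l <- l :: ls] = (gap m0 c l).+1 :: [seq gap m0 c l | l <- ls].
  rewrite /= gap_incr ?mem_head ?addn1 //; last exact/hls/mem_head.
  congr cons; apply/eq_in_map => i ils; rewrite /gap /c1 incr0 // inE.
  by apply: contraNneq lls => <-.
have b2 : [seq gap m0 c2 l | l <- l :: ls] = [seq x.+2 | x <- b].
  rewrite -map_comp; apply/eq_in_map => i ils /=.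
  by rewrite gap_incr ?addn2 //; exact: hls.
have hls1 : {in l :: ls, forall l, m0 <= c1 l + 1}.
  by move=> i /hls; rewrite /c1 /incr; case: ifP => _; lia.
have hls1' : {in ls, forall l, m0 <= c1 l + 1}.
  by move=> i il; apply: hls1; rewrite inE il orbT.
have hls2 : {in l :: ls, forall l, m0 <= c2 l + 1}.
  by move=> i /hls; rewrite /c2 /incr; case: ifP => _; lia.
have hls2' : {in ls, forall l, m0 <= c2 l + 1}.
  by move=> i il; apply: hls2; rewrite inE il orbT.
have [|n1 [q1 [n1E hq1 iq1]]] := IHd c1 hls1 hls1'.
  by rewrite b1; move: hd le_E; rewrite /b /=; lia.
rewrite b1 in n1E.
pose Phi : V -> V := at_factor l (@rmul_var K (c l + 1)).
have PhiX l' m' x : Phi (Xf l' m' x) = Xf l' m' (Phi x).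
  rewrite /Phi /Xf; have [->|h] := eqVneq l l'; last exact: at_factor_comm_neq.
  by apply: at_factor_comm => y; rewrite /= e_rmul.
have PhiA (p : A) x : Phi (p x) = p (Phi x).
  by rewrite /Phi (@op_comm_lin K k p (at_factor l (@rmul_var K (c l + 1)))).
have Phi1 : Phi (wv K c) = wv K c1.
  by rewrite /Phi /wv at_factorU ffunE rmul_v insU wv_upd.
have Phi2 : Phi (wv K c2) = 0.
  rewrite /Phi /wv at_factorU ffunE (@full_v _ (c2 l)) ?linear0 //.
  by rewrite /c2 /incr mem_head; lia.
have [kr|hno] := boolP ((size b <= r) && (sumn b <= E))%N; last first.
  exists n1, q1; split => //; first by rewrite n1E [RHS]chi_rec ifF ?addn0 //; exact: negbTE.
  move=> a ha; apply: iq1; have := congr1 Phi ha.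
  rewrite /Phi linear_sum linear0 => h; rewrite -[RHS]h; apply: eq_bigr => i _.
  by rewrite linearZ /= -/Phi PhiA Phi1.
have [le_kr le_TE] := andP kr.
have [|n2 [q2 [n2E hq2 iq2]]] := IHm c2 (r - size b)%N (E - sumn b)%N hls2 hls2'.
  by move: le_kr; rewrite /b /=; lia.
rewrite b2 in n2E.
have [s' s'0 hu] := ec_top K uls hls.
rewrite -/b in hu; set u := ec _ _ _ in hu.
(* [Phi] carries q1 w(c) to q1 w(c1) and kills q2 u w(c), a multiple of q2 w(c2). So the first
   coefficients of a relation vanish after applying [Phi], and then the second by independence over
   w(c2). *)
pose q (i : 'I_(n1 + n2)) := match fintype.split i with inl j => q1 j | inr j => q2 j * u end.
exists (n1 + n2)%N, q; split.
- by rewrite n1E n2E [RHS]chi_rec ifT.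
- move=> i; rewrite /q; case: (fintype.split i) => j //.
  have := Hom_mul (hq2 j) (Hom_ec (@sc K k) (en K (l :: ls) m0) (size b) (sumn b)).
  by rewrite !subnK // /u /b size_map.
move=> a; rewrite big_split_ord /=.
rewrite (eq_bigr (fun i => a (lshift n2 i) *: q1 i (wv K c))); last first.
  by move=> i _; rewrite /q -[lshift n2 i]/(unsplit (inl i)) unsplitK.
rewrite [X in _ + X](eq_bigr (fun i => a (rshift n1 i) *: q2 i (u (wv K c)))); last first.
  by move=> i _; rewrite /q -[rshift n1 i]/(unsplit (inr i)) unsplitK opfM.
move=> ha.
have a1 i : a (lshift n2 i) = 0.
  apply: (iq1 (fun i => a (lshift n2 i))).
  have := congr1 Phi ha; rewrite /Phi linear0 linearD !linear_sum /= -/Phi.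
  rewrite [X in _ + X = _]big1 ?addr0 => [h|j _]; last first.
    by rewrite /Phi linearZ /= -/Phi PhiA hu /Phi linearZ /= -/Phi Phi2 scaler0 linear0 scaler0.
  by rewrite -[RHS]h; apply: eq_bigr => j _; rewrite /Phi linearZ /= -/Phi PhiA Phi1.
have a2 i : a (rshift n1 i) = 0.
  apply: (iq2 (fun i => a (rshift n1 i))).
  move: ha; rewrite big1 ?add0r => [h|j _]; last by rewrite a1 scale0r.
  apply/eqP; have : s' *: \sum_(i < n2) a (rshift n1 i) *: q2 i (wv K c2) == 0.
    apply/eqP; rewrite -[RHS]h scaler_sumr; apply: eq_bigr => j _.
    by rewrite hu [q2 j (_ *: _)]linearZ /= !scalerA mulrC.
  by rewrite scaler_eq0 (negPf s'0).
move=> t; rewrite -[t]splitK; case: (fintype.split t) => j; [exact: a1|exact: a2].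
Qed.

End Lower.

(** * Weight spaces of the union *)

(** The transition matrix is square and of full rank. The spanning vectors from the upper bound may
    thus lie outside the weight space being measured. *)
Lemma indep_basis (K : fieldType) (V : lmodType K) n (l g : 'I_n -> V) :
  indep g -> (forall i, exists c : 'I_n -> K, g i = \sum_(j < n) c j *: l j) ->
  forall x, (exists c : 'I_n -> K, x = \sum_(j < n) c j *: l j) ->
  exists c : 'I_n -> K, x = \sum_(j < n) c j *: g j.
Proof.
move=> ig /choice[M hM] x [y ->]; pose A := \matrix_(i, j) M i j.
have comb (u : 'rV[K]_n) : \sum_i u 0 i *: g i = \sum_j (u *m A) 0 j *: l j.
  under eq_bigr => i _ do rewrite hM scaler_sumr.
  rewrite exchange_big; apply: eq_bigr => j _; rewrite mxE scaler_suml.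
  by apply: eq_bigr => i _; rewrite scalerA mxE.
have Au : A \in unitmx.
  rewrite -row_free_unit; apply/inj_row_free => u uA0.
  apply/rowP => i; rewrite mxE; apply: (ig (u 0)).
  by rewrite comb uA0 big1 // => j _; rewrite mxE scale0r.
exists ((\row_j y j *m invmx A) 0); rewrite comb mulmxKV //.
by apply: eq_bigr => j _; rewrite mxE.
Qed.

Section Polynomials.
Variables (K : numFieldType) (k : nat).
Local Notation F := (fock K).
Local Notation V := (tfock K k).
Local Notation A := (op K k).
Implicit Types (l : 'I_k) (m : int) (c : 'I_k -> int) (S : int -> bool) (C En : int).

(* the last factor comes first, as in the arguments of [chi] *)
Definition ls0 : seq 'I_k := rev (enum 'I_k).

Lemma uniq_ls0 : uniq ls0. Proof. by rewrite rev_uniq enum_uniq. Qed.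
Lemma mem_ls0 l : l \in ls0. Proof. by rewrite mem_rev mem_enum. Qed.
Lemma size_ls0 : size ls0 = k. Proof. by rewrite size_rev size_enum_ord. Qed.

Lemma coprod_ls0 m (x : V) : coprod (e m : F -> F) x = Eop K ls0 m x.
Proof.
rewrite coprod_Eop /Eop; congr (opf _ x); apply: perm_big.
by rewrite perm_sym; exact/permPl/perm_rev.
Qed.

Lemma coprod_is_linear (T : F -> F) : linear (@coprod K k T).
Proof.
move=> a x y; rewrite /coprod scaler_sumr -big_split; apply: eq_bigr => l _.
by rewrite linearP.
Qed.
HB.instance Definition _ (T : F -> F) :=
  GRing.isLinear.Build K V V _ (@coprod K k T) (coprod_is_linear T).

Inductive Pol S : A -> Prop :=
| Pol0 : Pol S 0
| Pol1 : Pol S 1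
| PolD p q : Pol S p -> Pol S q -> Pol S (p + q)
| PolZ a p : Pol S p -> Pol S (sc k a * p)
| PolM m p : S m -> Pol S p -> Pol S (Eop K ls0 m * p).

Lemma Pol_mul S p q : Pol S p -> Pol S q -> Pol S (p * q).
Proof.
move=> hp hq; elim: hp => {p} [||p p' _ h _ h'|a p _ h|m p hm _ h].
- by rewrite mul0r; exact: Pol0.
- by rewrite mul1r.
- by rewrite mulrDl; exact: PolD.
- by rewrite -mulrA; exact: PolZ.
- by rewrite -mulrA; exact: PolM.
Qed.

Lemma Pol_sub S S' p : (forall m, S m -> S' m) -> Pol S p -> Pol S' p.
Proof.
move=> h; elim=> {p} [||p p' _ h1 _ h'|a p _ h1|m p hm _ h1].
- exact: Pol0.
- exact: Pol1.
- exact: PolD.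
- exact: PolZ.
- by apply: PolM => //; exact: h.
Qed.

Lemma Pol_sum S I (s : seq I) (P : pred I) (F : I -> A) :
  (forall i, P i -> Pol S (F i)) -> Pol S (\sum_(i <- s | P i) F i).
Proof. by move=> h; elim/big_ind: _ => //; [exact: Pol0|exact: PolD]. Qed.

Lemma Hom_Pol m0 r E p : Hom (@sc K k) (en K ls0 m0) r E p -> Pol xpredT p.
Proof.
elim=> {r E p} [r E||r E p q _ h1 _ h2|r E a p _ h|r E m p _ h].
- exact: Pol0.
- exact: Pol1.
- exact: PolD.
- exact: PolZ.
- exact: PolM.
Qed.

Lemma lspan_Pol S (y x : V) :
  lspan [set x | exists ms : seq int, all S ms /\ x = foldr (fun m => coprod (e m : F -> F)) y ms] x <->
  exists2 p, Pol S p & x = p y.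
Proof.
split=> [[n [a [g [hg ->]]]]|[p hp ->]].
  have hq i : exists q : A, Pol S q /\ g i = q y.
    have [ms [hms ->]] := hg i; elim: ms hms => [_|m ms IH /= /andP[Sm /IH[q [hq ->]]]].
      by exists 1; split=> //; exact: Pol1.
    exists (Eop K ls0 m * q); split; first exact: PolM.
    by rewrite coprod_ls0.
  have /choice[q hq'] := hq.
  exists (\sum_(i < n) sc k (a i) * q i).
    by apply: Pol_sum => i _; apply: PolZ; case: (hq' i).
  by rewrite opf_sum; apply: eq_bigr => i _; case: (hq' i) => _ ->.
suff : exists n (a : 'I_n -> K) (ms : 'I_n -> seq int), (forall i, all S (ms i)) /\
   p y = \sum_(i < n) a i *: foldr (fun m => coprod (e m : F -> F)) y (ms i).
  move=> [n [a [ms [h1 ->]]]]; exists n, a, (fun i => foldr (fun m => coprod (e m : F -> F)) y (ms i)).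
  by split=> // i; exists (ms i).
elim: hp => {p} [||p p' _ [n [a [ms [h1 h2]]]] _ [n' [a' [ms' [h1' h2']]]]
  |a0 p _ [n [a [ms [h1 h2]]]]|m p hm _ [n [a [ms [h1 h2]]]]].
- by exists 0%N, (fun=> 0), (fun=> [::]); split=> //; rewrite big_ord0.
- exists 1%N, (fun=> 1), (fun=> [::]); split=> //.
  by rewrite big_ord1 scale1r.
- pose a2 (i : 'I_(n + n')) := match fintype.split i with inl j => a j | inr j => a' j end.
  pose ms2 (i : 'I_(n + n')) := match fintype.split i with inl j => ms j | inr j => ms' j end.
  exists (n + n')%N, a2, ms2; split.
    by move=> i; rewrite /ms2; case: fintype.split => j.
  rewrite opfD h2 h2' big_split_ord /=; congr (_ + _); apply: eq_bigr => i _.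
    by rewrite /a2 /ms2 -[lshift n' i]/(unsplit (inl i)) unsplitK.
  by rewrite /a2 /ms2 -[rshift n i]/(unsplit (inr i)) unsplitK.
- exists n, (fun i => a0 * a i), ms; split=> //.
  by rewrite opfM h2 opf_sc scaler_sumr; apply: eq_bigr => i _; rewrite scalerA.
exists n, a, (fun i => m :: ms i); split; first by move=> i /=; rewrite hm h1.
rewrite opfM h2 linear_sum; apply: eq_bigr => i _.
by rewrite linearZ /= coprod_ls0.
Qed.

Definition Np c (x : V) : Prop := exists2 p, Pol xpredT p & x = p (wv K c).

Definition degC (b : {ffun 'I_k -> monomial}) : int := \sum_l charge (b l).
Definition degE (b : {ffun 'I_k -> monomial}) : int := \sum_l energy (b l).

Definition hasdeg C En : V -> Prop := supported (fun b => degC b = C /\ degE b = En).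

Lemma deg_upd b l b' : degC (upd b l b') = degC b - charge (b l) + charge b' /\
  degE (upd b l b') = degE b - energy (b l) + energy b'.
Proof.
have h (f : monomial -> int) : \sum_j f (upd b l b' j) = \sum_j f (b j) - f (b l) + f b'.
  rewrite (bigD1 l) //= [in RHS](bigD1 l) //= ffunE eqxx.
  rewrite (eq_bigr (fun j => f (b j))) => [|j /negPf jl]; last by rewrite ffunE jl.
  ring.
by split; exact: h.
Qed.

Lemma hasdeg_E C En ls m x : hasdeg C En x -> hasdeg (C + 2) (En + m) (Eop K ls m x).
Proof.
move=> hx; rewrite /Eop opf_sum; apply: supported_sum => l _ /=.
apply: supported_Xf hx => b [h1 h2] b' h1' h2'.
have [-> ->] := deg_upd b l b'; rewrite h1 h2 h1' h2'; split; lia.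
Qed.

Definition c_wt c : int := \sum_l c l.
Definition e_wt c : int := \sum_l energy (v (c l)).

Lemma hasdeg_wv c : hasdeg (c_wt c) (e_wt c) (wv K c).
Proof.
apply: supportedU; rewrite /degC /degE; split; apply: eq_bigr => l _; rewrite ffunE //.
exact: charge_v.
Qed.

Lemma hasdeg_Hom c m0 ls r E p : Hom (@sc K k) (en K ls m0) r E p ->
  hasdeg (c_wt c + 2 * r%:Z) (e_wt c + r%:Z * m0 + E%:Z) (p (wv K c)).
Proof.
elim=> {r E p} [r E||r E p q _ h1 _ h2|r E a p _ h|r E m p _ h].
- exact: supported0.
- by rewrite opf1 mulr0 mul0r !addr0; exact: hasdeg_wv.
- exact: supportedD.
- exact: supportedZ.
rewrite opfM /en; have := @hasdeg_E _ _ ls (m0 + m%:Z) _ h.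
have -> : c_wt c + 2 * r%:Z + 2 = c_wt c + 2 * r.+1%:Z by lia.
have -> // : e_wt c + r%:Z * m0 + E%:Z + (m0 + m%:Z) = e_wt c + r.+1%:Z * m0 + (m + E)%N%:Z.
by rewrite PoszD (_ : r.+1%:Z = r%:Z + 1); [ring|lia].
Qed.

(** [Np] allows inhomogeneous polynomials, whereas both bounds concern one bidegree; this projection
    extracts it. *)
Definition proj C En : V -> V :=
  fglift (fun b => if (degC b == C) && (degE b == En) then << b >> else 0 : V).
HB.instance Definition _ C En := GRing.Linear.on (proj C En).

Lemma projE C En C' En' x : hasdeg C En x ->
  proj C' En' x = if (C == C') && (En == En') then x else 0.
Proof.
move=> hx; rewrite /proj fgliftE big_seq.
case: ifP => h.
  rewrite -[RHS]freeg_sumE [RHS]big_seq; apply: eq_bigr => b.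
  by rewrite mem_dom => /hx[-> ->]; rewrite h [RHS]freegUZ.
by rewrite big1 // => b; rewrite mem_dom => /hx[-> ->]; rewrite h scaler0.
Qed.

Lemma proj_E C En ls m x : proj C En (Eop K ls m x) = Eop K ls m (proj (C - 2) (En - m) x).
Proof.
apply: (@freeg_ext _ _ _ (proj C En \o Eop K ls m) (Eop K ls m \o proj (C - 2) (En - m))) => b /=.
have hb : hasdeg (degC b) (degE b) << b >> by apply: supportedU.
rewrite (projE _ _ hb) (projE _ _ (@hasdeg_E _ _ ls m _ hb)).
have -> : (degC b + 2 == C) = (degC b == C - 2) by lia.
have -> : (degE b + m == En) = (degE b == En - m) by lia.
by case: ifP => // _; rewrite linear0.
Qed.

(* the part of degree (C, En) of C[e] w, in terms of [Hom] *)
Definition homog c m0 C En (x : V) : Prop := x = 0 \/ exists r E q,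
  [/\ C = c_wt c + 2 * r%:Z, En = e_wt c + r%:Z * m0 + E%:Z,
      Hom (@sc K k) (en K ls0 m0) r E q & x = q (wv K c)].

Lemma homogD c m0 C En x y :
  homog c m0 C En x -> homog c m0 C En y -> homog c m0 C En (x + y).
Proof.
case=> [->|[r [E [q [h1 h2 h3 ->]]]]]; first by rewrite add0r.
case=> [->|[r' [E' [q' [h1' h2' h3' ->]]]]].
  by rewrite addr0; right; exists r, E, q.
have rr : r' = r by lia.
subst r'; have EE : E' = E by lia.
subst E'; right; exists r, E, (q + q'); split=> //; exact: HomD.
Qed.

Lemma proj_Pol c m0 p C En : (forall l, m0 <= c l + 1) -> Pol xpredT p ->
  homog c m0 C En (proj C En (p (wv K c))).
Proof.
move=> hm0 hp; elim: hp C En => {p} [||p p' _ h _ h'|a p _ h|m p _ _ h] C En.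
- by left; rewrite linear0.
- rewrite opf1 (projE _ _ (@hasdeg_wv c)); case: ifP => [/andP[/eqP <- /eqP <-]|_]; last by left.
  right; exists 0%N, 0%N, 1; rewrite mulr0 mul0r !addr0; split=> //; exact: Hom1.
- by rewrite opfD linearD; exact: homogD.
- rewrite opfM opf_sc linearZ /=; case: (h C En) => [->|[r [E [q [h1 h2 h3 ->]]]]].
    by left; rewrite scaler0.
  by right; exists r, E, (sc k a * q); split=> //; exact: HomZ.
rewrite opfM proj_E; case: (h (C - 2) (En - m)) => [->|[r [E [q [h1 h2 h3 ->]]]]].
  by left; rewrite linear0.
have [lt_m|le_m] := ltP m m0.
  left; rewrite -opfM mulrC opfM /Eop opf_sum big1 ?linear0 // => l _ /=.
  by rewrite Xf_wv_low //; have := hm0 l; lia.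
have [n mE] : exists n : nat, m = m0 + n%:Z by exists (absz (m - m0)%R); lia.
right; exists r.+1, (n + E)%N, (Eop K ls0 m * q); split => //; try lia.
by have := HomM n h3; rewrite /en -mE.
Qed.

Lemma Np_homog c m0 C En x : (forall l, m0 <= c l + 1) -> Np c x -> hasdeg C En x ->
  homog c m0 C En x.
Proof.
move=> hm0 [p hp xE] hx; have := proj_Pol C En hm0 hp.
by rewrite -xE (projE _ _ hx) !eqxx.
Qed.

Definition mono c := forall i j : 'I_k, (i <= j)%N -> c i <= c j.

Lemma mono_sorted c m0 : mono c -> (forall l, m0 <= c l + 1) ->
  sorted geq [seq gap m0 c l | l <- ls0].
Proof.
move=> hc hm0; rewrite /ls0 map_rev rev_sorted.
rewrite sorted_map; apply: (@sub_sorted _ (fun i j : 'I_k => i <= j)%N).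
  by move=> i j /= ij; rewrite /gap; have := hc _ _ ij; have := hm0 i; lia.
rewrite -(@sorted_map _ _ val leq) val_enum_ord.
exact: iota_sorted.
Qed.

Definition sh c (s : nat) l : int := c l - (2 * s)%:Z.

Lemma NpM c p x : Pol xpredT p -> Np c x -> Np c (p x).
Proof. by move=> hp [q hq ->]; exists (p * q) => //; exact: Pol_mul. Qed.

(** The generator w(c + 2) is obtained from w(c) by the lowest coefficient of e(z)^k; hence the
    spaces N(w_s) increase with s. *)
Lemma Np_incr c x : Np (incr ls0 2 c) x -> Np c x.
Proof.
move=> [p hp ->]; apply: NpM => //.
have [m0 hm0] : exists m0, forall l, m0 <= c l + 1.
  exists (- \sum_l `|c l|) => l.
  have h1 : - `|c l| <= c l by exact: lerNnormlW.
  have h2 : `|c l| <= \sum_l `|c l| by rewrite (bigD1 l) //= lerDl sumr_ge0.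
  by rewrite -lerBlDr (le_trans _ h1) // (le_trans (_ : _ <= - \sum_l `|c l|)) ?lerN2 // gerBl.
have [s s0 h] := ec_top K (c := c) (m0 := m0) uniq_ls0 (fun l _ => hm0 l).
move: h; set u := ec _ _ _ => h.
exists (sc k s^-1 * u); first by apply: PolZ; apply: Hom_Pol (Hom_ec _ _ _ _).
by rewrite opfM opf_sc h scalerA mulVf // scale1r.
Qed.

Lemma eq_Np c c' x : c =1 c' -> Np c x -> Np c' x.
Proof. by move=> h [p hp ->]; exists p => //; rewrite (eq_wv K h). Qed.

Lemma Np_sh c s s' x : (s <= s')%N -> Np (sh c s) x -> Np (sh c s') x.
Proof.
move=> ss'; rewrite -(subnKC ss'); elim: (s' - s)%N => [|n IH]; first by rewrite addn0.
move=> /IH h; apply: Np_incr; apply: eq_Np h => l.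
rewrite /incr mem_ls0 /sh; lia.
Qed.

Definition Lc c (x : V) : Prop := exists s, Np (sh c s) x.

(** The lower bound at s0 supplies n independent vectors. Any further x lies in some N(w_s) with s
    >= s0, where the upper bound confines the whole weight space to a span of n vectors; so x is
    already in the span of the first n. *)
Theorem dim_Lc c C En n s0 : mono c ->
  (forall s, (s0 <= s)%N -> exists m0 r E, [/\ forall l, m0 <= sh c s l + 1,
     C = c_wt (sh c s) + 2 * r%:Z, En = e_wt (sh c s) + r%:Z * m0 + E%:Z &
     n = chi [seq gap m0 (sh c s) l | l <- ls0] 0 r E]) ->
  has_dim [set x | Lc c x /\ hasdeg C En x] n.
Proof.
move=> hc H.
have mono_sh s : mono (sh c s) by move=> i j /hc; rewrite /sh; lia.
have [m0 [r [E [hm0 CE EnE nE]]]] := H s0 (leqnn _).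
have [n' [q [n'E hq iq]]] := @lower_bound K k ls0 (sh c s0) m0 r E uniq_ls0 (fun l _ => hm0 l).
have n'n : n' = n by rewrite n'E nE.
move: q hq iq; rewrite n'n => q hq iq {n' n'E n'n}.
have degq i : hasdeg C En (q i (wv K (sh c s0))).
  by rewrite CE EnE; exact: hasdeg_Hom.
have Nq s i : (s0 <= s)%N -> Np (sh c s) (q i (wv K (sh c s0))).
  by move=> hs; apply: Np_sh hs _; exists (q i) => //; apply: Hom_Pol (hq i).
exists (fun i => q i (wv K (sh c s0))); split; first exact: iq.
move=> x; split; last first.
  move=> [a ->]; split; last by apply: supported_sum => i _; apply: supportedZ; exact: degq.
  exists s0, (\sum_i sc k (a i) * q i).
    by apply: Pol_sum => i _; apply: PolZ; exact: Hom_Pol (hq i).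
  by rewrite opf_sum; apply: eq_bigr => i _.
move=> [[s1 /(Np_sh (leq_maxr s0 s1))]]; set s := maxn s0 s1 => Nx degx.
have hs : (s0 <= s)%N := leq_maxl _ _.
have {}Nq i := Nq s i hs.
have [m1 [r1 [E1 [hm1 CE1 EnE1 nE1]]]] := H s hs.
have hrel := rel_wv K (c := sh c s) (ls := ls0) (m0 := m1) (fun l _ => hm1 l)
  (mono_sorted (mono_sh s) hm1).
have [l sl hl] := upper_bound r1 E1 (graded_ann (wv K (sh c s)) ls0 m1) hrel.
have {}sl : size l = n by rewrite sl nE1.
have span y : Np (sh c s) y -> hasdeg C En y ->
    exists a : 'I_n -> K, y = \sum_(j < n) a j *: (l`_j (wv K (sh c s))).
  move=> Ny degy; have [->|[r2 [E2 [p [h1 h2 h3 ->]]]]] := Np_homog hm1 Ny degy.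
    by exists (fun=> 0); rewrite big1 // => j _; rewrite scale0r.
  have e1 : r2 = r1 by lia.
  subst r2; have e2 : E2 = E1 by lia.
  subst E2; have [cs scs] := hl p h3.
  rewrite opfB => /eqP; rewrite subr_eq0 => /eqP ->.
  exists (fun j => cs`_j); rewrite /comb opf_sum.
  rewrite (big_nth (0, 0)) size_zip scs minnn sl big_mkord; apply: eq_bigr => j _.
  by rewrite nth_zip //= opfM.
apply: (indep_basis iq) (span _ Nx degx) => i.
exact: span.
Qed.

End Polynomials.

(** * Nonpositive modes suffice *)

Section NonPositiveModes.
Variables (K : numFieldType) (k : nat) (c : 'I_k -> int).
Hypothesis mono_c : mono c.
Local Notation F := (fock K).
Local Notation V := (tfock K k).
Local Notation A := (op K k).
Local Notation W s := (wv K (sh c s)).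
Local Notation S0 := (fun m : int => m <= 0).
Local Notation E := (Eop K (ls0 k)).

Variable m0 : int.
Hypothesis hm0 : forall l, m0 <= c l + 1.

Let ms s : int := m0 - (2 * s)%:Z.
Let bs : seq nat := [seq gap m0 c l | l <- ls0 k].
Let T := sumn bs.

Let hms s l : l \in ls0 k -> ms s <= sh c s l + 1.
Proof. by move=> _; have := hm0 l; rewrite /ms /sh; lia. Qed.

Let bsE s : [seq gap (ms s) (sh c s) l | l <- ls0 k] = bs.
Proof. by apply: eq_map => l; rewrite /gap /ms /sh; congr absz; lia. Qed.

Let rel_s s : rel (en K (ls0 k) (ms s)) (fun _ _ p => p (W s) = 0) bs.
Proof.
rewrite -(bsE s); apply: rel_wv => [l /hms //|].
by apply: mono_sorted => [i j /mono_c|l]; [rewrite /sh; lia|apply: hms; exact: mem_ls0].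
Qed.

Let top_s s : exists2 a : K, a != 0 &
  ec (en K (ls0 k) (ms s.+1)) k T (W s.+1) = a *: W s.
Proof.
have [a a0 h] := ec_top K (uniq_ls0 k) (hms s.+1).
exists a => //; move: h; rewrite bsE size_ls0 => ->; congr (_ *: _).
by apply: eq_wv => l; rewrite /incr mem_ls0 /sh; lia.
Qed.

Lemma Pol_coef_exp S (p : {poly A}) j n : (forall i, Pol S p`_i) -> Pol S (p ^+ j)`_n.
Proof.
move=> hp; elim: j n => [|j IH] n.
  by rewrite expr0 coef1; case: eqP => _; [exact: Pol1|exact: Pol0].
by rewrite exprS coefM; apply: Pol_sum => i _; exact: Pol_mul.
Qed.

Definition Mneg s (x : V) : Prop := exists2 p, Pol S0 p & x = p (W s).

Lemma MnegD s x y : Mneg s x -> Mneg s y -> Mneg s (x + y).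
Proof. by move=> [p hp ->] [q hq ->]; exists (p + q) => //; exact: PolD. Qed.

Lemma MnegZ s a x : Mneg s x -> Mneg s (a *: x).
Proof. by move=> [p hp ->]; exists (sc k a * p) => //; exact: PolZ. Qed.

Lemma MnegM s p x : Pol S0 p -> Mneg s x -> Mneg s (p x).
Proof. by move=> hp [q hq ->]; exists (p * q) => //; exact: Pol_mul. Qed.

Lemma MnegZI s a x : a != 0 -> Mneg s (a *: x) -> Mneg s x.
Proof. by move=> a0 /(MnegZ a^-1); rewrite scalerA mulVf // scale1r. Qed.

(** Counted from m0 - 2s, the nonpositive modes are exactly the indices below [height s], provided
    2s >= m0. *)
Let height s : nat := absz ((2 * s)%:Z - m0 + 1)%R.
Let low s : {poly A} := \poly_(i < height s) en K (ls0 k) (ms s) i.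

Let Pol_low s i : 0 <= (2 * s)%:Z - m0 -> Pol S0 (low s)`_i.
Proof.
move=> hs; rewrite coef_poly; case: ifP => [hi|_]; last exact: Pol0.
rewrite /en -[Eop _ _ _]mulr1; apply: PolM; last exact: Pol1.
by rewrite /ms; move: hi; rewrite /height; lia.
Qed.

(** From here on T < [height s], so the coefficient that carries w_(s+1) to w_s involves nonpositive
    modes only and the spaces [Mneg s] increase. *)
Let s_mono : nat := ((T + `|m0|).+1)%N.

Let height_big s : (s_mono <= s)%N -> (T < height s)%N /\ 0 <= (2 * s)%:Z - m0.
Proof. by rewrite /s_mono /height; lia. Qed.

Let ec_low s j n : (n < height s)%N -> ec (en K (ls0 k) (ms s)) j n = (low s ^+ j)`_n.
Proof. by move=> h; rewrite (ecE _ _ h). Qed.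

Lemma Mneg_S s x : (s_mono <= s)%N -> Mneg s x -> Mneg s.+1 x.
Proof.
move=> hs [p hp ->]; apply: MnegM => //.
have [h1 h2] := height_big (leqW hs).
have [a a0 h] := top_s s; apply: (MnegZI a0); rewrite -h ec_low //.
by exists ((low s.+1 ^+ k)`_T) => //; apply: Pol_coef_exp => i; exact: Pol_low.
Qed.

Lemma Mneg_le s s' x : (s_mono <= s <= s')%N -> Mneg s x -> Mneg s' x.
Proof.
move=> /andP[hs hss']; rewrite -(subnKC hss'); elim: (s' - s)%N => [|n IH]; first by rewrite addn0.
by move=> /IH h; rewrite addnS; apply: Mneg_S => //; lia.
Qed.

Definition Uneg (x : V) : Prop := exists2 s, (s_mono <= s)%N & Mneg s x.

Lemma UnegD x y : Uneg x -> Uneg y -> Uneg (x + y).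
Proof.
move=> [s hs hx] [s' hs' hy]; exists (maxn s s'); first by rewrite leq_max hs.
by apply: MnegD; [apply: Mneg_le hx|apply: Mneg_le hy]; lia.
Qed.

Lemma Uneg0 : Uneg 0.
Proof. by exists s_mono => //; exists 0; [exact: Pol0|rewrite opf0]. Qed.

Lemma UnegZ a x : Uneg x -> Uneg (a *: x).
Proof. by move=> [s hs hx]; exists s => //; exact: MnegZ. Qed.

Lemma UnegM p x : Pol S0 p -> Uneg x -> Uneg (p x).
Proof. by move=> hp [s hs hx]; exists s => //; exact: MnegM. Qed.

Lemma Uneg_sum I (s : seq I) (P : pred I) (f : I -> V) :
  (forall i, P i -> Uneg (f i)) -> Uneg (\sum_(i <- s | P i) f i).
Proof. by move=> h; elim/big_ind: _ => //; [exact: Uneg0|exact: UnegD]. Qed.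

(* e(z)^(k+1) = 0 expresses e_m w_s through products with fewer positive modes *)
Lemma Uneg_mode (m : nat) : exists s1, forall s, (s1 <= s)%N -> Uneg (E (m.+1)%:Z (W s)).
Proof.
have [n] := ubnP m; elim: n m => // n IH m; rewrite ltnS => le_mn.
have /choice[s1 hs1] (i : nat) : exists s1, (i < m)%N -> forall s, (s1 <= s)%N -> Uneg (E (i.+1)%:Z (W s)).
  have [lt_im|le_mi] := ltnP i m; last by exists 0%N.
  by have [s1 h] := IH i (leq_trans lt_im le_mn); exists s1.
(* The summand m gives T + m < h; the sum of the s1 i exceeds every bound needed for the smaller
   modes. *)
exists (s_mono + m + \sum_(i < m) s1 i)%N => s hs.
have {}hs1 i s' : (i < m)%N -> (s <= s')%N -> Uneg (E (i.+1)%:Z (W s')).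
  move=> im ss'; apply: hs1 => //; apply: leq_trans ss'; apply: leq_trans hs.
  by rewrite (bigD1 (Ordinal im)) //= addnCA leq_addr.
have hsm : (s_mono <= s)%N by lia.
have [hT hpos] := height_big (leqW hsm).
set h := height s.+1 in hT; have hTm : (T + m < h)%N by rewrite /h /height; move: hs; rewrite /s_mono; lia.
pose N := (h + T + m).+1.
pose f := \poly_(i < N) en K (ls0 k) (ms s.+1) i.
pose g := \poly_(i < (T + m).+1) E (i.+1)%:Z.
have fE : f = 'X^h * g + low s.+1.
  apply/polyP => i; rewrite coefD coefXnM !coef_poly -/h /N.
  have [hi|hi] := ltnP i h; first by rewrite add0r ifT //; lia.
  rewrite addr0 (_ : (i - h < (T + m).+1)%N = (i < (h + T + m).+1)%N); last by lia.
  case: ifP => // _; congr (Eop _ _ _); rewrite /ms; move: hi; rewrite /h /height; lia.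
have hn : (h + T + m < N)%N by [].
have := (rel_s s.+1).2 (h + T + m)%N; rewrite size_map size_ls0 (ecE _ _ hn) -/f fE.
(* At degree h + T + m the part quadratic in the positive modes is absent, as it starts at 2h. In
   the linear part, the term with index T of [low ^+ k] turns w_(s+1) into a nonzero multiple of w_s
   and leaves the mode m + 1 on it. *)
have [q ->] := sq_expand (low s.+1) ('X^h * g) k.
rewrite !coefD [(('X^h * g) ^+ 2 * q)`_ _](_ : _ = 0) ?addr0; last first.
  by rewrite exprMn -exprM -mulrA coefXnM ifT //; lia.
rewrite mulrCA -mulrnAr coefXnM ifF; last by lia.
rewrite (_ : h + T + m - h = T + m)%N; last by lia.
have hiT : (T < (T + m).+1)%N by rewrite ltnS leq_addr.
rewrite coefMn opfD opfMn coefM opf_sum (bigD1 (Ordinal hiT)) //=.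
have Pol_exp j i : Pol S0 (low s.+1 ^+ j)`_i.
  by apply: Pol_coef_exp => i'; exact: Pol_low.
have gE i : (i <= T + m)%N -> g`_i = E (i.+1)%:Z by move=> hi; rewrite coef_poly ltnS hi.
rewrite addKn gE ?leq_addl // op_comm -(@ec_low s.+1 k T hT).
have [a a0 ->] := top_s s; rewrite linearZ /=.
set X := \sum_(i < _ | _) _; set Y := opf _ _.
move=> /eqP; rewrite mulrnDl addrCA addr_eq0 => /eqP hX.
have : Uneg (a *: E (m.+1)%:Z (W s) *+ k.+1).
  rewrite hX -scaleN1r; apply: UnegZ; apply: UnegD.
    apply: UnegM (Pol_exp _ _) _; exists s.+1; first exact: leqW.
    by exists 1; [exact: Pol1|rewrite opf1].
  rewrite -scaler_nat; apply: UnegZ; apply: Uneg_sum => i iT.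
  (* Below T the coefficient of [low ^+ k] kills w_(s+1); above T the positive mode is smaller than
     m + 1 and the induction hypothesis applies. *)
  have [lt_iT|le_Ti] := ltnP i T.
    rewrite op_comm -(@ec_low s.+1 k i (ltn_trans lt_iT hT)).
    suff -> : ec (en K (ls0 k) (ms s.+1)) k i (W s.+1) = 0 by rewrite linear0; exact: Uneg0.
    have [k0|k0] := posnP k.
      have T0 : T = 0%N by rewrite /T (size0nil (_ : size bs = 0%N)) // size_map size_ls0.
      by have T1 := leq_ltn_trans (leq0n i) lt_iT; rewrite T0 in T1.
    have sbs : size bs = k by rewrite size_map size_ls0.
    apply: (rel_s s.+1).1; first by rewrite sbs k0 leqnn.
    by have := tb_full bs; rewrite sbs => ->.
  rewrite gE; last exact: leq_subr.
  apply: UnegM => //; apply: hs1 => //.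
  have := ltn_ord i; move: iT le_Ti; rewrite -val_eqE /=; lia.
rewrite -scaler_nat scalerA => /(UnegZ ((k.+1%:R * a)^-1)).
by rewrite scalerA mulVf ?scale1r // mulf_neq0 // pnatr_eq0.
Qed.

(** For a positive mode, x is first moved to a level s large enough for [Uneg_mode]; then the mode
    is commuted onto w_s. *)
Lemma Uneg_E m x : Uneg x -> Uneg (E m x).
Proof.
move=> hx; have [hm|hm] := leP m 0.
  by rewrite -[E m]mulr1; apply: UnegM hx; apply: PolM => //; exact: Pol1.
have [n ->] : exists n : nat, m = n.+1%:Z by exists (absz (m - 1)%R); lia.
have [s1 h1] := Uneg_mode n; have [s hs hx'] := hx.
have [|p hp ->] := @Mneg_le s (maxn s s1) x _ hx'; first by rewrite hs leq_maxl.
by rewrite -opfM mulrC opfM; apply: UnegM hp _; apply: h1; rewrite leq_maxr.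
Qed.

Lemma Uneg_Pol p x : Pol xpredT p -> Uneg x -> Uneg (p x).
Proof.
move=> hp hx; elim: hp => {p} [||p p' _ h _ h'|a p _ h|m p _ _ h].
- by rewrite opf0; exact: Uneg0.
- by rewrite opf1.
- by rewrite opfD; exact: UnegD.
- by rewrite opfM opf_sc; exact: UnegZ.
- by rewrite opfM; exact: Uneg_E.
Qed.

Lemma Lc_Uneg x : Lc c x -> Uneg x.
Proof.
move=> [s hx]; have [p hp ->] := Np_sh (leq_maxl s s_mono) hx.
apply: Uneg_Pol => //; exists (maxn s s_mono); first exact: leq_maxr.
by exists 1; [exact: Pol1|rewrite opf1].
Qed.

End NonPositiveModes.

Section LDLc.
Variables (K : numFieldType) (k : nat) (D : k.+1.-tuple nat).
Local Notation F := (fock K).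

Definition cD (l : 'I_k) : int := - (beta D l)%:Z.

Lemma beta_le i j : (i <= j)%N -> (beta D j <= beta D i)%N.
Proof.
move=> ij; rewrite /beta; have [jk|kj] := leqP j k; last by rewrite big_geq // ltnW.
rewrite [X in (_ <= X)%N](@big_cat_nat _ _ _ j.+1) //=.
by rewrite leq_addl.
Qed.

Lemma mono_cD : mono cD.
Proof. by move=> i j /beta_le; rewrite /cD; lia. Qed.

Lemma beta_sumn l : (beta D l <= sumn D)%N.
Proof.
rewrite /beta sumnE [X in (_ <= X)%N](big_nth 0%N) size_tuple.
have [lk|kl] := leqP l k; last by rewrite big_geq ?ltnS ?(ltnW kl).
by rewrite [X in (_ <= X)%N](@big_cat_nat _ _ _ l.+1) //= leq_addl.
Qed.

Lemma w_wv s : w K D s = wv K (sh cD s).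
Proof. by []. Qed.

(** Modes below the lower limit in [M] commute to w_s and kill it, all charges being at least minus
    the sum of D, less 2s. *)
Lemma M_Mneg s (x : tfock K k) : M D s x <-> Mneg cD s x.
Proof.
rewrite /M w_wv; split=> [/lspan_Pol[p hp ->]|[p hp ->]].
  by exists p => //; apply: Pol_sub hp => m /andP[].
apply/lspan_Pol.
suff [q hq ->] : exists2 q, Pol (fun m => - (sumn D + 2 * s)%:Z + 1 <= m <= 0) q &
    p (wv K (sh cD s)) = q (wv K (sh cD s)) by exists q.
elim: hp => {p} [||p p' _ [q hq h] _ [q' hq' h']|a p _ [q hq h]|m p hm _ [q hq h]].
- by exists 0; [exact: Pol0|].
- by exists 1; [exact: Pol1|].
- by exists (q + q'); [exact: PolD|rewrite !opfD h h'].
- by exists (sc k a * q); [exact: PolZ|rewrite !opfM h].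
have [h1|h1] := leP (- (sumn D + 2 * s)%:Z + 1) m.
  by exists (Eop K (ls0 k) m * q); [apply: PolM; rewrite ?h1|rewrite !opfM h].
exists 0; first exact: Pol0.
rewrite opfM h -opfM mulrC opfM /Eop opf_sum big1 ?linear0 // => l _ /=.
rewrite Xf_wv_low // /sh /cD; have := beta_sumn l; lia.
Qed.

Theorem LD_Lc (x : tfock K k) : LD D x <-> Lc (K := K) cD x.
Proof.
have hm0 l : - (sumn D)%:Z <= cD l + 1 by rewrite /cD; have := beta_sumn l; lia.
split=> [[s _ /M_Mneg[p hp ->]]|/(Lc_Uneg mono_cD hm0)[s hs hx]].
  by exists s, p => //; exact: Pol_sub hp.
by exists s; [exact: leq_trans hs|exact/M_Mneg].
Qed.

End LDLc.

(** * The symmetry of the weights *)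

Lemma indep_leq (K : fieldType) (V : lmodType K) n m (g : 'I_n -> V) (l : 'I_m -> V) :
  indep g -> (forall i, exists c : 'I_m -> K, g i = \sum_(j < m) c j *: l j) -> (n <= m)%N.
Proof.
move=> ig /choice[M hM]; pose A : 'M[K]_(n, m) := \matrix_(i, j) M i j.
suff /eqP <- : row_free A by exact: rank_leq_col.
apply/inj_row_free => u uA0; apply/rowP => i; rewrite mxE; apply: (ig (u 0)).
transitivity (\sum_j (u *m A) 0 j *: l j).
  under eq_bigr => i' _ do rewrite hM scaler_sumr.
  rewrite exchange_big; apply: eq_bigr => j _; rewrite mxE scaler_suml.
  by apply: eq_bigr => i' _; rewrite scalerA mxE.
by rewrite uA0 big1 // => j _; rewrite mxE scale0r.
Qed.

Lemma has_dim_leq (K : fieldType) (V : lmodType K) (W W' : set V) n n' (f : {linear V -> V}) :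
  has_dim W n -> has_dim W' n' -> (forall x, W x -> W' (f x)) ->
  (forall x, W x -> f x = 0 -> x = 0) -> (n <= n')%N.
Proof.
move=> [g [ig hg]] [g' [_ hg']] hf finj.
have Wg i : W (g i).
  apply/hg; exists (fun j => (j == i)%:R).
  rewrite (bigD1 i) //= eqxx scale1r big1 ?addr0 // => j /negPf ->.
  by rewrite scale0r.
apply: (@indep_leq _ _ _ _ (fun i => f (g i)) g') => [a ha|i].
  apply: ig; apply: finj; first by apply/hg; exists a.
  by rewrite linear_sum -[RHS]ha; apply: eq_bigr => i _; rewrite linearZ.
by apply/hg'/hf.
Qed.

Lemma linear_freegE (K : fieldType) (T : choiceType) (M : lmodType K)
    (G : {linear {freeg T / K} -> M}) x :
  G x = \sum_(b <- dom x) coeff b x *: G << b >>.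
Proof.
rewrite -{1}[x]freeg_sumE linear_sum; apply: eq_bigr => b _.
by rewrite freegUZ linearZ.
Qed.

(** * Injectivity of powers of e on negative weights *)

Section Sl2.
Variables (K : numFieldType) (V : lmodType K) (e f : {linear V -> V}).
Variable wt : int -> V -> Prop.
Hypothesis wt_e : forall C x, wt C x -> wt (C + 2) (e x).
Hypothesis wt_f : forall C x, wt C x -> wt (C - 2) (f x).
Hypothesis efC : forall C x, wt C x -> e (f x) - f (e x) = C%:~R *: x.

Lemma wt_iter C x i : wt C x -> wt (C + 2 * i%:Z) (iter i e x).
Proof.
move=> hx; elim: i => [|i IH]; first by rewrite mulr0 addr0.
rewrite iterS (_ : C + 2 * i.+1%:Z = C + 2 * i%:Z + 2); last by lia.
exact: wt_e.
Qed.

Lemma e_iter_f C x i : wt C x -> iter i.+1 e (f x) =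
  f (iter i.+1 e x) + ((i.+1)%:Z * (C + i%:Z))%:~R *: iter i e x.
Proof.
move=> hx; elim: i => [|i IH].
  have := efC hx => /eqP; rewrite subr_eq => /eqP /= ->.
  by rewrite mul1r addr0 addrC.
rewrite iterS IH linearD linearZ /= -!iterS.
have := efC (wt_iter i.+1 hx) => /eqP; rewrite subr_eq => /eqP ->.
rewrite [_ + f _]addrC -addrA -scalerDl -rmorphD /=; congr (_ + _%:~R *: _).
have -> : i.+2%:Z = i%:Z + 2 by lia.
have -> : i.+1%:Z = i%:Z + 1 by lia.
ring.
Qed.

(** Induction on the nilpotency order j of f at x. Once f x = 0, x is a lowest weight vector, and
    the factors (i + 1)(i - n) of [e_iter_f] are nonzero for i < n. *)
Lemma iter_e_inj j n m x : wt (- n%:Z) x -> iter j f x = 0 -> (m <= n)%N ->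
  iter m e x = 0 -> x = 0.
Proof.
elim: j n m x => // j IH n m x hx fx mn ex.
(* f x has weight -(n + 2) and is killed by e^(m+1), with m + 1 <= n + 2. *)
have fx0 : f x = 0.
  apply: (IH (n + 2)%N m.+1).
  - by rewrite (_ : - (n + 2)%N%:Z = - n%:Z - 2); [exact: wt_f|lia].
  - by rewrite -iterSr.
  - by rewrite addn2 !ltnS ltnW.
  - by rewrite (e_iter_f _ hx) iterS ex !linear0 ?scaler0 addr0.
elim: m mn ex => // m IHm mn ex; apply: IHm; first exact: ltnW.
have := e_iter_f m hx; rewrite fx0 ex linear0 add0r => /esym/eqP.
rewrite (_ : iter m.+1 e 0 = 0); last by elim: (m.+1) => //= i ->; rewrite linear0.
rewrite scaler_eq0 intr_eq0 => /orP[|/eqP //].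
rewrite mulf_eq0; lia.
Qed.

End Sl2.

(** * The lowering operator f_0 on the Fock space *)

Section Lowering.
Variable K : fieldType.
Local Notation F := (fock K).
Local Notation R := (@rmul_var K).
Implicit Types (b : monomial) (u t i j : int).

Definition rem b u : monomial := if u <= 0 then u |` b else b `\ u.

Lemma occurs_rem b u t : occurs b u -> occurs (rem b u) t = (t != u) && occurs b t.
Proof.
rewrite /occurs /rem; case: (leP u 0) => hu /= ub; rewrite !inE.
  by have [->|tu] //= := eqVneq t u; rewrite hu.
by have [->|tu] //= := eqVneq t u; rewrite leNgt hu.
Qed.

(* the two variables of psi(i) phi(-i) *)
Definition pa i : int := 2 * i.
Definition pb i : int := 2 * (0 - i) + 1.

Definition empty i b := ~~ occurs b (pa i) && ~~ occurs b (pb i).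
Definition filled i b := occurs b (pa i) && occurs b (pb i).
Definition ad i b := adjoin (adjoin b (pa i)) (pb i).
Definition rm i b := rem (rem b (pa i)) (pb i).

Lemma pab i : pb i == pa i = false. Proof. by rewrite /pa /pb; lia. Qed.

Lemma occurs_ad i b t : empty i b -> occurs (ad i b) t = [|| t == pb i, t == pa i | occurs b t].
Proof.
by move=> /andP[h1 h2]; rewrite /ad !occurs_adjoin // negb_or h2 pab.
Qed.

Lemma occurs_rm i b t : filled i b -> occurs (rm i b) t = [&& t != pb i, t != pa i & occurs b t].
Proof.
by move=> /andP[h1 h2]; rewrite /rm !occurs_rem // pab h2.
Qed.

Lemma filled_ad i b : empty i b -> filled i (ad i b).
Proof. by move=> h; rewrite /filled !occurs_ad // !eqxx /= orbT. Qed.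

Lemma empty_rm i b : filled i b -> empty i (rm i b).
Proof. by move=> h; rewrite /empty !occurs_rm // !eqxx /= andbF. Qed.

Lemma rm_ad i b : empty i b -> rm i (ad i b) = b.
Proof.
move=> h; apply: occurs_inj => t; rewrite occurs_rm ?filled_ad // occurs_ad //.
have /andP[h1 h2] := h.
have [->|t1] := eqVneq t (pb i); first by rewrite (negPf h2).
by have [->|t2] := eqVneq t (pa i); first by rewrite (negPf h1).
Qed.

Lemma ad_rm i b : filled i b -> ad i (rm i b) = b.
Proof.
move=> h; apply: occurs_inj => t; rewrite occurs_ad ?empty_rm // occurs_rm //.
have /andP[h1 h2] := h.
have [->|t1] := eqVneq t (pb i); first by rewrite h2.
by have [->|t2] := eqVneq t (pa i); first by rewrite h1.
Qed.

Lemma pair_neq i j : i != j -> [/\ pa i == pa j = false, pa i == pb j = false,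
  pb i == pa j = false & pb i == pb j = false].
Proof. by rewrite /pa /pb => h; split; lia. Qed.

Lemma empty_ad i j b : i != j -> empty j b -> empty i (ad j b) = empty i b.
Proof.
by move=> /pair_neq[h1 h2 h3 h4] h; rewrite /empty !occurs_ad // h1 h2 h3 h4.
Qed.

Lemma filled_ad_neq i j b : i != j -> empty j b -> filled i (ad j b) = filled i b.
Proof.
by move=> /pair_neq[h1 h2 h3 h4] h; rewrite /filled !occurs_ad // h1 h2 h3 h4.
Qed.

Lemma empty_rm_neq i j b : i != j -> filled j b -> empty i (rm j b) = empty i b.
Proof.
by move=> /pair_neq[h1 h2 h3 h4] h; rewrite /empty !occurs_rm // h1 h2 h3 h4.
Qed.

Lemma filled_rm_neq i j b : i != j -> filled j b -> filled i (rm j b) = filled i b.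
Proof.
by move=> /pair_neq[h1 h2 h3 h4] h; rewrite /filled !occurs_rm // h1 h2 h3 h4.
Qed.

Definition E i (x : F) : F := phi (0 - i) (psi i x).
HB.instance Definition _ i := GRing.Linear.copy (E i) (R (pb i) \o R (pa i)).

Definition sg i b : K :=
  (-1) ^+ (#|` above b (pa i)| + #|` above (adjoin b (pa i)) (pb i)|)%N.

Lemma sg_sqr i b : sg i b * sg i b = 1.
Proof. by rewrite /sg -expr2 sqrr_sign. Qed.

Lemma E_basis i b : E i << b >> = if empty i b then sg i b *: << ad i b >> else 0.
Proof.
rewrite /E /phi /psi -/(pa i) -/(pb i) rmul_varU /empty.
case: ifPn => h1 /=; first by rewrite linear0.
rewrite linearZ /= rmul_varU occurs_adjoin // pab /=.
by case: ifPn => h2 /=; rewrite ?scaler0 // scalerA -exprD.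
Qed.

Lemma EC i j x : E i (E j x) = E j (E i x).
Proof.
rewrite /E /phi /psi; have rN u z : R u (- z) = - R u z by rewrite linearN.
set a := 2 * (0 - i) + 1; set b := 2 * i; set a' := 2 * (0 - j) + 1; set b' := 2 * j.
rewrite (rmul_var_anti b a' (R b' x)) (rmul_var_anti b b' x) !rN opprK.
rewrite (rmul_var_anti a a') (rmul_var_anti a b' (R b x)) !rN opprK.
by [].
Qed.

(** Removes the pair psi(i) phi(-i) with the sign with which [E i] would create it, so the two are
    mutually inverse between empty and filled pairs. *)
Definition Fl i : F -> F :=
  fglift (fun b => if filled i b then sg i (rm i b) *: << rm i b >> else 0 : F).
HB.instance Definition _ i := GRing.Linear.on (Fl i).

Lemma Fl_basis i b : Fl i << b >> = if filled i b then sg i (rm i b) *: << rm i b >> else 0.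
Proof. exact: fgliftU. Qed.

(** The share of h_0 belonging to the i-th pair, normalised by v(0), which contains exactly one
    variable of each pair. *)
Definition kap i b : int := (occurs b (pa i))%:Z + (occurs b (pb i))%:Z - 1.

Lemma comm_same i b : E i (Fl i << b >>) - Fl i (E i << b >>) = (kap i b)%:~R *: << b >>.
Proof.
rewrite E_basis Fl_basis /kap; case: ifPn => hf.
  have /andP[h1 h2] := hf; rewrite /empty h1 h2 /= linear0 subr0.
  by rewrite linearZ /= E_basis empty_rm // scalerA sg_sqr ad_rm.
rewrite linear0 sub0r; case: ifPn => he.
  rewrite linearZ /= Fl_basis filled_ad // rm_ad // scalerA sg_sqr.
  by have /andP[/negPf -> /negPf ->] := he; rewrite scale1r scaleN1r.
rewrite linear0 oppr0; move: hf he; rewrite /filled /empty.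
by case: (occurs b _); case: (occurs b _) => //= _ _; rewrite scale0r.
Qed.

Lemma comm_neq i j b : i != j -> E i (Fl j << b >>) = Fl j (E i << b >>).
Proof.
move=> ij; have ji : j != i by rewrite eq_sym.
rewrite E_basis Fl_basis.
case: ifPn => hf; last first.
  rewrite linear0; case: ifPn => he; last by rewrite linear0.
  by rewrite linearZ /= Fl_basis filled_ad_neq // (negPf hf) scaler0.
rewrite linearZ /= E_basis empty_rm_neq //.
case: ifPn => he; last by rewrite !linear0.
rewrite [Fl j _]linearZ /= Fl_basis filled_ad_neq // hf !scalerA.
set b0 := rm j b.
have he0 : empty i b0 by rewrite empty_rm_neq.
have hj0 : empty j b0 by rewrite empty_rm.
have bE : b = ad j b0 by rewrite ad_rm.
have rmE : rm j (ad i b) = ad i b0.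
  rewrite bE; have ed : ad i (ad j b0) = ad j (ad i b0).
    apply: occurs_inj => t; rewrite !occurs_ad ?empty_ad //.
    by case: (t == pb i); case: (t == pa i); case: (t == pb j); case: (t == pa j).
  by rewrite ed rm_ad ?empty_ad.
rewrite rmE; congr (_ *: _).
(* The signs are not computed: commutation of [E i] and [E j] on b0 compares the two products of
   signs, and each sign is its own inverse. *)
have := EC i j << b0 >>; rewrite !E_basis he0 hj0 !linearZ /= !E_basis !empty_ad // he0 hj0 -bE.
rewrite !scalerA => /(congr1 (coeff (ad i b))); rewrite !coeffZ.
have -> : ad j (ad i b0) = ad i b by rewrite -rmE ad_rm // filled_ad_neq.
rewrite coeffU eqxx !mulr1 => h.
by rewrite -[LHS]mulr1 -(sg_sqr i b) mulrACA h mulrACA sg_sqr mul1r mulrC.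
Qed.

(** With e_0 and h_0 this is an sl_2-triple. On a monomial only finitely many i contribute. *)
Definition f0 : F -> F := fglift (fun b => \sum_(i \in [set: int]) Fl i << b >>).
HB.instance Definition _ := GRing.Linear.on f0.

Definition rg (N : nat) : seq int := [seq p%:Z - N%:Z | p <- iota 0 (N + N).+1].

Lemma rg_uniq N : uniq (rg N).
Proof. by rewrite map_inj_uniq ?iota_uniq // => p q; lia. Qed.

Lemma mem_rg N i : (i \in rg N) = (`|i| <= N)%N.
Proof.
apply/mapP/idP => [[p]|h]; first by rewrite mem_iota => hp ->; lia.
by exists (absz (i + N%:Z)%R); [rewrite mem_iota; lia|lia].
Qed.

(** Outside the window every pair is half filled, so e_0 and f_0 become finite sums over a window
    that adding or removing pairs inside it preserves. *)
Definition good N b := forall i, (N < `|i|)%N -> ~~ empty i b && ~~ filled i b.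

Lemma good_ad N i b : (`|i| <= N)%N -> empty i b -> good N b -> good N (ad i b).
Proof.
move=> iN hi hb j hj; have ji : j != i by apply: contraTneq hj => ->; rewrite -leqNgt.
by rewrite empty_ad // filled_ad_neq //; exact: hb.
Qed.

Lemma good_rm N i b : (`|i| <= N)%N -> filled i b -> good N b -> good N (rm i b).
Proof.
move=> iN hi hb j hj; have ji : j != i by apply: contraTneq hj => ->; rewrite -leqNgt.
by rewrite empty_rm_neq // filled_rm_neq //; exact: hb.
Qed.

Lemma fsum_rg N (G : int -> F) : (forall i, (N < `|i|)%N -> G i = 0) ->
  \sum_(i \in [set: int]) G i = \sum_(i <- rg N) G i.
Proof.
move=> h; rewrite [RHS]fsbig_seq ?rg_uniq //.
apply/esym/fsbig_widen => // i /= [_ hi]; apply: h.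
by rewrite ltnNge -mem_rg; apply/negP.
Qed.

Lemma e0_good N b : good N b -> e 0 << b >> = \sum_(i <- rg N) E i << b >>.
Proof.
move=> hb; apply: fsum_rg => i hi; rewrite -/(E i << b >>) E_basis.
by have /andP[/negPf ->] := hb i hi.
Qed.

Lemma f0_good N b : good N b -> f0 << b >> = \sum_(i <- rg N) Fl i << b >>.
Proof.
move=> hb; rewrite /f0 fgliftU; apply: fsum_rg => i hi; rewrite Fl_basis.
by have /andP[_ /negPf ->] := hb i hi.
Qed.

Lemma pairs_out b N i : (forall u, u \in b -> (`|u| <= N)%N) -> (N < `|i|)%N ->
  occurs b (pa i) = (i <= 0) /\ occurs b (pb i) = (0 < i).
Proof.
move=> hb hi; have h u : (N < `|u|)%N -> occurs b u = (u <= 0).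
  move=> hu; rewrite /occurs; suff -> : u \in b = false by rewrite addbF.
  by apply/negP => /hb; rewrite leqNgt hu.
by rewrite !h /pa /pb; lia.
Qed.

Lemma charge_kap b N : (forall u, u \in b -> (`|u| <= N)%N) ->
  charge b = \sum_(i <- rg N) kap i b.
Proof.
move=> hb; pose L := [seq pa i | i <- rg N] ++ [seq pb i | i <- rg N].
pose g (u : int) : int := if 0 < u then 1 else -1.
have uL : uniq L.
  have inj_pa : injective pa by move=> i j; rewrite /pa; lia.
  have inj_pb : injective pb by move=> i j; rewrite /pb; lia.
  rewrite cat_uniq (map_inj_uniq inj_pa) (map_inj_uniq inj_pb) rg_uniq andbT andTb.
  apply/hasPn => _ /mapP[i _ ->]; apply/mapP => -[j _].
  by rewrite /pa /pb; lia.
have -> : charge b = \sum_(u <- L | u \in b) g u.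
  rewrite -big_filter; apply: perm_big; apply: uniq_perm; rewrite ?filter_uniq //.
  move=> u; rewrite mem_filter; have [ub|//] := boolP (u \in b).
  rewrite mem_cat; apply/esym/orP; have := hb u ub => hu.
  have [ev|od] : u = pa (u %/ 2)%Z \/ u = pb (- (u %/ 2)%Z) by rewrite /pa /pb; lia.
    by left; rewrite ev; apply: map_f; rewrite mem_rg; lia.
  by right; rewrite od; apply: map_f; rewrite mem_rg; lia.
transitivity (\sum_(u <- [seq pa i | i <- rg N] | u \in b) g u +
    \sum_(u <- [seq pb i | i <- rg N] | u \in b) g u); first exact: big_cat.
rewrite (big_map pa) (big_map pb) [X in X + _]big_mkcond [X in _ + X]big_mkcond -big_split.
apply: eq_bigr => i _; rewrite /= /kap.
have occE u : (occurs b u)%:Z = ((u <= 0)%R : nat)%:Z + (if u \in b then g u else 0).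
  by rewrite /occurs /g; case: (leP u 0) => hu; case: (u \in b).
rewrite !occE addrACA [X in X + _ - 1](_ : _ = 1) ?(addrC 1) ?addrK //.
by rewrite /pa /pb; lia.
Qed.

Lemma comm_e0_f0 b : e 0 (f0 << b >>) - f0 (e 0 << b >>) = (charge b)%:~R *: << b >>.
Proof.
pose N := (\sum_(u <- b) `|u|)%N.
have hN u : u \in b -> (`|u| <= N)%N.
  by move=> ub; rewrite /N (big_fsetD1 u) //= leq_addr.
have hb : good N b.
  move=> i hi; have [h1 h2] := pairs_out hN hi; rewrite /empty /filled h1 h2.
  by case: leP.
rewrite (charge_kap hN) (f0_good hb) (e0_good hb) !linear_sum -big_split /=.
rewrite (eq_big_seq (fun j => \sum_(i <- rg N) E i (Fl j << b >>) -
   \sum_(i <- rg N) Fl i (E j << b >>))) => [|j]; last first.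
  rewrite mem_rg => hj; rewrite E_basis Fl_basis; congr (_ - _).
    case: ifPn => h; last by rewrite linear0 big1 // => i _; rewrite linear0.
    rewrite linearZ /= (@e0_good N); last exact: good_rm.
    by rewrite scaler_sumr; apply: eq_bigr => i _; rewrite linearZ.
  case: ifPn => h; last by rewrite linear0 big1 // => i _; rewrite linear0.
  rewrite linearZ /= (@f0_good N); last exact: good_ad.
  by rewrite scaler_sumr; apply: eq_bigr => i _; rewrite linearZ.
rewrite sumrB [X in X - _]exchange_big /= -sumrB rmorph_sum scaler_suml.
apply: eq_big_seq => i hi; rewrite -comm_same -sumrB.
rewrite (bigD1_seq i) ?rg_uniq //= big1 ?addr0 // => j ji.
by rewrite comm_neq ?subrr // eq_sym.
Qed.

(** Only the absence of psi(0) contributes a negative amount, namely -1. At fixed energy the charge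
    is thus bounded below, which makes f_0 locally nilpotent. *)
Lemma charge_energy b : -1 <= charge b + energy b.
Proof.
rewrite /charge /energy -big_split /=.
have h : - (0 \in b)%:Z <= \sum_(u <- b)
    ((if 0 < u then 1 else -1) + (if 0 < u then (u %/ 2)%Z else - (u %/ 2)%Z)).
  have [b0|b0] := boolP (0 \in b).
    rewrite (big_fsetD1 0) //= lerDl big_seq; apply: sumr_ge0 => u.
    by rewrite !inE => /andP[u0 _]; case: ltP => hu; lia.
  rewrite oppr0 big_seq; apply: sumr_ge0 => u ub.
  have u0 : u != 0 by apply: contraTneq ub => ->.
  by case: ltP => hu; lia.
by apply: le_trans h; case: (0 \in b).
Qed.

Lemma supported_f0 (C En : int) (x : F) :
  supported (fun b => charge b = C /\ energy b = En) x ->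
  supported (fun b => charge b = C - 2 /\ energy b = En) (f0 x).
Proof.
apply: supported_fglift => b [h1 h2]; apply: supported_sum => i _; rewrite Fl_basis.
case: ifPn => h; last exact: supported0.
apply: supportedZ; apply: supportedU; have /andP[ea eb] := empty_rm h.
have : charge (ad i (rm i b)) = charge (rm i b) + 1 + 1.
  by rewrite /ad !charge_adjoin // occurs_adjoin // pab.
have : energy (ad i (rm i b)) = energy (rm i b) + (pa i %/ 2)%Z + (pb i %/ 2)%Z.
  by rewrite /ad !energy_adjoin // occurs_adjoin // pab.
by rewrite ad_rm // h1 h2 /pa /pb => h3 h4 /=; split; lia.
Qed.

End Lowering.

Section Symmetry.
Variables (K : numFieldType) (k : nat).
Local Notation F := (fock K).
Local Notation V := (tfock K k).
Implicit Types (C En : int) (x : V).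

Lemma comm_tensor b :
  coprod (e 0 : F -> F) (coprod (@f0 K) << b >>) - coprod (@f0 K) (coprod (e 0 : F -> F) << b >>) =
  (degC b)%:~R *: (<< b >> : V).
Proof.
have cc (T T' : F -> F) : coprod T (coprod T' << b >>) =
    \sum_(l < k) \sum_(l' < k) at_factor l T (at_factor l' T' << b >>) :> V.
  by apply: eq_bigr => l _; rewrite linear_sum.
rewrite !cc.
rewrite [X in _ - X]exchange_big -sumrB /= /degC rmorph_sum scaler_suml.
apply: eq_bigr => l _; rewrite -sumrB (bigD1 l) //= big1 ?addr0 => [|l' l'l]; last first.
  by rewrite at_factor_comm_neq ?subrr // eq_sym.
rewrite (at_factorU l (@f0 K)) (at_factorU l (e 0 : F -> F)) !at_factor_ins -linearB /=.
by rewrite comm_e0_f0 linearZ /= ins_id.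
Qed.

Lemma comm_hasdeg C En x : hasdeg C En x ->
  coprod (e 0 : F -> F) (coprod (@f0 K) x) - coprod (@f0 K) (coprod (e 0 : F -> F) x) = C%:~R *: x.
Proof.
move=> hx; pose G : V -> V := fun x => coprod (e 0 : F -> F) (coprod (@f0 K) x) -
  coprod (@f0 K) (coprod (e 0 : F -> F) x).
have linG : linear G.
  by move=> a y z; rewrite /G !linearP /= scalerDr addrACA.
pose GL : {linear V -> V} := HB.pack G (GRing.isLinear.Build _ _ _ _ G linG).
rewrite -[LHS]/(GL x) (linear_freegE GL) -[in RHS](freeg_sumE x) scaler_sumr.
rewrite big_seq [RHS]big_seq; apply: eq_bigr => b; rewrite mem_dom => /hx[<- _].
by rewrite [in RHS]freegUZ -[GL _]/(G << b >>) /G comm_tensor !scalerA mulrC.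
Qed.

Lemma hasdeg_f0 C En x : hasdeg C En x -> hasdeg (C - 2) En (coprod (@f0 K) x).
Proof.
move=> hx; apply: supported_sum => l _; apply: supported_fglift hx => b [h1 h2].
apply: (@supported_fglift _ _ _ (fun b' => charge b' = charge (b l) - 2 /\ energy b' = energy (b l))).
  move=> b' [h1' h2']; apply: supportedU.
  by have := deg_upd b l b'; rewrite /upd h1 h2 h1' h2' => -[e1 e2]; rewrite e1 e2; split; ring.
by apply: supported_f0; apply: supportedU.
Qed.

Lemma hasdeg_e0 C En x : hasdeg C En x -> hasdeg (C + 2) En (coprod (e 0 : F -> F) x).
Proof.
by rewrite coprod_ls0 => /(@hasdeg_E K k C En (ls0 k) 0); rewrite addr0.
Qed.

Lemma hasdeg_eq0 C En x : C + En < - k%:Z -> hasdeg C En x -> x = 0.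
Proof.
move=> h hx; rewrite -[x]freeg_sumE big_seq big1 // => b; rewrite mem_dom => /hx[h1 h2].
suff : - k%:Z <= C + En by rewrite leNgt h.
rewrite -h1 -h2 /degC /degE -big_split /= -[k in - k%:Z]card_ord -sum1_card.
rewrite -[(\sum_(_ in _) 1)%N]/(\sum_(_ in 'I_k) 1)%N.
rewrite -natz natr_sum -sumrN; apply: ler_sum => l _; exact: charge_energy.
Qed.

(** [iter_e_inj] holds on the whole tensor power, where f_0 acts; restricted to [Lc c], which e_0
    preserves, it embeds weight -n into weight n. *)
Theorem sym_leq c (n : nat) En N1 N2 :
  has_dim [set x : V | Lc (K := K) c x /\ hasdeg (- n%:Z) En x] N1 ->
  has_dim [set x : V | Lc (K := K) c x /\ hasdeg n%:Z En x] N2 -> (N1 <= N2)%N.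
Proof.
move=> h1 h2.
pose ef : {linear V -> V} := coprod (e 0 : F -> F).
have lin_iter i : linear (iter i ef).
  by elim: i => [|i IH] a x y; rewrite ?iterS ?IH ?linearP.
pose g : {linear V -> V} := HB.pack (iter n ef) (GRing.isLinear.Build _ _ _ _ _ (lin_iter n)).
have wte C x : hasdeg C En x -> hasdeg (C + 2) En (ef x) by exact: hasdeg_e0.
have wtf C x : hasdeg C En x -> hasdeg (C - 2) En (coprod (@f0 K) x) by exact: hasdeg_f0.
have efC C x : hasdeg C En x -> ef (coprod (@f0 K) x) - coprod (@f0 K) (ef x) = C%:~R *: x.
  exact: comm_hasdeg.
apply: (has_dim_leq (f := g) h1 h2) => x /= [Lx dx].
  split; last by rewrite (_ : n%:Z = - n%:Z + 2 * n%:Z); [exact: (wt_iter wte)|lia].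
  elim: (n) => //= i [s hs]; exists s; rewrite /ef /= coprod_ls0.
  by apply: NpM hs; rewrite -[Eop _ _ _]mulr1; apply: PolM => //; exact: Pol1.
pose j := (`|En| + k + 1)%N.
apply: (@iter_e_inj K V ef (coprod (@f0 K)) (fun C => hasdeg C En) wte wtf efC j n n) => //.
have hj i : hasdeg (- n%:Z - 2 * i%:Z) En (iter i (coprod (@f0 K)) x).
  elim: i => [|i IH]; first by rewrite mulr0 subr0.
  rewrite iterS (_ : - n%:Z - 2 * i.+1%:Z = - n%:Z - 2 * i%:Z - 2); first exact: wtf.
  lia.
apply: (hasdeg_eq0 _ (hj j)); rewrite /j; lia.
Qed.

End Symmetry.

(** * Power series and the counting function *)

Section PowerSeries.
Implicit Types (f g h : fps) (p q : {poly rat}).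

Definition tr (N : nat) f : {poly rat} := \poly_(i < N) f i.

Lemma coef_tr N f i : (i < N)%N -> (tr N f)`_i = f i.
Proof. by move=> h; rewrite coef_poly h. Qed.

Lemma fps_mulE N f g n : (n < N)%N -> fps_mul f g n = (tr N f * tr N g)`_n.
Proof.
move=> nN; rewrite coefM; apply: eq_bigr => i _.
have := ltn_ord i; rewrite ltnS => le_in.
by rewrite !coef_tr // (leq_ltn_trans _ nN) // leq_subr.
Qed.

Lemma fps_mulC f g : fps_mul f g =1 fps_mul g f.
Proof. by move=> n; rewrite !(@fps_mulE n.+1) // mulrC. Qed.

Lemma coefM_congr p p' q q' n : (forall i, (i <= n)%N -> p`_i = p'`_i) ->
  (forall i, (i <= n)%N -> q`_i = q'`_i) -> (p * q)`_n = (p' * q')`_n.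
Proof.
move=> hp hq; rewrite !coefM; apply: eq_bigr => i _.
have := ltn_ord i; rewrite ltnS => le_in.
by rewrite hp // hq ?leq_subr.
Qed.

Lemma fps_mulA f g h : fps_mul f (fps_mul g h) =1 fps_mul (fps_mul f g) h.
Proof.
move=> n; rewrite !(@fps_mulE n.+1) //.
transitivity ((tr n.+1 f * (tr n.+1 g * tr n.+1 h))`_n).
  by apply: coefM_congr => // i hi; rewrite coef_tr ?ltnS // (@fps_mulE n.+1) ?ltnS.
rewrite mulrA; apply: coefM_congr => // i hi.
by rewrite coef_tr ?ltnS // (@fps_mulE n.+1) ?ltnS.
Qed.

Lemma fps_mul1 f : fps_mul (fps_of_poly 1) f =1 f.
Proof.
move=> n; rewrite /fps_mul big_ord_recl /= /fps_of_poly coef1 mul1r subn0 big1 ?addr0 // => i _.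
by rewrite coef1 mul0r.
Qed.

Lemma fps_mul_congr f f' g g' n : (forall i, (i <= n)%N -> f i = f' i) ->
  (forall i, (i <= n)%N -> g i = g' i) -> fps_mul f g n = fps_mul f' g' n.
Proof.
move=> hf hg; apply: eq_bigr => i _; have := ltn_ord i; rewrite ltnS => le_in.
by rewrite hf // hg ?leq_subr.
Qed.

Lemma fps_inv_uniq f g : f 0%N != 0 -> fps_mul f g =1 fps_of_poly 1 -> g =1 fps_inv f.
Proof.
move=> f0 fg n; rewrite -fps_mul1 (fps_mul_congr (f' := fps_mul f (fps_inv f)) (g' := g)) //; last first.
  by move=> i _; rewrite fps_mulV.
rewrite fps_mulC fps_mulA (fps_mul_congr (f' := fps_of_poly 1) (g' := fps_inv f)) ?fps_mul1 // => i _.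
by rewrite fps_mulC fg.
Qed.

Lemma fps_inv_congr f g n : (forall i, (i <= n)%N -> f i = g i) -> fps_inv f n = fps_inv g n.
Proof.
move=> h; rewrite /fps_inv; congr nth.
elim: n h => [|n IH] h /=; first by rewrite h.
rewrite IH => [|i hi]; last by apply: h; exact: leqW.
congr rcons; rewrite h //; congr (_ * _); apply: eq_bigr => i _.
by rewrite h ?leq_subr.
Qed.

Lemma fps_of_polyM p q : fps_of_poly (p * q) =1 fps_mul (fps_of_poly p) (fps_of_poly q).
Proof. by move=> n; rewrite /fps_of_poly coefM. Qed.

End PowerSeries.

Lemma qfactS m : qfact m.+1 = qfact m * (1 - 'X^(m.+1)).
Proof. by rewrite /qfact big_nat_recr. Qed.

Lemma qfact_npart m : fps_mul (fps_of_poly (qfact m)) (fun n => (npart m n)%:R) =1 fps_of_poly 1.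
Proof.
elim: m => [|m IH] n.
  rewrite /qfact big_geq // fps_mul1 /fps_of_poly coef1 /=.
  by case: eqP.
rewrite (fps_mul_congr (f' := fps_mul (fps_of_poly (qfact m)) (fps_of_poly (1 - 'X^(m.+1))))
  (g' := fun n => (npart m.+1 n)%:R)) //; last by move=> i _; rewrite qfactS fps_of_polyM.
rewrite -fps_mulA -IH; apply: fps_mul_congr => // {n} n _.
rewrite (@fps_mulE n.+1) //.
rewrite (coefM_congr (p' := 1 - 'X^(m.+1)) (q' := tr n.+1 (fun n => (npart m.+1 n)%:R))) //; last first.
  by move=> i hi; rewrite coef_tr.
rewrite mulrBl mul1r coefB coefXnM coef_tr // npartS.
rewrite ltnS; case: (ltnP m n) => [lt_mn|le_nm]; last by rewrite subr0 addn0.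
by rewrite coef_tr ?ltnS ?leq_subr // natrD addrK.
Qed.

Lemma qfact0 m : (qfact m)`_0 = 1.
Proof.
elim: m => [|m IH]; first by rewrite /qfact big_geq // coef1.
by rewrite qfactS coef0M IH mul1r coefB coef1 coefXn subr0.
Qed.

Lemma qinfty_qfact m i : (i <= m)%N -> qinfty i = (qfact m)`_i.
Proof.
rewrite /qinfty => h; rewrite -(subnKC h); elim: (m - i)%N => [|d IH]; first by rewrite addn0.
by rewrite addnS qfactS mulrBr mulr1 coefB coefMXn ltnS leq_addr subr0.
Qed.

(* coefficients of 1 / ((x_0 - t)_q! (x_1 - x_0)_q! ...) *)
Fixpoint hcoef (t : nat) (x : seq nat) (n : nat) : nat :=
  if x is N :: x' then (\sum_(y < n.+1) npart (N - t) y * hcoef N x' (n - y))%N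
  else (n == 0%N).

Fixpoint qdiffs (t : nat) (x : seq nat) : {poly rat} :=
  if x is N :: x' then qfact (N - t) * qdiffs N x' else 1.

Lemma qdiffs_hcoef t x : fps_mul (fps_of_poly (qdiffs t x)) (fun n => (hcoef t x n)%:R) =1
  fps_of_poly 1.
Proof.
elim: x t => [|N x IH] t n /=.
  by rewrite fps_mul1 /fps_of_poly coef1; case: eqP.
pose P := fps_of_poly (qfact (N - t)); pose Q := fps_of_poly (qdiffs N x).
pose p : fps := fun n => (npart (N - t) n)%:R; pose q : fps := fun n => (hcoef N x n)%:R.
transitivity (fps_mul (fps_mul P Q) (fps_mul p q) n).
  apply: fps_mul_congr => i _; first exact: fps_of_polyM.
  rewrite natr_sum; apply: eq_bigr => y _; exact: natrM.
transitivity (fps_mul (fps_mul P p) (fps_mul Q q) n).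
  rewrite -!fps_mulA; apply: fps_mul_congr => // i _.
  by rewrite !fps_mulA; apply: fps_mul_congr => // j _; rewrite fps_mulC.
rewrite (fps_mul_congr (f' := fps_of_poly 1) (g' := fps_of_poly 1)) ?fps_mul1 //.
  by move=> i _; exact: qfact_npart.
by move=> i _; exact: IH.
Qed.

Lemma qdiffs_nth t N x : qdiffs t (N :: x) =
  qfact (N - t) * \prod_(0 <= j < size x) qfact (nth 0 (N :: x) j.+1 - nth 0 (N :: x) j)%N.
Proof.
elim: x t N => [|M x IH] t N; first by rewrite /= big_geq.
by rewrite [LHS]/= -/(qdiffs N (M :: x)) IH /= big_nat_recl.
Qed.

Lemma qdiffs0 t x : (qdiffs t x)`_0 = 1.
Proof. by elim: x t => [|N x IH] t /=; rewrite ?coef1 // coef0M qfact0 IH mul1r. Qed.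

(** (N)_q! and (oo)_q have the same coefficients up to q^N. This is how (oo)_q arises from the
    smallest of the N_l. *)
Lemma fps_inv_hcoef (p : {poly rat}) N x n : (n <= N)%N -> qdiffs 0 (N :: x) = qfact N * p ->
  fps_inv (fps_mul qinfty (fps_of_poly p)) n = (hcoef 0 (N :: x) n)%:R.
Proof.
move=> nN hp; have f0 : fps_of_poly (qdiffs 0 (N :: x)) 0%N != 0.
  by rewrite /fps_of_poly qdiffs0 oner_neq0.
rewrite (fps_inv_uniq f0 (@qdiffs_hcoef 0 (N :: x))); apply: fps_inv_congr => i hi.
rewrite hp fps_of_polyM; apply: fps_mul_congr => // j hj.
by rewrite (@qinfty_qfact N) //; apply: leq_trans nN; apply: leq_trans hi.
Qed.

Fixpoint enumN (k t r : nat) : seq (seq nat) :=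
  if k is k'.+1 then
    flatten [seq [seq N :: x | x <- enumN k' N (r - N)] | N <- iota t (r.+1 - t)]
  else if r == 0%N then [:: [::]] else [::].

Lemma mem_enumN k t r x :
  (x \in enumN k t r) = [&& size x == k, path leq t x & sumn x == r].
Proof.
elim: k t r x => [|k IH] t r x /=.
  case: x => [|N x] /=; last by case: eqP; rewrite ?inE.
  by rewrite eq_sym; case: eqP; rewrite ?inE.
apply/flatten_mapP/idP => [[N]|].
  rewrite mem_iota => hN /mapP[y]; rewrite IH => /and3P[h1 h2 /eqP h3] -> /=.
  by rewrite eqSS h1 h2 andbT h3 /=; apply/andP; split; [lia|apply/eqP; lia].
case: x => // N x /= /and3P[h1 /andP[h2 h3] /eqP h4].
exists N; first by rewrite mem_iota; lia.
apply: map_f; rewrite IH -eqSS h1 h3 /=; lia.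
Qed.

Lemma uniq_enumN k t r : uniq (enumN k t r).
Proof.
elim: k t r => [|k IH] t r /=; first by case: eqP.
have : uniq (iota t (r.+1 - t)) by exact: iota_uniq.
elim: (iota _ _) => //= N s IHs /andP[Ns us]; rewrite cat_uniq IHs // andbT.
rewrite map_inj_uniq ?IH; last by move=> x y [].
apply/hasPn => x /flatten_mapP[M Ms /mapP[y _ ->]]; apply/mapP => -[z _ [MN _]].
by rewrite MN (negPf Ns) in Ms.
Qed.

Fixpoint qform (b x : seq nat) : nat :=
  match b, x with
  | b0 :: b', N :: x' => (N * N.-1 + b0 * N + qform b' x')%N
  | _, _ => 0%N
  end.

Lemma chi_enum b t r E : chi b t r E =
  (\sum_(x <- enumN (size b) t r) if (qform b x <= E)%N then hcoef t x (E - qform b x) else 0)%N.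
Proof.
elim: b t r E => [|b0 b IH] t r E.
  rewrite /=; case: eqP => _; first by rewrite big_seq1 /= subn0.
  by rewrite big_nil.
rewrite [enumN _ _ _]/= big_flatten big_map /=.
transitivity (\sum_(t <= N < r.+1) \sum_(y < E.+1 | (N * N.-1 + b0 * N + y <= E)%N)
        npart (N - t) y * chi b N (r - N) (E - (N * N.-1 + b0 * N + y)))%N.
  rewrite [RHS]big_geq_mkord; apply: eq_bigl => N; by [].
apply: eq_bigr => N _; rewrite big_map.
rewrite (eq_bigr (fun y : 'I_E.+1 => \sum_(x <- enumN (size b) N (r - N)) npart (N - t) y *
   (if qform b x <= E - (N * N.-1 + b0 * N + y)
    then hcoef N x (E - (N * N.-1 + b0 * N + y) - qform b x) else 0))%N); last first.
  by move=> y _; rewrite IH big_distrr.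
rewrite exchange_big; apply: eq_bigr => x _ /=.
set q := (N * N.-1 + b0 * N)%N; set Q := qform b x.
have [hE|hE] := leqP (q + Q) E; last first.
  by rewrite big1 // => y hy; case: ifP => [|_]; [lia|rewrite muln0].
rewrite -(big_mkord (fun y => q + y <= E)%N (fun y => npart (N - t) y *
   (if (Q <= E - (q + y))%N then hcoef N x (E - (q + y) - Q) else 0))%N).
rewrite -(big_mkord xpredT (fun y => npart (N - t) y * hcoef N x (E - (q + Q) - y))%N).
rewrite (@big_cat_nat _ _ _ (E - (q + Q)).+1) //=; last by lia.
rewrite [X in (_ + X)%N]big_nat_cond [X in (_ + X)%N]big1 ?addn0; last first.
  by move=> y /andP[/andP[h1 h2] h3]; case: ifP => [|_]; [lia|rewrite muln0].
apply: congr_big_nat => // y /andP[h1 h2]; first by lia.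
by rewrite ifT; [congr (_ * hcoef _ _ _)%N; lia|lia].
Qed.

(** * The terms of the character formula *)

Lemma energy_v_sh (c : int) (s : nat) :
  energy (v (c - (2 * s)%:Z)) = energy (v c) - c * s%:Z + s%:Z * s%:Z.
Proof.
apply: (@mulfI _ 4) => //; rewrite mulrDr mulrBr !energy_v.
rewrite (_ : ((c - (2 * s)%:Z) %% 2)%Z = (c %% 2)%Z); last by lia.
rewrite PoszM; ring.
Qed.

Lemma energy_vN (c : int) : energy (v (- c)) = energy (v c).
Proof.
apply: (@mulfI _ 4) => //; rewrite !energy_v sqrrN; congr (_ - _); lia.
Qed.

Section Formula.
Variables (k : nat) (D : k.+1.-tuple nat).
Implicit Types (y : nat -> int) (x : seq nat).

(** The shift by alpha turns the index set of the formula into the nondecreasing integer sequences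
    y, since alpha_(l-1) - alpha_l = d_l/2. *)
Definition Psi y : k.-tuple rat := [tuple alpha D l + (y l)%:~R | l < k].

Lemma tnth_Psi y l : tnth (Psi y) l = alpha D l + (y l)%:~R.
Proof. exact: tnth_mktuple. Qed.

Lemma nth_Psi y l : (l < k)%N -> (Psi y)`_l = alpha D l + (y l)%:~R.
Proof. by move=> lk; rewrite -(tnth_nth 0 _ (Ordinal lk)) tnth_Psi. Qed.

Definition ndec y := forall l, (l.+1 < k)%N -> y l <= y l.+1.

Lemma alphaS l : (l < k)%N -> alpha D l = (nth 0%N D l.+1)%:R / 2 + alpha D l.+1.
Proof. by move=> lk; rewrite /alpha /beta big_ltn ?ltnS // natrD mulrDl. Qed.

Lemma indicesP i : indices D i <-> exists2 y, ndec y & i = Psi y.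
Proof.
have step y l : (l.+1 < k)%N ->
    ((Psi y)`_l - (nth 0%N D l.+1)%:R / 2 <= (Psi y)`_l.+1) = (y l <= y l.+1).
  move=> lk; rewrite !nth_Psi ?(ltnW lk) // (alphaS (ltnW lk)).
  by rewrite -addrA addrAC addrCA addrA addrK addrC lerD2l ler_int.
split=> [[h1 h2]|[y hy ->]].
  have /choice[z hz] (l : 'I_k) : exists z : int, tnth i l + alpha D l = z%:~R.
    by have /intrP[z hz] := h1 l; exists z.
  pose y (l : nat) : int := if insub l is Some j then z j - (beta D l)%:Z else 0.
  have iE : i = Psi y.
    apply: eq_from_tnth => l; rewrite tnth_Psi /y valK rmorphB /= -hz -pmulrn.
    by rewrite /alpha; field.
  by exists y => // l lk; rewrite -step // -iE; exact: h2.
split=> [l|l lk]; last by rewrite step //; exact: hy.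
rewrite tnth_Psi; apply/intrP; exists (y l + (beta D l)%:Z).
by rewrite rmorphD /= /alpha -pmulrn; field.
Qed.

(** The integer (alpha_l + y_l)^2 minus 1/4 if beta_l is odd: the contribution of factor l to the
    exponent of q. *)
Definition tm (y : nat -> int) (l : nat) : int :=
  energy (v (beta D l)%:Z) + (beta D l)%:Z * y l + y l * y l.
Definition Aq y : int := \sum_(l < k) tm y l.

Lemma tm4 y l : 4 * tm y l = (2 * y l + (beta D l)%:Z) ^+ 2 - ((beta D l)%:Z %% 2)%Z.
Proof. by rewrite /tm !mulrDr energy_v; ring. Qed.

Lemma tm_ge0 y l : 0 <= tm y l.
Proof.
have := tm4 y l; set z := 2 * _ + _ => h.
have hz : (z %% 2)%Z = ((beta D l)%:Z %% 2)%Z by rewrite /z; lia.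
have [z0|z0] := eqVneq z 0; first by move: h hz; rewrite z0; lia.
have : 1 <= z ^+ 2.
  by rewrite expr2; have [h1|h1] : z <= -1 \/ 1 <= z; [lia|nia|nia].
by move: h hz; lia.
Qed.

Lemma tm_bound y l : `|y l| <= 4 * tm y l + 1 + (beta D l)%:Z.
Proof.
have := tm4 y l; set z := 2 * _ + _ => h.
have : `|z| <= z ^+ 2 by rewrite expr2; have [h1|h1] : z <= 0 \/ 1 <= z; [lia|nia|nia].
by rewrite /z in h *; lia.
Qed.

Lemma Aq_bound y l : (l < k)%N -> tm y l <= Aq y.
Proof.
move=> lk; rewrite /Aq (bigD1 (Ordinal lk)) //= lerDl.
by apply: sumr_ge0 => i _; exact: tm_ge0.
Qed.

Lemma pD_sum : (pD D)%:R = \sum_(l < k) (((beta D l)%:Z %% 2)%Z)%:~R :> rat.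
Proof.
rewrite /pD -sum1_card natr_sum big_mkcond; apply: eq_bigr => l _.
rewrite inE /=.
have -> : (alpha D l - 2^-1 \is a Num.int) = odd (beta D l).
  apply/intrP/idP => [[z hz]|hodd].
    have : (beta D l)%:Z%:~R = (2 * z + 1)%:~R :> rat.
      by rewrite rmorphD rmorphM /= -hz /alpha -pmulrn; field.
    by move=> /intr_inj; lia.
  have bE : (beta D l)%:R = 1 + 2 * ((beta D l)./2)%:R :> rat.
    by rewrite -{1}(odd_double_half (beta D l)) hodd natrD -muln2 natrM mulrC.
  by exists ((beta D l)./2)%:Z; rewrite /alpha bE -pmulrn; field.
have -> : ((beta D l)%:Z %% 2)%Z = (odd (beta D l) : nat)%:Z by lia.
by case: (odd _).
Qed.

Lemma energy_Psi y : \sum_(l < k) tnth (Psi y) l ^+ 2 - (pD D)%:R / 4 = (Aq y)%:~R.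
Proof.
rewrite pD_sum mulr_suml -sumrB /Aq rmorph_sum; apply: eq_bigr => l _.
rewrite tnth_Psi; apply: (@mulfI _ 4) => //.
have := congr1 (fun z : int => z%:~R : rat) (tm4 y l); rewrite rmorphM /= => ->.
move: ((beta D l)%:Z %% 2)%Z => z.
by rewrite rmorphB rmorphXn rmorphD rmorphM /= /alpha -pmulrn; field.
Qed.

Definition SA : rat := \sum_(l < k) alpha D l.

Lemma sum_Psi y : \sum_(l < k) tnth (Psi y) l = SA + (\sum_(l < k) y l)%:~R.
Proof. by rewrite rmorph_sum /SA -big_split; apply: eq_bigr => l _; exact: tnth_Psi. Qed.

Definition qden y : {poly rat} := \prod_(0 <= l < k.-1) qfact (absz (y l.+1 - y l)%R).

Lemma denominator_Psi y : ndec y ->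
  denominator D (Psi y) = fps_mul qinfty (fps_of_poly (qden y)).
Proof.
move=> hy; rewrite /denominator /qden; congr (fps_mul _ (fps_of_poly _)).
apply: eq_big_nat => l /andP[_ hl]; have lk : (l.+1 < k)%N by lia.
rewrite !nth_Psi ?(ltnW lk) // (alphaS (ltnW lk)); congr qfact.
have -> : alpha D l.+1 + (y l.+1)%:~R - ((nth 0%N D l.+1)%:R / 2 + alpha D l.+1 + (y l)%:~R) +
   (nth 0%N D l.+1)%:R / 2 = (absz (y l.+1 - y l)%R)%:R :> rat.
  rewrite [RHS]pmulrn gez0_abs ?subr_ge0; last exact: hy.
  by rewrite rmorphB /=; ring.
exact: Num.Theory.natrK.
Qed.

Lemma qz_term_Psi y (En B : int) : ndec y ->
  qz_term (\sum_(l < k) tnth (Psi y) l ^+ 2 - (pD D)%:R / 4) (\sum_(l < k) tnth (Psi y) l)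
    (fps_inv (denominator D (Psi y))) En%:~R (SA + B%:~R) =
  if (\sum_(l < k) y l == B) && (Aq y <= En)
  then fps_inv (fps_mul qinfty (fps_of_poly (qden y))) (absz (En - Aq y)%R) else 0.
Proof.
move=> hy; rewrite /qz_term energy_Psi sum_Psi denominator_Psi //.
rewrite (inj_eq (addrI _)) eqr_int eq_sym -rmorphB /=.
have -> : (((En - Aq y)%:~R : rat) \is a Num.nat) = (Aq y <= En) :> bool.
  by rewrite natrEint intr_int ler0z subr_ge0.
case: ifP => // /andP[_ h].
congr (fps_inv _ _); rewrite -[in LHS](gez0_abs (_ : 0 <= En - Aq y)) ?subr_ge0 //.
by rewrite -pmulrn Num.Theory.natrK.
Qed.

Lemma ch_formula_eq0 a b : ~ (exists En B : int, a = En%:~R /\ b = SA + B%:~R) ->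
  ch_formula D a b = 0.
Proof.
move=> h; apply: fsbig1 => i /indicesP[y hy ->].
rewrite /qz_term energy_Psi sum_Psi; case: ifP => // /andP[/eqP hb /natrP[n hn]].
case: h; exists (Aq y + n%:Z), (\sum_(l < k) y l); split=> //.
by rewrite rmorphD /= -pmulrn -hn addrC subrK.
Qed.

End Formula.

Lemma qform_sum b x : size b = size x -> qform b x =
  (\sum_(j < size x) (nth 0 x j * (nth 0 x j).-1 + nth 0 b j * nth 0 x j))%N.
Proof.
elim: x b => [|N x IH] [|b0 b] //=; first by rewrite big_ord0.
by move=> [h]; rewrite big_ord_recl /= IH.
Qed.

Lemma sumn_sum x : sumn x = (\sum_(j < size x) nth 0 x j)%N.
Proof. by rewrite sumnE (big_nth 0%N) big_mkord. Qed.

Section FormulaChi.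
Variables (k : nat) (D : k.+1.-tuple nat).
Implicit Types (y : nat -> int) (x : seq nat) (eps : bool).

Local Notation Psi := (Psi D).
Local Notation Aq := (Aq D).

Definition sgn eps : int := if eps then 1 else -1.
(** Relates position j in the list of thresholds (last factor first) to the index of the
    corresponding beta. Positive charges must be taken in reverse order to be nondecreasing along
    the factors. *)
Definition tau eps (j : nat) : nat := if eps then j else (k.-1 - j)%N.

(* [ceps false] is the charge vector -beta of [LD], and [ceps true] its image
   under the symmetry h_0 -> -h_0 *)
Definition ceps eps (l : 'I_k) : int := sgn eps * (beta D (tau eps (k.-1 - l)%N))%:Z.

Lemma ceps_false l : ceps false l = cD D l.
Proof.
rewrite /ceps /cD /tau /= mulN1r (_ : (k.-1 - (k.-1 - l))%N = l) //.
by have := ltn_ord l; lia.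
Qed.

Lemma mono_ceps eps : mono (ceps eps).
Proof.
move=> i j ij; rewrite /ceps /tau /sgn; case: eps.
  by rewrite !mul1r lez_nat beta_le //; lia.
rewrite !mulN1r lerN2 lez_nat beta_le //; have := ltn_ord i; have := ltn_ord j; lia.
Qed.

Lemma tau_lt eps j : (j < k)%N -> (tau eps j < k)%N.
Proof. by rewrite /tau; case: eps => //; lia. Qed.

Lemma tauK eps j : (j < k)%N -> tau eps (tau eps j) = j.
Proof. by rewrite /tau; case: eps => //; lia. Qed.

Lemma sum_tau eps (F : nat -> int) : \sum_(j < k) F (tau eps j) = \sum_(l < k) F l.
Proof.
rewrite /tau; case: eps => //=.
rewrite [RHS](reindex_inj rev_ord_inj) /=; apply: eq_bigr => j _; congr F.
by have := ltn_ord j; lia.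
Qed.

(** The inverse of N_j = s + y for positive and N_j = s - y for negative charges; in both cases
    nondecreasing x correspond to nondecreasing y. *)
Definition yx eps (s : nat) x (l : nat) : int := sgn eps * ((nth 0%N x (tau eps l))%:Z - s%:Z).

Lemma sgnK eps : sgn eps * sgn eps = 1.
Proof. by case: eps. Qed.

Lemma yx_tau eps s x j : (j < k)%N -> yx eps s x (tau eps j) = sgn eps * ((nth 0%N x j)%:Z - s%:Z).
Proof. by move=> jk; rewrite /yx tauK. Qed.

Lemma sum_yx eps s x : size x = k ->
  \sum_(l < k) yx eps s x l = sgn eps * ((sumn x)%:Z - (k * s)%N%:Z).
Proof.
move=> sx; rewrite -(sum_tau eps) (eq_bigr (fun j : 'I_k => sgn eps * ((nth 0%N x j)%:Z - s%:Z))); last first.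
  by move=> j _; rewrite yx_tau.
rewrite -mulr_sumr sumrB sumn_sum sx; congr (_ * (_ - _)).
  by rewrite (big_morph Posz PoszD (erefl _)).
by rewrite sumr_const card_ord -mulr_natr natz PoszM mulrC.
Qed.

Lemma ndec_yx eps s x : size x = k -> path leq 0 x -> ndec k (yx eps s x).
Proof.
move=> sx /path_sorted hs l lk; rewrite /yx /sgn /tau; case: eps.
  rewrite !mul1r lerD2r lez_nat.
  by apply: (sortedP 0%N hs); rewrite sx.
rewrite !mulN1r lerN2 lerD2r lez_nat.
have -> : (k.-1 - l = (k.-1 - l.+1).+1)%N by lia.
by apply: (sortedP 0%N hs); rewrite sx; lia.
Qed.

Lemma qden_yx eps s N x : size (N :: x) = k -> path leq 0 (N :: x) ->
  qdiffs 0 (N :: x) = qfact N * qden k (yx eps s (N :: x)).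
Proof.
move=> sx hp; rewrite qdiffs_nth subn0; congr (_ * _).
have sx' : size x = k.-1 by rewrite -sx.
have hsort j : (j < k.-1)%N -> (nth 0 (N :: x) j <= nth 0 (N :: x) j.+1)%N.
  move=> hj; apply: (sortedP 0%N (path_sorted hp)); rewrite sx; lia.
rewrite sx' /qden /yx /sgn /tau; case: eps.
  apply: eq_big_nat => j /andP[_ hj]; congr qfact.
  by have := hsort j hj; lia.
rewrite big_nat_rev /=; apply: eq_big_nat => j /andP[_ hj]; congr qfact.
have -> : (0 + k.-1 - j.+1 = k.-1 - j.+1)%N by [].
have hj' : (k.-1 - j.+1 < k.-1)%N by lia.
have := hsort _ hj'.
have -> : (k.-1 - j = (k.-1 - j.+1).+1)%N by lia.
by rewrite /=; lia.
Qed.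

Lemma Psi_inj y y' : Psi y = Psi y' -> forall l, (l < k)%N -> y l = y' l.
Proof.
move=> h l lk; have := congr1 (fun t : k.-tuple rat => t`_l) h.
by rewrite !nth_Psi // => /addrI /intr_inj.
Qed.

Lemma eq_Psi y y' : (forall l, (l < k)%N -> y l = y' l) -> Psi y = Psi y'.
Proof. by move=> h; apply: eq_from_tnth => l; rewrite !tnth_Psi h. Qed.

Lemma c_wt_ceps eps s : c_wt (sh (ceps eps) s) =
  sgn eps * (\sum_(l < k) (beta D l)%:Z) - (2 * (k * s))%N%:Z.
Proof.
rewrite /c_wt /sh sumrB; congr (_ - _).
  rewrite /ceps -mulr_sumr; congr (_ * _).
  rewrite -(sum_tau eps (fun l => (beta D l)%:Z)) [RHS](reindex_inj rev_ord_inj) /=.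
  by apply: eq_bigr => l _; congr (beta _ (tau _ _))%:Z; have := ltn_ord l; lia.
by rewrite sumr_const card_ord -mulr_natr natz; lia.
Qed.

Lemma e_wt_ceps eps s : e_wt (sh (ceps eps) s) =
  \sum_(j < k) energy (v (sgn eps * (beta D (tau eps j))%:Z - (2 * s)%:Z)).
Proof.
rewrite /e_wt [RHS](reindex_inj rev_ord_inj) /=; apply: eq_bigr => l _.
rewrite /sh /ceps; congr (energy (v (_ * (beta _ (tau _ _))%:Z - _))).
by have := ltn_ord l; lia.
Qed.

Hypothesis k_gt0 : (0 < k)%N.

Lemma gaps_ceps eps s m0 : [seq gap m0 (sh (ceps eps) s) l | l <- ls0 k] =
  mkseq (fun j => absz (sgn eps * (beta D (tau eps j))%:Z - (2 * s)%:Z + 1 - m0)%R) k.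
Proof.
have -> : ls0 k = [seq rev_ord i | i <- enum 'I_k].
  apply: (@eq_from_nth _ (Ordinal k_gt0)); first by rewrite size_ls0 size_map size_enum_ord.
  rewrite size_ls0 => i ik; rewrite /ls0 nth_rev ?size_enum_ord //.
  rewrite (nth_map (Ordinal k_gt0)) ?size_enum_ord //.
  apply: val_inj; rewrite /= !nth_enum_ord //; lia.
rewrite -map_comp /mkseq -val_enum_ord -map_comp; apply: eq_map => i /=.
rewrite /gap /sh /ceps /= (_ : (k.-1 - (k - i.+1))%N = i) //.
by have := ltn_ord i; lia.
Qed.

(** Completing the square: together with the energy of the shifted vacuum, N (N - 1) + b N + m0 N
    becomes (N - s)^2 plus or minus beta (N - s), up to the energy of v(beta). *)
Lemma qform_Aq eps s m0 x : size x = k ->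
  (forall j, (j < k)%N -> m0 <= sgn eps * (beta D (tau eps j))%:Z - (2 * s)%:Z + 1) ->
  Aq (yx eps s x) = e_wt (sh (ceps eps) s) + (sumn x)%:Z * m0 +
    (qform [seq gap m0 (sh (ceps eps) s) l | l <- ls0 k] x)%:Z.
Proof.
move=> sx hm; rewrite e_wt_ceps gaps_ceps qform_sum ?size_mkseq // sx sumn_sum sx.
rewrite !(big_morph Posz PoszD (erefl _)) mulr_suml -!big_split /=.
rewrite /Aq -(sum_tau eps (tm D (yx eps s x))); apply: eq_bigr => j _.
have jk := ltn_ord j; have := hm j jk.
rewrite nth_mkseq // /tm yx_tau // energy_v_sh.
set bj := (beta D _)%:Z; set xj := nth 0%N x j.
have -> : energy (v (sgn eps * bj)) = energy (v bj).
  by case: (eps); rewrite /sgn ?mul1r // mulN1r energy_vN.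
move=> hmj.
rewrite PoszD !PoszM gez0_abs; last by rewrite subr_ge0.
have -> : xj%:Z * xj.-1%:Z = xj%:Z * xj%:Z - xj%:Z.
  by case: (xj) => [|z] //=; rewrite (_ : z.+1%:Z = z%:Z + 1); [ring|lia].
rewrite [2 * s%:Z]mulrC.
have := sgnK eps; case: (eps); rewrite /sgn => _; ring.
Qed.

End FormulaChi.

Section FormulaChi2.
Variables (k : nat) (D : k.+1.-tuple nat).
Implicit Types (y : nat -> int) (x : seq nat) (eps : bool).

Local Notation Psi := (Psi D).
Local Notation Aq := (Aq D).

Lemma Aq_ge0 y : 0 <= Aq y.
Proof. by apply: sumr_ge0 => l _; exact: tm_ge0. Qed.

Lemma y_bound y (En : int) l : (l < k)%N -> Aq y <= En ->
  `|y l| <= 4 * En + 1 + (sumn D)%:Z.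
Proof.
move=> lk h; have := tm_bound D y l.
by have := Aq_bound D y lk; have := beta_sumn D l; lia.
Qed.

Lemma e_wt_bound eps s : e_wt (sh (ceps D eps) s) <=
  \sum_(l < k) energy (v (beta D l)%:Z) + (k * sumn D * s)%N%:Z + (k * s * s)%N%:Z.
Proof.
rewrite (e_wt_ceps D eps s).
rewrite -addrA; have -> : (k * sumn D * s)%N%:Z + (k * s * s)%N%:Z =
    \sum_(j < k) ((sumn D * s)%N%:Z + (s * s)%N%:Z).
  by rewrite sumr_const card_ord -mulr_natr natz -!PoszD -PoszM; congr Posz; lia.
rewrite -(sum_tau k eps (fun l => energy (v (beta D l)%:Z))) -big_split /=.
apply: ler_sum => j _; rewrite energy_v_sh.
have -> : energy (v (sgn eps * (beta D (tau k eps j))%:Z)) = energy (v (beta D (tau k eps j))%:Z).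
  by case: (eps); rewrite /sgn ?mul1r // mulN1r energy_vN.
rewrite -addrA lerD2l -!PoszM lerD2r -mulNr PoszM; apply: ler_wpM2r => //.
by have := beta_sumn D (tau k eps j); rewrite /sgn; case: (eps); lia.
Qed.

Hypothesis k_gt0 : (0 < k)%N.

(** For fixed En and B, only boundedly many y contribute to the formula; once s exceeds their size
    they correspond exactly to the sequences N_l of [chi]. *)
Lemma formula_chi eps (En B : int) : exists s0, forall s, (s0 <= s)%N ->
  exists m0 r E, [/\ forall l, m0 <= sh (ceps D eps) s l + 1,
    r%:Z = (k * s)%N%:Z + sgn eps * B,
    En = e_wt (sh (ceps D eps) s) + r%:Z * m0 + E%:Z &
    ch_formula D En%:~R (SA D + B%:~R) =
    (chi [seq gap m0 (sh (ceps D eps) s) l | l <- ls0 k] 0 r E)%:R].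
Proof.
set e0 := \sum_(l < k) energy (v (beta D l)%:Z).
(* Large enough for r >= 0, for E >= 0 (-r m0 grows like 2ks^2 but [e_wt] only like ks^2), for all s
   + y and s - y to be nonnegative, and for N_0 to reach the degree at which 1/(oo)_q is read
   off. *)
exists (k * sumn D + 2 * `|B| + 6 * `|En| + `|e0| + sumn D + 2)%N => s hs.
pose m0 : int := - (sumn D)%:Z - (2 * s)%:Z.
have [r rE] : exists r : nat, r%:Z = (k * s)%N%:Z + sgn eps * B.
  exists (absz ((k * s)%N%:Z + sgn eps * B)%R); rewrite gez0_abs //.
  have : (s <= k * s)%N by rewrite leq_pmull.
  by rewrite /sgn; case: (eps); lia.
have hm j : m0 <= sgn eps * (beta D (tau k eps j))%:Z - (2 * s)%:Z + 1.
  by have := beta_sumn D (tau k eps j); rewrite /m0 /sgn; case: (eps); lia.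
have [E EE] : exists E : nat, En = e_wt (sh (ceps D eps) s) + r%:Z * m0 + E%:Z.
  exists (absz (En - e_wt (sh (ceps D eps) s) - r%:Z * m0)%R); rewrite gez0_abs; last first.
    have h1 := e_wt_bound eps s; rewrite -/e0 in h1.
    have h2 : (`|En| + `|e0| + (k * sumn D + 2 * `|B|) * s <= k * s * s)%N by nia.
    have h3 : - r%:Z * m0 >= 2 * (k * s * s)%N%:Z - 2 * (`|B| * s)%N%:Z.
      have : 0 <= r%:Z * (sumn D)%:Z by rewrite mulr_ge0.
      have : - (`|B| * s)%N%:Z <= sgn eps * B * s%:Z.
        by rewrite PoszM -mulNr ler_wpM2r // /sgn; case: (eps); lia.
      rewrite /m0 rE !PoszM; nia.
    nia.
  ring.
exists m0, r, E; split=> // [l|]; first by rewrite /sh /ceps.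
have QE x : size x = k -> sumn x = r ->
    Aq (yx k eps s x) = En - E%:Z + (qform [seq gap m0 (sh (ceps D eps) s) l | l <- ls0 k] x)%:Z.
  move=> sx sr; rewrite (qform_Aq k_gt0 (m0 := m0)) // sr EE; ring.
pose f i := qz_term (\sum_(l < k) tnth i l ^+ 2 - (pD D)%:R / 4) (\sum_(l < k) tnth i l)
    (fps_inv (denominator D i)) En%:~R (SA D + B%:~R).
pose Phi x := Psi (yx k eps s x).
have in_S x : x \in enumN k 0 r -> [/\ size x = k, path leq 0 x & sumn x = r].
  by rewrite mem_enumN => /and3P[/eqP -> -> /eqP ->].
have uL : uniq (map Phi (enumN k 0 r)).
  rewrite map_inj_in_uniq ?uniq_enumN // => x x' /in_S[sx _ _] /in_S[sx' _ _] /Psi_inj h.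
  apply: (@eq_from_nth _ 0%N); first by rewrite sx sx'.
  move=> j; rewrite sx => jk; have := h _ (tau_lt eps jk).
  by rewrite !yx_tau // /sgn; case: (eps); lia.
transitivity (\sum_(i <- map Phi (enumN k 0 r)) f i).
  rewrite /ch_formula [RHS]fsbig_seq //; apply/esym/fsbig_widen.
    move=> i /= hi; have /mapP[x xS ->] : i \in map Phi (enumN k 0 r) by [].
    have [sx hx _] := in_S x xS; apply/indicesP; exists (yx k eps s x) => //.
    exact: ndec_yx.
  move=> i [/indicesP[y hy ->] hi]; rewrite /= -/(f _) /f qz_term_Psi //.
  case: ifP => // /andP[/eqP hB hA]; case: hi.
  suff : Psi y \in map Phi (enumN k 0 r) by [].
  have hb l : (l < k)%N -> `|y l| <= 4 * En + 1 + (sumn D)%:Z by move=> lk; exact: y_bound.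
  pose x := mkseq (fun j => absz (s%:Z + sgn eps * y (tau k eps j))%R) k.
  have sx : size x = k by rewrite size_mkseq.
  have yE l : (l < k)%N -> yx k eps s x l = y l.
    move=> lk; rewrite /yx /x nth_mkseq ?tau_lt // tauK //.
    by have := hb l lk; rewrite /sgn; case: (eps); lia.
  rewrite (@eq_Psi k D y (yx k eps s x)) => [|l lk]; last by rewrite yE.
  apply: map_f; rewrite mem_enumN sx eqxx /=; apply/andP; split.
    have hsorted : sorted leq x.
      apply/(sortedP 0%N) => j; rewrite sx => jk.
      rewrite !nth_mkseq ?(ltnW jk) //.
      have hb1 := hb _ (tau_lt eps jk); have hb2 := hb _ (tau_lt eps (ltnW jk)).
      move: hb1 hb2; rewrite /sgn /tau; case: (eps) => hb1 hb2.
        by have := hy j jk; lia.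
      have hj : ((k.-1 - j.+1).+1 < k)%N by lia.
      have := hy _ hj; have -> : ((k.-1 - j.+1).+1 = k.-1 - j)%N by lia.
      by move: hb1 hb2; lia.
    by move: hsorted; case: (x).
  have := sum_yx eps s sx; rewrite (eq_bigr (fun l : 'I_k => y l)) => [|l _]; last by rewrite yE.
  rewrite hB => /(congr1 (fun z => sgn eps * z)); rewrite mulrA sgnK mul1r => h.
  by apply/eqP; lia.
rewrite big_map chi_enum natr_sum size_map size_ls0; apply: eq_big_seq => x /in_S[sx hx sr].
rewrite /f qz_term_Psi; last exact: ndec_yx.
rewrite sum_yx // sr rE addrAC subrr add0r mulrA sgnK mul1r eqxx /= QE //.
set Q := qform _ x.
have -> : (En - E%:Z + Q%:Z <= En) = (Q <= E)%N by lia.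
case: ifP => // hQ.
have -> : absz (En - (En - E%:Z + Q%:Z))%R = (E - Q)%N by lia.
(* It remains that E - Q <= N: here E - Q = En - Aq <= En, while [y_bound] keeps N close to s. *)
case: x sx hx sr @Q hQ => [|N x] sx hx sr Q hQ; first by move: k_gt0; rewrite -sx.
rewrite (fps_inv_hcoef (N := N) (x := x)) //; last exact: qden_yx.
have hA : Aq (yx k eps s (N :: x)) <= En by rewrite QE // -/Q; lia.
have := y_bound (tau_lt eps k_gt0) hA; rewrite yx_tau //=.
have := Aq_ge0 (yx k eps s (N :: x)); rewrite QE // -/Q /sgn; case: (eps); lia.
Qed.

End FormulaChi2.

(** * The character *)

Lemma eq_has_dim (K : fieldType) (V : lmodType K) (W W' : set V) n :
  (forall x, W x <-> W' x) -> has_dim W n -> has_dim W' n.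
Proof. by move=> h [g [ig hg]]; exists g; split=> // x; rewrite -h. Qed.

Section Main.
Variables (K : numFieldType) (k : nat) (D : k.+1.-tuple nat).
Local Notation F := (fock K).
Local Notation V := (tfock K k).
Implicit Types (x : V).

Lemma coeff_coprod_diag (f : monomial -> K) x b :
  coeff b (coprod (fglift (fun c : monomial => << f c *g c >> : F)) x) =
  (\sum_(l < k) f (b l)) * coeff b x.
Proof.
set T := fglift _; have TU b' : coprod T << b' >> = (\sum_(l < k) f (b' l)) *: << b' >> :> V.
  rewrite /coprod scaler_suml; apply: eq_bigr => l _.
  by rewrite at_factorU /T fgliftU freegUZ linearZ /= ins_id.
rewrite (linear_freegE (@coprod K k T)) raddf_sum /= -[in RHS](freeg_sumE x) raddf_sum mulr_sumr.
apply: eq_bigr => b' _; rewrite /= coeffZ TU coeffZ !coeffU mul1r.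
by have [->|_] := eqVneq b' b; [rewrite mulrCA|rewrite !mulr0].
Qed.

Lemma has_weightP (a b : rat) x : has_weight a b x <->
  supported (fun B => (degE B)%:~R = a /\ (degC B)%:~R / 2 = b) x.
Proof.
have ratr_inj : injective (@ratr K) by exact: fmorph_inj.
have h2 : (2 : K) != 0 by rewrite pnatr_eq0.
have eqC B : ((degC B)%:~R / 2 = b) <-> (2^-1 * (degC B)%:~R = ratr b :> K).
  split=> [<-|h]; first by rewrite rmorphM fmorphV /= ratr_int ratr_nat mulrC.
  by apply: ratr_inj; rewrite -h rmorphM fmorphV /= ratr_int ratr_nat mulrC.
have eqE B : ((degE B)%:~R = a) <-> ((degE B)%:~R = ratr a :> K).
  split=> [<-|h]; first by rewrite ratr_int.
  by apply: ratr_inj; rewrite -h ratr_int.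
have cE B : coeff B (coprod (@d K) x) = (degE B)%:~R * coeff B x.
  by rewrite /d coeff_coprod_diag /degE rmorph_sum.
have cC B : coeff B (coprod (@h0 K) x) = (degC B)%:~R * coeff B x.
  by rewrite /h0 coeff_coprod_diag /degC rmorph_sum.
split=> [[hd hh] B x0|hx].
  split; [apply/eqE|apply/eqC]; apply: (mulIf x0).
    by rewrite -cE hd coeffZ.
  by rewrite -mulrA -cC -coeffZ hh coeffZ.
split; apply/eqP/freeg_eqP => B; rewrite !coeffZ ?cE ?cC.
  have [->|/hx[/eqE -> _] //] := eqVneq (coeff B x) 0; by rewrite !mulr0.
have [->|/hx[_ /eqC <-]] := eqVneq (coeff B x) 0; first by rewrite !mulr0.
by rewrite mulrA.
Qed.

Lemma has_weight_int (C En : int) x :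
  has_weight En%:~R (C%:~R / 2) x <-> hasdeg C En x.
Proof.
split=> [/has_weightP h B /h[h1 h2]|h].
  split; last exact: intr_inj h1.
  by apply/(@intr_inj rat)/(mulIf _ h2).
by apply/has_weightP => B /h[-> ->].
Qed.

Lemma SA_sum : SA D = (\sum_(l < k) (beta D l)%:Z)%:~R / 2.
Proof.
by rewrite /SA rmorph_sum mulr_suml; apply: eq_bigr.
Qed.

Hypothesis k_gt0 : (0 < k)%N.

Lemma dim_formula eps (En B : int) : exists n,
  ch_formula D En%:~R (SA D + B%:~R) = n%:R /\
  has_dim [set x : V | Lc (ceps D eps) x /\
    hasdeg (sgn eps * (\sum_(l < k) (beta D l)%:Z + 2 * B)) En x] n.
Proof.
have [s0 hs] := formula_chi D k_gt0 eps En B.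
have [m1 [r1 [E1 [_ _ _ ch0]]]] := hs s0 (leqnn _).
exists (chi [seq gap m1 (sh (ceps D eps) s0) l | l <- ls0 k] 0 r1 E1); split=> //.
apply: (@dim_Lc K k (ceps D eps) _ _ _ s0); first exact: mono_ceps.
move=> s /hs[m0 [r [E [h1 h2 h3 h4]]]]; exists m0, r, E; split=> //.
  by rewrite c_wt_ceps h2 mulrDr; lia.
by apply/eqP; rewrite -(eqr_nat rat) -h4 -ch0.
Qed.

(** [dim_formula] gives the dimension of L^D in the weight opposite to the one wanted. The same
    value is the dimension for the charges +beta in the wanted weight, so [sym_leq], used once for
    each sign of the charges, bounds the two opposite weights of L^D against each other in both
    directions. *)
Lemma dim_sym (En B : int) : exists n,
  ch_formula D En%:~R (SA D + B%:~R) = n%:R /\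
  has_dim [set x : V | Lc (cD D) x /\
    hasdeg (\sum_(l < k) (beta D l)%:Z + 2 * B) En x] n.
Proof.
(* B' is chosen so that the h_0-weight Sb + 2B changes sign. *)
set Sb := \sum_(l < k) _; pose B' := - Sb - B.
have [n1 [c1 d1]] := dim_formula false En B.
have [n2 [c2 d2]] := dim_formula true En B.
have [n3 [c3 d3]] := dim_formula false En B'.
have [n4 [c4 d4]] := dim_formula true En B'.
have e12 : n1 = n2 by apply/eqP; rewrite -(eqr_nat rat) -c1 c2.
have e34 : n3 = n4 by apply/eqP; rewrite -(eqr_nat rat) -c3 c4.
exists n1; split=> //; move: d1 d2 d3 d4; rewrite -/Sb /sgn !mulN1r !mul1r.
have -> : Sb + 2 * B' = - (Sb + 2 * B) by rewrite /B'; lia.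
rewrite opprK (_ : ceps D false = cD D); last by apply/funext => l; exact: ceps_false.
set C := Sb + 2 * B => d1 d2 d3 d4.
suff -> : n1 = n3 by [].
apply/eqP; rewrite eqn_leq.
have [n Cn] : exists n : nat, C = n%:Z \/ C = - n%:Z by exists (absz C); lia.
case: Cn => Cn; rewrite Cn ?opprK in d1 d2 d3 d4.
  by rewrite (sym_leq d1 d3) e34 e12 (sym_leq d4 d2).
by rewrite (sym_leq d3 d1) e34 e12 (sym_leq d2 d4).
Qed.

Lemma LD_weight0 (a b : rat) x : ~ (exists En B : int, a = En%:~R /\ b = SA D + B%:~R) ->
  LD D x -> has_weight a b x -> x = 0.
Proof.
move=> hno /LD_Lc[s hs] /has_weightP hx.
rewrite -[x]freeg_sumE big_seq big1 // => b0; rewrite mem_dom => x0.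
exfalso; apply: hno; have [h1 h2] := hx _ x0.
have hxd : hasdeg (degC b0) (degE b0) x by apply/has_weight_int; rewrite h1 h2; apply/has_weightP.
have hm0 l : - (sumn D)%:Z - (2 * s)%:Z <= sh (cD D) s l + 1.
  by rewrite /sh /cD; have := beta_sumn D l; lia.
have [xE|[r [E [q [e1 e2 _ _]]]]] := Np_homog hm0 hs hxd.
  by move: x0; rewrite xE coeff0 eqxx.
exists (degE b0), (r%:Z - (k * s)%N%:Z - \sum_(l < k) (beta D l)%:Z); rewrite -h1 -h2; split=> //.
have -> : degC b0 = 2 * (r%:Z - (k * s)%N%:Z) - \sum_(l < k) (beta D l)%:Z.
  rewrite e1 -(_ : ceps D false = cD D); last by apply/funext => l; exact: ceps_false.
  by rewrite c_wt_ceps /sgn; lia.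
rewrite SA_sum !rmorphB rmorphM /= rmorphB /=; by field.
Qed.

Theorem character_LD : is_character (@LD K k D) (ch_formula D).
Proof.
split=> [x [s s1 [n [c [g [hg ->]]]]]|a b].
  exists n, c, g; split=> // i; have [ms [hms gE]] := hg i; split.
    exists s => //; exists 1%N, (fun=> 1), (fun=> g i); split=> [_|]; first exact: hg.
    by rewrite big_ord1 scale1r.
  suff [C [En h]] : exists C En : int, hasdeg C En (g i).
    by exists En%:~R, (C%:~R / 2); apply/has_weight_int.
  rewrite gE {gE hms}; elim: ms => [|m ms [C [En IH]]] /=.
    by exists (c_wt (sh (cD D) s)), (e_wt (sh (cD D) s)); exact: hasdeg_wv.
  by exists (C + 2), (En + m); rewrite coprod_ls0; exact: hasdeg_E.
have [[En [B [-> ->]]]|hno] := pselect (exists En B : int, a = En%:~R /\ b = SA D + B%:~R).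
  have [n [hn hd]] := dim_sym En B; exists n; split=> //.
  apply: eq_has_dim hd => x /=.
  have -> : SA D + B%:~R = (\sum_(l < k) (beta D l)%:Z + 2 * B)%:~R / 2.
    by rewrite SA_sum rmorphD rmorphM /=; field.
  by rewrite LD_Lc has_weight_int.
exists 0%N; split; last exact: ch_formula_eq0.
exists (fun=> 0); split=> [c _ []//|x]; split=> [[h1 h2]|[c ->]].
  by exists (fun=> 0); rewrite big_ord0; exact: LD_weight0 hno h1 h2.
rewrite big_ord0; split.
  by apply/LD_Lc; exists 0%N, 0; [exact: Pol0|rewrite opf0].
by apply/has_weightP; exact: supported0.
Qed.

End Main.

Theorem theorem5p1 (R : realType) (k : nat) (D : k.+1.-tuple nat)
    (hk : (1 <= k)%N) (hD : (tnth D ord_max <= 1)%N) :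
  is_character (@LD (complex R) k D) (@ch_formula k D).
Proof. exact: character_LD. Qed.
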